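(* Let $\Omega\subset\mathbb{R}^n$ be an open, bounded and definable set and let $f\colon\overline{\Omega}\to\mathbb{R}^n$ be a continuous definable mapping. The following statements hold. (i) Suppose that $x\in\Omega$ is a regular point of $f$, and $y:=f(x)$. Let $W\subset\Omega$ be an open neighborhood of $x$ such that $\overline{W}\cap f^{-1}(y)=\{x\}$. Then $$\deg(f,W,y)=\mathrm{Sign}_f(x).$$ (ii) Let $y\notin f(\partial\Omega)$ be a regular value of $f$. Then $$\deg(f,\Omega,y)=\sum_{x\in f^{-1}(y)}\mathrm{Sign}_f(x).$$
   Context: Fix an o-minimal structure on $(\mathbb{R},+,\cdot)$, i.e. a sequence $(\mathcal{D}_n)_{n\in\mathbb{N}}$ such that: (a) $\mathcal{D}_n$ is a Boolean algebra of subsets of $\mathbb{R}^n$; (b) $X\in\mathcal{D}_m$, $Y\in\mathcal{D}_n$ imply $X\times Y\in\mathcal{D}_{m+n}$; (c) if $X\in\mathcal{D}_{n+1}$ then $\pi(X)\in\mathcal{D}_n$, where $\pi\colon\mathbb{R}^{n+1}\to\mathbb{R}^n$ is the projection on the first $n$ coordinates; (d) $\mathcal{D}_n$ contains all algebraic subsets of $\mathbb{R}^n$; (e) each set in $\mathcal{D}_1$ is a finite union of points and intervals. A set is definable if it belongs to some $\mathcal{D}_n$; a mapping is definable if its graph is definable. $\mathbb{B}_r(x)$ is the open Euclidean ball of center $x$ and radius $r$; $\mathrm{co}$ denotes convex hull. For $A\in\mathbb{R}^{n\times n}$, $\sigma(A):=\inf_{\|v\|=1}\|Av\|$. $B_f$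 is the set of points of $\Omega$ at which $f$ is not of class $C^1$ (i.e. $f$ is not $C^1$ on any neighbourhood of the point); it is a definable nowhere dense set. For $x\in\Omega\setminus B_f$, $df(x)$ is the derivative of $f$ at $x$; for $U\subset\Omega$, $df(U):=\{df(x): x\in U\setminus B_f\}$. For $x\in\Omega$, $$\nu_f(x):=\lim_{r\to0^+}\ \inf_{A\in\mathrm{co}(df(\mathbb{B}_r(x)))}\sigma(A)\in[0,+\infty].$$ A point $x\in\Omega$ is a regular point of $f$ if $\nu_f(x)>0$. A point $y\in\mathbb{R}^n$ is a regular value of $f$ if $f^{-1}(y)$ is empty or all points of $f^{-1}(y)$ are regular points (for $y\notin f(\partial\Omega)$, $f^{-1}(y)\subset\Omega$). For a regular point $\overline{x}\in\Omega$ of $f$, $$\mathrm{Sign}_f(\overline{x}):=\lim_{x\in\Omega\setminus B_f,\ x\to\overline{x}}\mathrm{sign}\det df(x)$$ (this limit exists and is $\pm1$ at regular points). For a bounded open set $W\subset\mathbb{R}^n$, a continuous mapping $f\colon\overline{W}\to\mathbb{R}^n$ and $y\notin f(\partial W)$, $\deg(f,W,y)\in\mathbb{Z}$ denotes the Brouwer degree of $f$ on $W$ with respect to $y$. *)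

(* Defs.v *)
From HB Require Import structures.
From mathcomp Require Import all_boot all_order all_algebra.
From mathcomp Require Import all_classical all_reals all_analysis.
(* the notations of mpoly clash with those of mathcomp-analysis *)
From mathcomp.multinomials Require Import -(notations) mpoly.

Set Implicit Arguments.
Unset Strict Implicit.
Unset Printing Implicit Defensive.

Import Order.TTheory GRing.Theory Num.Theory.
Import numFieldNormedType.Exports.

Local Open Scope classical_set_scope.
Local Open Scope ring_scope.

(* Points of R^n are row vectors.  Accordingly a linear map of R^n is a matrix
   acting on the right, v |-> v *m A, and the derivative of f at x is the
   library's [jacobian f x], with ['d f x v = v *m jacobian f x]: it is the
   transpose of the usual Jacobian matrix. *)

Section Geometry.
Variable R : realType.

(* The library's norm on 'rV[R]_n is the sup norm. *)
Definition enorm (n : nat) (v : 'rV[R]_n) : R :=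
  Num.sqrt (\sum_(i < n) v 0 i ^+ 2).

Definition eball (n : nat) (x : 'rV[R]_n) (r : R) : set 'rV[R]_n :=
  [set z | enorm (z - x) < r].

Definition boundary (n : nat) (W : set 'rV[R]_n) : set 'rV[R]_n :=
  closure W `\` interior W.

Definition convex_hull (V : lmodType R) (S : set V) : set V :=
  [set x | exists (k : nat) (w : 'I_k -> R) (p : 'I_k -> V),
     [/\ forall i, 0 <= w i, \sum_(i < k) w i = 1, forall i, S (p i)
       & x = \sum_(i < k) w i *: p i]].

End Geometry.

Section OMinimal.
Variable R : realType.

Definition algebraic_set (n : nat) (X : set 'rV[R]_n) : Prop :=
  exists s : seq (mpoly n R),
    X = [set x : 'rV[R]_n | forall p, p \in s -> meval (fun i => x 0 i) p = 0].

(* Points are the degenerate intervals `[a, a]; intervals may be unbounded. *)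
Definition finite_union_of_intervals (X : set 'rV[R]_1) : Prop :=
  exists s : seq (interval R),
    X = [set x : 'rV[R]_1 | exists2 I : interval R, I \in s & x 0 0 \in I].

Record ominimal (D : forall n : nat, set (set 'rV[R]_n)) : Prop := {
  ominimal_set0 : forall n, D n set0 ;
  ominimal_setU : forall n (X Y : set 'rV[R]_n),
    D n X -> D n Y -> D n (X `|` Y) ;
  ominimal_setC : forall n (X : set 'rV[R]_n), D n X -> D n (~` X) ;
  ominimal_prod : forall m n (X : set 'rV[R]_m) (Y : set 'rV[R]_n),
    D m X -> D n Y ->
    D (m + n)%N [set z : 'rV[R]_(m + n) | X (lsubmx z) /\ Y (rsubmx z)] ;
  ominimal_proj : forall n (X : set 'rV[R]_(n + 1)),
    D (n + 1)%N X -> D n (lsubmx @` X) ;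
  ominimal_algebraic : forall n (X : set 'rV[R]_n), algebraic_set X -> D n X ;
  ominimal_dim1 : forall X : set 'rV[R]_1,
    D 1%N X -> finite_union_of_intervals X }.

(* [f] is only meaningful on its domain [A]. *)
Definition definable_map (D : forall n : nat, set (set 'rV[R]_n)) (m n : nat)
    (A : set 'rV[R]_m) (f : 'rV[R]_m -> 'rV[R]_n) : Prop :=
  D (m + n)%N [set z : 'rV[R]_(m + n) | A (lsubmx z) /\ rsubmx z = f (lsubmx z)].

End OMinimal.

Section Differential.
Variables (R : realType) (n : nat).
Implicit Types (f g : 'rV[R]_n -> 'rV[R]_n) (x y : 'rV[R]_n).

(* Class C^k on an open set [U]. *)
Fixpoint Ck (k : nat) (U : set 'rV[R]_n) f : Prop :=
  match k with
  | 0%N => forall x, U x -> {for x, continuous f}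
  | k'.+1 => (forall x, U x -> differentiable f x) /\
             (forall v, Ck k' U (fun x => 'D_v f x))
  end.

Definition smooth f : Prop := forall k, Ck k setT f.

Section Regular.
Variables (Omega : set 'rV[R]_n) (f : 'rV[R]_n -> 'rV[R]_n).

(* B_f *)
Definition singular_locus : set 'rV[R]_n :=
  [set x | Omega x /\
     ~ exists U, [/\ open U, U x, U `<=` Omega & Ck 1 U f]].

(* df(U) *)
Definition dimage (U : set 'rV[R]_n) : set 'M[R]_n :=
  [set jacobian f x | x in U `&` (Omega `\` singular_locus)].

Definition sigma (A : 'M[R]_n) : \bar R :=
  ereal_inf [set (enorm (v *m A))%:E | v in [set v : 'rV[R]_n | enorm v = 1]].

(* The infimum is monotone in r, so the limit exists in \bar R. *)
Definition nu x : \bar R :=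
  lim (ereal_inf [set sigma A | A in convex_hull (dimage (eball x r))]
         @[r --> 0^'+]).

Definition regular_point x : Prop := Omega x /\ (0 < nu x)%E.

(* f^{-1}(y), for f defined on the closure of Omega *)
Definition fiber y : set 'rV[R]_n := [set x | closure Omega x /\ f x = y].

Definition regular_value y : Prop := forall x, fiber y x -> regular_point x.

Definition Sign x : R :=
  lim (Num.sg (\det (jacobian f z))
         @[z --> within (Omega `\` singular_locus) (nbhs x)]).

End Regular.

(* [g] is a smooth approximation of [f] that computes the degree:
   sup_{closure W} |g - f| < dist(y, f(boundary W)), written pointwise (both
   extrema are attained when W is bounded and f is continuous on its closure),
   and y is a regular value of g on W. *)
Definition degree_approximation f (W : set 'rV[R]_n) y g : Prop :=
  [/\ smooth g,
      forall x z, closure W x -> boundary W z ->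
        enorm (g x - f x) < enorm (f z - y)
    & forall x, W x -> g x = y -> \det (jacobian g x) != 0].

(* Brouwer degree of f : closure W -> R^n with respect to y, for W bounded and
   open, f continuous and y outside f(boundary W): the signed number of
   preimages of y under any such g (their number is finite, and the value does
   not depend on g). *)
Definition degree f (W : set 'rV[R]_n) y : int :=
  xget 0 [set d : int | exists2 g, degree_approximation f W y g &
    d = \sum_(x \in [set x | W x /\ g x = y]) sgz (\det (jacobian g x))].

End Differential.

(* Main.v *)
Require Import Defs.
From HB Require Import structures.
From mathcomp Require Import all_boot all_order all_algebra all_fingroup.
From mathcomp Require Import all_classical all_reals all_analysis.
From mathcomp.multinomials Require Import -(notations) mpoly.
From mathcomp Require Import finmap zify ring lra.
Set Implicit Arguments.
Unset Strict Implicit.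
Unset Printing Implicit Defensive.
Import Order.TTheory GRing.Theory Num.Theory.
Import numFieldNormedType.Exports.
Local Open Scope ring_scope.

(* Near a regular point [x], [f - f x] is never opposite to the linear map
   [v |-> v *m A] with [A] = [jacobian f z], [z] close to [x]: the convex set
   [co (df (B_r x))] applied to [v] stays away from [0], hence is separated from
   it by some [u], and [dot u (f (x + v) - f x)] is positive by a mean value
   argument.  The latter, and the density of the points where [f] is [C^1], come
   from the Baire theorem, since by o-minimality a definable set that is dense
   in an open set contains an open set.

   The degree is computed on fine triangulations of a torus: a simplex counts
   when it is mapped around [y], and this count is a coboundary, so it
   depends only on the direction of [f - y] near the boundary.  Localising it at
   the zeros yields the sum of signs of [det A], for [f] as well as for
   approximations defining the degree; these exist by Bernstein's theorem and a
   counting proof of Sard's. *)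

(** * Counting the simplices around the origin *)

Section SimplexCount.
Variables (R : realFieldType) (n : nat).

(** Since [degree] selects a value by [xget], an approximation must exist and all of them must give
    the same sum. Instead of comparing two approximations, each [g] is compared with [f] itself: the
    count on a grid makes sense for any continuous map, and the resulting sum over the zeros of [f]
    no longer involves [g]. The obstacle is that [f] need not be differentiable at a zero. What
    remains there is that each nearby point has some [u] with positive product with both [f - y] and
    the linear model. This condition is open, so one [u] serves all vertices of a small cell, and
    such a cell then counts zero for any mixture of the two maps. The count follows the ray through
    some [q], which has to avoid faces of codimension two. A suitable [q] depends on the grid, so
    statements are made for fine grids and generic [q], and instantiated only when the counts are
    compared. On the o-minimal side the axiom on subsets of the line is the only source of
    finiteness. Baire's theorem, applied to countable families of definable sets indexed by integers
    or rational intervals, carries it to higher dimension in place of cell decomposition. *)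

Definition dot (u v : 'rV[R]_n) : R := \sum_i u 0 i * v 0 i.

Lemma dotDr u v w : dot u (v + w) = dot u v + dot u w.
Proof. by rewrite -big_split; apply: eq_bigr => i _; rewrite mxE mulrDr. Qed.

Lemma dotC u v : dot u v = dot v u.
Proof. by apply: eq_bigr => i _; rewrite mulrC. Qed.

Lemma dotZr u a v : dot u (a *: v) = a * dot u v.
Proof. by rewrite mulr_sumr; apply: eq_bigr => i _; rewrite mxE mulrCA. Qed.

Lemma dotNr u v : dot u (- v) = - dot u v.
Proof. by rewrite -scaleN1r dotZr mulN1r. Qed.

Lemma dotBr u v w : dot u (v - w) = dot u v - dot u w.
Proof. by rewrite dotDr dotNr. Qed.

Lemma dot0r u : dot u 0 = 0.
Proof. by rewrite -[0 in LHS](scale0r 0) dotZr mul0r. Qed.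

Lemma dot_sumr (I : Type) (r : seq I) (P : pred I) u (F : I -> 'rV[R]_n) :
  dot u (\sum_(i <- r | P i) F i) = \sum_(i <- r | P i) dot u (F i).
Proof. by apply: (big_morph (dot u)) => [v w|]; rewrite ?dotDr ?dot0r. Qed.

Lemma dot_ge0 u : 0 <= dot u u.
Proof. by apply: sumr_ge0 => i _; rewrite -expr2 sqr_ge0. Qed.

Lemma dot_gt0 u : u != 0 -> 0 < dot u u.
Proof.
move=> u0; rewrite lt_neqAle dot_ge0 andbT eq_sym; apply: contra u0 => /eqP e.
apply/eqP/rowP => i; rewrite mxE; apply/eqP; move/eqP: e.
rewrite psumr_eq0; last by move=> j _; rewrite -expr2 sqr_ge0.
by move=> /allP/(_ i); rewrite mem_index_enum => /(_ isT)/=; rewrite mulf_eq0 orbb.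
Qed.

(** The ray through such a [q] meets the cone on a facet only in its relative interior. Counting
    nonzero coefficients, rather than excluding hyperplanes, allows families with repetitions or
    dependent vectors. *)
Definition generic (I : finType) (a : I -> 'rV[R]_n) (q : 'rV[R]_n) : Prop :=
  forall c : I -> R, q = \sum_i c i *: a i -> (n <= #|[set i | c i != 0%R]|)%N.

(** Adding up the coefficients along the fibres of [phi] can only shrink the support, so [phi] need
    not be injective. One generic [q] for all vertices of a grid thus serves every single
    simplex. *)
Lemma generic_comp (I J : finType) (a : I -> 'rV[R]_n) (phi : J -> I) q :
  generic a q -> generic (a \o phi) q.
Proof.
move=> ga c qE; pose c' i := \sum_(j | phi j == i) c j.
have qE' : q = \sum_i c' i *: a i.
  rewrite qE (partition_big phi predT) //=; apply: eq_bigr => i _.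
  by rewrite scaler_suml; apply: eq_bigr => j /eqP ->.
apply: leq_trans (ga _ qE') _.
apply: leq_trans (leq_imset_card phi [set j | c j != 0]).
apply/subset_leq_card/fintype.subsetP => i; rewrite inE => ci.
have [j /andP[/eqP <- cj]] : exists j, (phi j == i) && (c j != 0).
  apply/existsP; apply: contraNT ci; rewrite negb_exists => /forallP h.
  by rewrite /c' big1 // => j pj; have := h j; rewrite pj negbK => /eqP.
by apply: imset_f; rewrite inE.
Qed.

Definition in_cone (b : 'I_n -> 'rV[R]_n) q : Prop :=
  exists c : 'I_n -> R, (forall i, 0 < c i) /\ q = \sum_i c i *: b i.

Definition facet q (b : 'I_n -> 'rV[R]_n) : int :=
  if `[< in_cone b q >] then sgz (\det (\matrix_i b i)) else 0.

(* The signed number of facets hit by the ray through [q]: for generic [q] it is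
   1, -1 or 0 according to the position of [0] with respect to the simplex [a]. *)
Definition simplex q (a : 'I_n.+1 -> 'rV[R]_n) : int :=
  \sum_(k < n.+1) (-1) ^+ k * facet q (a \o lift k).

Section OneSimplex.
Variables (q : 'rV[R]_n) (a : 'I_n.+1 -> 'rV[R]_n).

Let D (k : 'I_n.+1) : R := (-1) ^+ k * \det (\matrix_i a (lift k i)).

(** Cramer's rule: this is the expansion, along its first column, of a determinant with a repeated
    column. *)
Lemma minors_relation : \sum_k D k *: a k = 0.
Proof.
apply/rowP => j; rewrite mxE summxE.
pose B : 'M[R]_(n.+1) := \matrix_(i, l) (if unlift 0 l is Some l' then a i 0 l' else a i 0 j).
have dB : \det B = 0.
  rewrite -det_tr; apply: (@determinant_alternate _ _ _ 0 (lift 0 j)); first exact: neq_lift.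
  by move=> i; rewrite !mxE unlift_none liftK.
rewrite -[RHS]dB (expand_det_col _ 0); apply: eq_bigr => k _.
rewrite !mxE unlift_none mulrC; congr (_ * _).
rewrite /cofactor addn0; congr (_ * \det _).
by apply/matrixP => i l; rewrite !mxE liftK.
Qed.

Lemma minor_neq0_free i (e : 'I_n.+1 -> R) :
  D i != 0 -> e i = 0 -> \sum_k e k *: a k = 0 -> forall k, e k = 0.
Proof.
move=> Di ei; rewrite (bigD1_ord i) //= ei scale0r add0r => e0.
have detN0 : \det (\matrix_l a (lift i l)) != 0.
  by apply: contra Di => /eqP; rewrite /D => ->; rewrite mulr0.
pose v := \row_l e (lift i l).
have v0 : v = 0.
  apply/eqP; apply: contraNT detN0 => vN0; apply/det0P; exists v => //.
  rewrite mulmx_sum_row -[RHS]e0; apply: eq_bigr => l _.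
  by rewrite rowK mxE.
move=> k; case: (unliftP i k) => [l ->|->//].
by have /rowP/(_ l) := v0; rewrite !mxE.
Qed.

(** A nonzero minor makes the other [n] vectors a basis, so the relations between the [n + 1]
    vectors form the line spanned by the signed minors. *)
Lemma kernel_line i (e : 'I_n.+1 -> R) :
  D i != 0 -> \sum_k e k *: a k = 0 -> forall k, e k = e i / D i * D k.
Proof.
move=> Di e0 k; apply/eqP; rewrite -subr_eq0; apply/eqP; move: k.
apply: (minor_neq0_free Di); first by rewrite divfK // subrr.
transitivity (\sum_k e k *: a k - \sum_k (e i / D i) *: (D k *: a k)).
  rewrite -sumrB; apply: eq_bigr => k _; by rewrite scalerBl scalerA.
by rewrite -scaler_sumr minors_relation scaler0 e0 subr0.
Qed.

(** The ray through [q] crosses the facet opposite to vertex [i], phrased with all [n + 1]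
    coefficients so that two crossings can be subtracted. *)
Definition omits i : Prop := exists c : 'I_n.+1 -> R,
  [/\ c i = 0, forall k, k != i -> 0 < c k & q = \sum_k c k *: a k].

Lemma in_coneP i : in_cone (a \o lift i) q <-> omits i.
Proof.
split=> [[c [c0 qE]]|[c [ci c0 qE]]].
  exists (fun k => if unlift i k is Some l then c l else 0).
  split; first by rewrite unlift_none.
    by move=> k; case: unliftP => [l -> _|->]; rewrite ?liftK // eqxx.
  rewrite (bigD1_ord i) //= unlift_none scale0r add0r qE.
  by apply: eq_bigr => l _; rewrite liftK.
exists (c \o lift i); split=> [l|]; first by apply: c0; rewrite eq_sym neq_lift.
by rewrite qE (bigD1_ord i) //= ci scale0r add0r.
Qed.

Lemma simplexE : simplex q a =
  \sum_k (if `[< omits k >] then sgz (D k) else 0).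
Proof.
apply: eq_bigr => k _; rewrite /facet (asbool_equiv_eq (in_coneP k)).
case: ifP => _; last by rewrite mulr0.
rewrite /D sgzM; congr (_ * _).
by rewrite -signr_odd -[in RHS]signr_odd; case: (odd k); rewrite ?expr1 ?expr0 ?sgzN ?sgz1.
Qed.

(** The difference of the two representations of [q] is a relation, hence a multiple of [D], and its
    entries at [i] and [j] have opposite signs. *)
Lemma omits_opp i j : D i != 0 -> omits i -> omits j -> i != j -> D i * D j < 0.
Proof.
move=> Di [c [ci c0 qE]] [d [dj d0 qE']] ij.
have e0 : \sum_k (d k - c k) *: a k = 0.
  rewrite -[RHS](subrr q) {1}qE' qE -sumrB.
  by apply: eq_bigr => k _; rewrite scalerBl.
have /(_ j) := kernel_line Di e0; rewrite dj ci subr0 sub0r => ej.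
have cj : 0 < c j by apply: c0; rewrite eq_sym.
have di : 0 < d i by apply: d0.
have -> : D j = - c j * (D i / d i).
  by rewrite ej; field; rewrite Di lt0r_neq0.
have -> : D i * (- c j * (D i / d i)) = - (D i ^+ 2 * c j / d i) by ring.
rewrite oppr_lt0 divr_gt0 // mulr_gt0 // exprn_even_gt0 //.
Qed.

Hypothesis ga : generic a q.

Lemma generic_zero i j (c : 'I_n.+1 -> R) :
  q = \sum_k c k *: a k -> c i = 0 -> c j = 0 -> i = j.
Proof.
move=> /ga cn ci cj; apply/eqP; apply: contraTT cn => ij; rewrite -ltnNge.
have : [set k | c k != 0] \subset ~: [set i; j].
  apply/fintype.subsetP => k; rewrite !inE => ck; apply/norP.
  by split; apply: contraNneq ck => ->; rewrite ?ci ?cj.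
move=> /subset_leq_card; rewrite [X in (_ <= X)%N]cardsCs finset.setCK cards2 ij card_ord subn2 => h.
apply: leq_ltn_trans h _; rewrite prednK // lt0n.
apply: contraNneq ij => n0; apply/eqP/val_inj.
have k0 (k : 'I_n.+1) : k = 0 :> nat.
  by apply/eqP; rewrite -leqn0 -[X in (_ <= X)%N](n0 : n = 0%N) -ltnS.
by rewrite [LHS](k0 i) [RHS](k0 j).
Qed.

(** A pivot of the simplex method: starting from the crossing [i], the coefficients move along the
    relation until another one vanishes. Genericity prevents two from vanishing together. *)
Lemma omits_pair i u : D i != 0 -> omits i -> (forall k, 0 < dot u (a k)) ->
  exists j, [/\ j != i, omits j & D i * D j < 0].
Proof.
move=> Di oi u0; have [c [ci c0 qE]] := oi.
pose E k := D i * D k.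
have E0 : \sum_k E k *: a k = 0.
  transitivity (D i *: \sum_k D k *: a k); last by rewrite minors_relation scaler0.
  by rewrite scaler_sumr; apply: eq_bigr => k _; rewrite scalerA.
have Ei : 0 < E i by rewrite /E -expr2 exprn_even_gt0.
(* If every [E k] were nonnegative, pairing the relation with [u] would give a positive sum equal to
   zero. *)
have [k0 Ek0] : exists k, E k < 0.
  apply/existsP; apply: contraT; rewrite negb_exists => /forallP h.
  have : 0 < \sum_k E k * dot u (a k).
    rewrite (bigD1 i) //=; apply: ltr_pwDl; first by rewrite mulr_gt0.
    by apply: sumr_ge0 => k _; rewrite mulr_ge0 ?(ltW (u0 _)) // leNgt.
  have -> : \sum_k E k * dot u (a k) = dot u (\sum_k E k *: a k).
    by rewrite dot_sumr; apply: eq_bigr => k _; rewrite dotZr.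
  by rewrite E0 dot0r ltxx.
(* Ratio test: [g k] is the time at which coefficient [k] reaches zero, and the smallest one is
   kept. *)
pose g k := c k / - E k.
have [j Ej jmin] := @arg_minP _ _ _ k0 (fun k => E k < 0) g Ek0.
have ji : j != i by apply: contraTneq Ej => ->; rewrite -leNgt ltW.
have cj : 0 < c j by exact: c0.
have gj : 0 < g j by rewrite divr_gt0 ?oppr_gt0.
pose d k := c k + g j * E k.
have qd : q = \sum_k d k *: a k.
  transitivity (\sum_k c k *: a k + g j *: \sum_k E k *: a k).
    by rewrite E0 scaler0 addr0.
  rewrite scaler_sumr -big_split; apply: eq_bigr => k _.
  by rewrite scalerDl scalerA.
have dj : d j = 0 by rewrite /d /g invrN mulrN mulNr divfK ?subrr ?ltr0_neq0.
exists j; split=> //; exists d; split=> // k kj.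
rewrite lt_neqAle; apply/andP; split.
  by apply/eqP => /esym dk; move/eqP: kj; apply; exact: (generic_zero qd).
have ck : 0 <= c k by have [->|/c0/ltW//] := eqVneq k i; rewrite ci.
have [Ek|Ek] := leP 0 (E k); first by rewrite /d addr_ge0 // mulr_ge0 // ltW.
have := jmin k Ek; rewrite /d {2}/g ler_pdivlMr ?oppr_gt0 //; lra.
Qed.

Lemma simplex_halfspace u : (forall k, 0 < dot u (a k)) -> simplex q a = 0.
Proof.
move=> u0; rewrite simplexE.
case: (pselect (exists i, omits i /\ D i != 0)) => [[i [oi Di]]|no]; last first.
  apply: big1 => k _; case: asboolP => // ok.
  have [->|Dk] := eqVneq (D k) 0; first by rewrite sgz0.
  by case: no; exists k.
have [j [ji oj Dij]] := omits_pair Di oi u0.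
have Dj : D j != 0 by apply: contraTneq Dij => ->; rewrite mulr0 ltxx.
rewrite (bigD1 i) //= (bigD1 j) //= big1 ?addr0.
  rewrite !asboolT // ; move: Dij.
  have [Di0|Di0|Di0] := sgzP (D i); have [Dj0|Dj0|Dj0] := sgzP (D j) => //.
  - by rewrite Di0 mul0r ltxx.
  - by rewrite Di0 mul0r ltxx.
  - by rewrite Dj0 mulr0 ltxx.
  - by rewrite pmulr_rlt0 // ltNge ltW.
  - by rewrite Dj0 mulr0 ltxx.
  - by rewrite nmulr_rlt0 // ltNge ltW.
(* A third crossing would make three minors pairwise of opposite signs. *)
move=> k /andP[ki kj]; case: asboolP => // ok.
have h1 := omits_opp Di oi ok (negbT (introF eqP (fun e => negP ki (introT eqP (esym e))))).
have h2 := omits_opp Dj oj ok (negbT (introF eqP (fun e => negP kj (introT eqP (esym e))))).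
exfalso; nra.
Qed.

(** With barycenter [0] all signed minors are equal, so [omits_opp] allows at most one crossing, and
    there is one. *)
Lemma simplex_barycenter : \sum_k a k = 0 -> D 0 != 0 ->
  simplex q a = sgz (\det (\matrix_i a (lift 0 i))).
Proof.
move=> a0 D0.
have DE k : D k = D 0.
  have /(_ k) : forall k, 1 = 1 / D 0 * D k.
    by apply: (kernel_line D0); under eq_bigr do rewrite scale1r.
  by move/(congr1 ( *%R (D 0))); rewrite mulrA mulrCA mul1r mulfV // mulr1 mul1r.
have D0E : D 0 = \det (\matrix_i a (lift 0 i)) by rewrite /D expr0 mul1r.
have uM : \matrix_i a (lift 0 i) \in unitmx by rewrite unitmxE unitfE -D0E.
pose w := q *m invmx (\matrix_i a (lift 0 i)).
pose c k : R := if unlift 0 k is Some l then w 0 l else 0.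
have qE : q = \sum_k c k *: a k.
  rewrite big_ord_recl /c unlift_none scale0r add0r -[LHS](mulmxKV uM) -/w.
  by rewrite mulmx_sum_row; apply: eq_bigr => l _; rewrite liftK rowK.
(* Since the vertices sum to [0], the least coefficient may be subtracted from all of them without
   changing [q]. *)
have [i _ imin] := @arg_minP _ _ _ 0 predT c isT.
pose d k := c k - c i.
have qd : q = \sum_k d k *: a k.
  transitivity (\sum_k c k *: a k - c i *: \sum_k a k).
    by rewrite a0 scaler0 subr0.
  by rewrite scaler_sumr -sumrB; apply: eq_bigr => k _; rewrite scalerBl.
have di : d i = 0 by rewrite /d subrr.
have oi : omits i.
  exists d; split=> // k ki; rewrite lt_neqAle subr_ge0 imin // andbT.
  by apply: contra ki => /eqP/esym dk; apply/eqP/(generic_zero qd).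
rewrite simplexE (bigD1 i) //= asboolT // DE D0E big1 ?addr0 // => k ki.
case: asboolP => // ok; have := @omits_opp i k; rewrite !DE => /(_ D0 oi ok).
by rewrite eq_sym => /(_ ki); rewrite ltNge -expr2 sqr_ge0.
Qed.

End OneSimplex.
End SimplexCount.

Lemma nonroot_exists (R : numDomainType) (p : {poly R}) : p != 0 -> exists t, ~~ root p t.
Proof.
move=> p0; apply: contrapT => h.
pose s : seq R := [seq k%:R | k <- iota 0 (size p)].
have us : uniq s.
  by rewrite map_inj_in_uniq ?iota_uniq // => i j _ _ /eqP; rewrite eqr_nat => /eqP.
have : all (root p) s.
  by apply/allP => t _; apply: contrapT => /negP rt; apply: h; exists t.
by move/(max_poly_roots p0)/(_ us); rewrite size_map size_iota ltnn.
Qed.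

Section GenericExists.
Variables (R : realFieldType) (n : nat) (I : finType) (a : I -> 'rV[R]_n).

Lemma annihilator (J : {set I}) : (#|J| < n)%N ->
  exists2 l : 'rV[R]_n, l != 0 & forall i, i \in J -> dot l (a i) = 0.
Proof.
move=> Jn; pose B : 'M[R]_(n, #|J|) := \matrix_(i, k) a (enum_val k) 0 i.
have : kermx B != 0.
  by rewrite kermx_eq0 /row_free neq_ltn (leq_ltn_trans (rank_leq_col _) Jn).
move=> /rowV0Pn[l /sub_kermxP lB l0]; exists l => // i iJ.
move/rowP/(_ (enum_rank_in iJ i)): lB; rewrite !mxE => <-.
by apply: eq_bigr => k _; rewrite mxE enum_rankK_in.
Qed.

(* A point of the moment curve avoiding finitely many hyperplanes. *)
Lemma generic_exists : exists q, generic a q.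
Proof.
pose Q (J : {set I}) (l : 'rV[R]_n) :=
  (#|J| < n)%N -> l != 0 /\ forall i, i \in J -> dot l (a i) = 0.
have /choice[l lP] : forall J, exists l, Q J l.
  move=> J; have [/annihilator[l l0 lJ]|nJ] := ltnP #|J| n; first by exists l.
  by exists 0; rewrite /Q ltnNge nJ.
pose P := \prod_(J : {set I} | (#|J| < n)%N) rVpoly (l J).
have [t] : exists t, ~~ root P t.
  apply: nonroot_exists; apply/prodf_neq0 => J Jn.
  by have [lJ _] := lP J Jn; apply: contra lJ => /eqP e; rewrite -(rVpolyK (l J)) e linear0.
move=> Pt; exists (\row_i t ^+ i) => c qE; rewrite leqNgt; apply: contra Pt => Jn.
have [_ lJ] := lP _ Jn; apply/rootP; rewrite horner_prod.
rewrite (bigD1 [set i | c i != 0]) //=; set v := l _ in lJ *.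
suff -> : (rVpoly v).[t] = 0 by rewrite mul0r.
transitivity (dot v (\row_i t ^+ i)).
  by rewrite horner_poly; apply: eq_bigr => i _; rewrite valK mxE.
rewrite qE dot_sumr big1 // => i _; rewrite dotZr.
by have [->|ci] := eqVneq (c i) 0; rewrite ?mul0r // lJ ?mulr0 ?inE.
Qed.

End GenericExists.

(** * Kuhn's triangulation of a torus *)

Section Grid.
Variables (n M : nat).

(* Vertices form a torus, so that every cell has a neighbour across every facet. *)
Definition vertex := 'rV['I_M.+2]_n.
(** A simplex of Kuhn's triangulation is a monotone path across a cube: it starts at the base
    vertex, and the permutation gives the order in which the coordinates are increased. *)
Definition cell := (vertex * 'S_n)%type.

Definition vert (c : cell) (k : nat) : vertex :=
  c.1 + \sum_(i < n | (i < k)%N) delta_mx 0 (c.2 i).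

Definition interior_vertex (T : {set cell}) (p : vertex) : Prop :=
  forall c k, (k <= n)%N -> vert c k = p -> c \in T.

Lemma vertE c k j : vert c k 0 j = c.1 0 j + (((c.2^-1)%g j < k)%N : nat)%:R.
Proof.
rewrite mxE summxE (reindex_inj (@perm_inj _ (c.2^-1)%g)) /=; congr (_ + _).
rewrite big_mkcond (bigD1 j) //= !mxE permKV !eqxx big1 ?addr0; first by case: (_ < k)%N.
by move=> i ij; rewrite !mxE permKV eq_sym (negbTE ij) if_same.
Qed.

Definition facet_verts (c : cell) (k : 'I_n.+1) : 'I_n -> vertex :=
  fun l => vert c (lift k l).

End Grid.

(** * The pairing of facets and the discrete Stokes formula *)

Section Stokes.
Variables (n' M : nat).
Let n := n'.+1.
Let flag := (cell n M * 'I_n.+1)%type.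

Definition rotation : 'S_n := lift_perm ord_max ord0 1%g.

(** For an inner vertex [k], swapping the steps [k - 1] and [k] of the path changes this vertex
    only. For the first or last vertex, a step is moved from one end of the path to the other, which
    shifts the numbering of the common vertices by one. *)
Definition neighbour (x : flag) : flag :=
  let: ((b, s), k) := x in
  if k == ord0 then ((b + delta_mx 0 (s ord0), (rotation * s)%g), ord_max)
  else if k == ord_max then
    ((b - delta_mx 0 ((rotation^-1 * s)%g ord0), (rotation^-1 * s)%g), ord0)
  else ((b, (tperm (inord k.-1) (inord k) * s)%g), k).

Lemma neighbour_max (b : vertex n M) (s : 'S_n) : neighbour (b, s, ord_max) =
  ((b - delta_mx 0 ((rotation^-1 * s)%g ord0), (rotation^-1 * s)%g), ord0).
Proof. by rewrite /neighbour (_ : (ord_max == ord0 :> 'I_n.+1) = false) ?eqxx. Qed.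

Lemma neighbourK : involutive neighbour.
Proof.
have m0 : (ord_max == ord0 :> 'I_n.+1) = false by [].
move=> [[b s] k]; rewrite {2}/neighbour; have [->|k0] := eqVneq k ord0.
  by rewrite /neighbour m0 eqxx mulgA mulVg mul1g addrK.
have [->|kn] := eqVneq k ord_max.
  by rewrite /neighbour eqxx mulgA mulgV mul1g subrK.
by rewrite /neighbour (negbTE k0) (negbTE kn) mulgA tperm2 mul1g.
Qed.

Lemma neighbour_verts0 (b : vertex n M) (s : 'S_n) m : (m <= n')%N ->
  vert (b + delta_mx 0 (s ord0), (rotation * s)%g) m = vert (b, s) m.+1.
Proof.
move=> mn; rewrite /vert /= -addrA; congr (b + _).
rewrite big_mkcond [in RHS]big_mkcond big_ord_recr big_ord_recl /= ltnNge mn addr0.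
congr (_ + _); apply: eq_bigr => i _; rewrite ltnS.
have -> : widen_ord (leqnSn n') i = lift ord_max i by apply: val_inj; rewrite /= /bump leqNgt ltn_ord.
by rewrite permM lift_perm_lift perm1.
Qed.

Lemma neighbour_facet x : facet_verts (neighbour x).1 (neighbour x).2 = facet_verts x.1 x.2.
Proof.
have facet0 b s : let x : flag := ((b, s), ord0) in
    facet_verts (neighbour x).1 (neighbour x).2 = facet_verts x.1 x.2.
  apply: funext => l; rewrite /facet_verts /= /bump leqNgt ltn_ord /= add0n add1n.
  by rewrite neighbour_verts0 // -ltnS ltn_ord.
case: x => [[b s] k]; have [->|k0] := eqVneq k ord0; first exact: facet0.
have [->|kn] := eqVneq k ord_max.
  rewrite -[(b, s, _)]neighbourK (neighbour_max b s) neighbourK; exact/esym/facet0.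
apply: funext => l; rewrite /facet_verts /= (negbTE k0) (negbTE kn) /= /vert /=.
congr (b + _); set m := bump k l.
have mk : m != k by rewrite /m /bump; case: leqP => h; lia.
(* As [m] differs from [k], the first [m] steps contain both swapped steps or neither. *)
set t := tperm _ _; rewrite (reindex_inj (@perm_inj _ t)) /=.
have kn' : (k < n)%N by rewrite ltn_neqAle -ltnS ltn_ord andbT; apply: contra kn => /eqP e; apply/eqP/val_inj.
have k0' : (0 < k)%N by rewrite lt0n; apply: contra k0 => /eqP e; apply/eqP/val_inj.
apply: eq_big => [i|i _]; last by rewrite permM /t tpermK.
rewrite /t; case: tpermP => [->|->|//]; rewrite !inordK; lia.
Qed.

Definition flag_sign (x : flag) : int := (-1) ^+ x.1.2 * (-1) ^+ x.2.

(** A transposition is odd and keeps [k]. The rotation has the parity of [n - 1], while the facet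
    index jumps between [0] and [n]: in total an odd number of sign changes. *)
Lemma neighbour_sign x : flag_sign (neighbour x) = - flag_sign x.
Proof.
have sign0 b s : let x : flag := ((b, s), ord0) in flag_sign (neighbour x) = - flag_sign x.
  rewrite /flag_sign /= odd_permM odd_lift_perm odd_perm1 /= addbF.
  rewrite addbF signr_addb signr_odd expr0 mulr1 [(-1) ^+ n]exprS mulN1r mulrN.
  by rewrite mulrAC -signr_odd -signr_addb addbb mul1r.
case: x => [[b s] k]; have [->|k0] := eqVneq k ord0; first exact: sign0.
have [->|kn] := eqVneq k ord_max.
  by rewrite -[(b, s, _)]neighbourK (neighbour_max b s) neighbourK sign0 opprK.
rewrite /flag_sign /= (negbTE k0) (negbTE kn) /= odd_mul_tperm.
have kn' : (k < n)%N by rewrite ltn_neqAle -ltnS ltn_ord andbT; apply: contra kn => /eqP e; apply/eqP/val_inj.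
have k0' : (0 < k)%N by rewrite lt0n; apply: contra k0 => /eqP e; apply/eqP/val_inj.
have -> : inord k.-1 != inord k :> 'I_n.
  by apply/eqP => /(congr1 val); rewrite /= !inordK; lia.
by rewrite signrN mulNr.
Qed.

(** [neighbour] pairs the flags with equal facets and opposite signs. The hypothesis on [phi] puts
    both cells of a pair in [T] whenever the facet contributes, so the sum equals its opposite. *)
Lemma stokes_succ (T : {set cell n M}) (phi : ('I_n -> vertex n M) -> int) :
  (forall F, phi F != 0 -> exists l, interior_vertex T (F l)) ->
  \sum_(c in T) (-1) ^+ c.2 * \sum_(k < n.+1) (-1) ^+ k * phi (facet_verts c k) = 0.
Proof.
move=> phiT; pose F (x : flag) := if x.1 \in T then flag_sign x * phi (facet_verts x.1 x.2) else 0.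
have -> : \sum_(c in T) (-1) ^+ c.2 * \sum_(k < n.+1) (-1) ^+ k * phi (facet_verts c k) = \sum_x F x.
  rewrite big_mkcond -(pair_bigA _ (fun c k => F (c, k))) /=; apply: eq_bigr => c _.
  rewrite /F /=; case: ifP => _; last by rewrite big1.
  by rewrite mulr_sumr; apply: eq_bigr => k _; rewrite /flag_sign mulrA.
have FN x : F (neighbour x) = - F x.
  rewrite /F neighbour_facet neighbour_sign mulNr.
  have [->|/phiT[l il]] := eqVneq (phi (facet_verts x.1 x.2)) 0.
    by rewrite !mulr0 oppr0; case: ifP => _; case: ifP => _; rewrite ?oppr0.
  have -> : x.1 \in T by apply: (il _ (lift x.2 l)) => //; rewrite -ltnS.
  suff -> : (neighbour x).1 \in T by [].
  apply: (il _ (lift (neighbour x).2 l)); first by rewrite -ltnS.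
  by rewrite -/(facet_verts _ _ l) neighbour_facet.
have : \sum_x F x = - \sum_x F x.
  rewrite {1}(reindex_inj (inv_inj neighbourK)) /= -sumrN.
  by apply: eq_bigr => x _; rewrite FN.
by move/eqP; rewrite -addr_eq0 -mulr2n mulrn_eq0 /= => /eqP.
Qed.

End Stokes.

Lemma stokes n M (T : {set cell n M}) (phi : ('I_n -> vertex n M) -> int) :
  (forall F, phi F != 0 -> exists l, interior_vertex T (F l)) ->
  \sum_(c in T) (-1) ^+ c.2 * \sum_(k < n.+1) (-1) ^+ k * phi (facet_verts c k) = 0.
Proof.
case: n T phi => [|n] T phi h; last exact: stokes_succ.
apply: big1 => c _; rewrite big1 ?mulr0 // => k _.
have [->|/h[[]//]] := eqVneq (phi (facet_verts c k)) 0; by rewrite mulr0.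
Qed.

(** * The count: homotopy invariance and linear maps *)

Section Count.
Variables (R : realFieldType) (n M : nat).
Implicit Types (a : vertex n M -> 'rV[R]_n) (T : {set cell n M}).

Definition count q a T : int :=
  \sum_(c in T) (-1) ^+ c.2 * simplex q (fun k : 'I_n.+1 => a (vert c k)).

(** A single [u] for both maps and all vertices of the cell puts every mixture of their values in
    one half-space, where [simplex_halfspace] applies. *)
Definition boundary_free a a' T : Prop :=
  forall c, c \in T -> (exists2 k, (k <= n)%N & ~ interior_vertex T (vert c k)) ->
  exists u : 'rV[R]_n, forall k, (k <= n)%N ->
    0 < dot u (a (vert c k)) /\ 0 < dot u (a' (vert c k)).

(** The intermediate labelling [m] takes [a'] at interior vertices and [a] elsewhere. Passing from
    [a] to [m] changes only facets with an interior vertex, and [stokes] cancels these. Passing from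
    [m] to [a'] changes only cells with a noninterior vertex, and these count zero for both. *)
Lemma count_homotopy q a a' T (aa' := fun x : vertex n M + vertex n M =>
    match x with inl p => a p | inr p => a' p end) :
  generic aa' q -> boundary_free a a' T -> count q a T = count q a' T.
Proof.
move=> gaa' bf; pose m p := if `[< interior_vertex T p >] then a' p else a p.
transitivity (count q m T).
  apply/eqP; rewrite -subr_eq0 -sumrB; apply/eqP.
  pose phi (F : 'I_n -> vertex n M) := facet q (a \o F) - facet q (m \o F).
  rewrite -[RHS](@stokes n M T phi); last first.
    move=> F; rewrite /phi => Fd; apply: contrapT => noint.
    move/eqP: Fd; apply; apply/eqP; rewrite subr_eq0; apply/eqP; congr facet.
    by apply: funext => l; rewrite /m /= asboolF // => il; apply: noint; exists l.
  apply: eq_bigr => c _; rewrite -mulrBr -sumrB; congr (_ * _).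
  by apply: eq_bigr => k _; rewrite mulrBr.
apply: eq_bigr => c cT; congr (_ * _).
have [allint|] := pselect (forall k, (k <= n)%N -> interior_vertex T (vert c k)).
  congr simplex; apply: funext => k; rewrite /m asboolT //; apply: allint.
  by rewrite -ltnS.
move=> /existsNP[k /not_implyP[kn ki]].
have [u u0] := bf c cT (ex_intro2 _ _ k kn ki).
transitivity (0 : int); last symmetry; apply: (@simplex_halfspace _ _ _ _ _ u) => [|l].
- pose psi (j : 'I_n.+1) := if `[< interior_vertex T (vert c j) >]
    then inr (vert c j) else inl (vert c j) : vertex n M + vertex n M.
  have := generic_comp (phi := psi) gaa'; congr generic.
  by apply: funext => j; rewrite /m /psi /=; case: ifP.
- by rewrite /m; case: ifP => _; [apply: (u0 l _).2|apply: (u0 l _).1]; rewrite -ltnS.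
- exact: (generic_comp (phi := fun j : 'I_n.+1 => inr (vert c j)) gaa').
- by apply: (u0 l _).2; rewrite -ltnS.
Qed.

Definition coords (p : vertex n M) : 'rV[R]_n := \row_j (p 0 j : nat)%:R.

Lemma coords_vert (c : cell n M) k j : (c.1 0%R j <= M)%N ->
  coords (vert c k) 0 j = coords c.1 0 j + (((c.2^-1)%g j < k)%N : nat)%:R.
Proof.
move=> cM; rewrite [LHS]mxE [coords c.1 0 j]mxE -natrD; congr (_%:R); rewrite vertE.
case: ltnP => _; last by rewrite addr0 addn0.
by rewrite /= [(1 %% _)%N]modn_small // addn1 modn_small.
Qed.

Lemma perm_mono_id (t : 'S_n) : (forall i j : 'I_n, (i < j)%N -> (t i < t j)%N) -> t = 1%g.
Proof.
have ge (f : 'S_n) : (forall i j : 'I_n, (i < j)%N -> (f i < f j)%N) -> forall i : 'I_n, (i <= f i)%N.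
  move=> fm i; move: {2}(nat_of_ord i) (erefl (nat_of_ord i)) => m.
  elim: m i => [|m IH] i im; first by rewrite im.
  have mn : (m < n)%N by apply: ltn_trans (ltn_ord i); rewrite im.
  by rewrite im; apply: leq_ltn_trans (IH (Ordinal mn) erefl) _; apply: fm; rewrite im.
move=> tm; have tVm : forall i j : 'I_n, (i < j)%N -> ((t^-1)%g i < (t^-1)%g j)%N.
  move=> i j ij; rewrite ltnNge leq_eqVlt; apply/negP => /orP[/eqP/val_inj/perm_inj e|/tm].
    by rewrite e ltnn in ij.
  by rewrite !permKV ltnNge ltnW.
apply/permP => i; rewrite perm1; apply/val_inj/eqP; rewrite eqn_leq ge // andbT.
by have := ge _ tVm (t i); rewrite permK.
Qed.

Lemma sum_ltn (j m : nat) : (\sum_(k < m.+1) (j < k) = m - j)%N.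
Proof.
elim: m => [|m IH]; first by rewrite big_ord_recl big_ord0.
rewrite big_ord_recr /= IH; case: ltnP; lia.
Qed.

Lemma det_rank1 : \det (1%:M + const_mx 1 : 'M[R]_n) = n.+1%:R.
Proof.
pose r : 'rV[R]_n := const_mx 1; pose c : 'cV[R]_n := const_mx 1.
pose X := block_mx 1%:M (- r) c 1%:M; pose Y := block_mx (1%:M : 'M[R]_1) r 0 1%:M.
have detY : \det Y = 1 by rewrite det_ublock !det1 mulr1.
have XY : X *m Y = block_mx 1%:M 0 c (1%:M + const_mx 1).
  rewrite mulmx_block !mul1mx !mulmx1 !mulmx0 !addr0 subrr; congr block_mx.
  rewrite addrC; congr (_ + _); apply/matrixP => i k.
  by rewrite !mxE big_ord1 !mxE mulr1.
have YX : Y *m X = block_mx (1%:M + r *m c) 0 c 1%:M.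
  by rewrite mulmx_block !mul1mx !mulmx1 !mul0mx !add0r addNr.
have := congr1 determinant XY; rewrite det_mulmx detY mulr1 det_lblock det1 mul1r => <-.
have := congr1 determinant YX; rewrite det_mulmx detY mul1r det_lblock det1 mulr1 => ->.
rewrite det_mx11 !mxE (eq_bigr (fun=> 1)) => [|i _]; last by rewrite !mxE mulr1.
by rewrite sumr_const card_ord -natr1 addrC.
Qed.

Lemma dot_mul (u v : 'rV[R]_n) : dot u v = (u *m v^T) 0 0.
Proof. by rewrite mxE; apply: eq_bigr => i _; rewrite mxE. Qed.

Lemma sgz_pmul (x y : R) : 0 < x -> sgz (x * y) = sgz y.
Proof. by move=> x0; rewrite sgzM gtr0_sgz // mul1r. Qed.

Lemma dot_contragredient (A : 'M[R]_n) u v : A \in unitmx ->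
  dot (u *m (invmx A)^T) (v *m A) = dot u v.
Proof.
move=> uA; rewrite !dot_mul trmx_mul -mulmxA (mulmxA _ A^T) -trmx_mul.
by rewrite mulmxV // trmx1 mul1mx.
Qed.

Lemma dot_delta j (v : 'rV[R]_n) : dot (delta_mx 0 j) v = v 0 j.
Proof.
rewrite /dot (bigD1 j) //= big1 ?addr0; first by rewrite mxE !eqxx mul1r.
by move=> i ij; rewrite mxE (negbTE ij) andbF mul0r.
Qed.

(** [w] is the barycenter of the cell [(b, 1)]: its coordinate [j] is increased at [n - j] of the
    [n + 1] vertices. Every other cell is separated from [w] by a linear form and counts zero. *)
Lemma count_linear q T (b : vertex n M) (A : 'M[R]_n) (h : R)
    (w := coords b + \row_j ((n - j)%:R / n.+1%:R))
    (a := fun p => (h *: (coords p - w)) *m A) :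
  (b, 1%g) \in T -> (forall c j, c \in T -> (c.1 0%R j <= M)%N) ->
  A \in unitmx -> 0 < h -> generic a q -> count q a T = sgz (\det A).
Proof.
move=> bT TM uA h0 ga.
have fr_lt1 (j : 'I_n) : ((n - j)%:R / n.+1%:R : R) < 1.
  by rewrite ltr_pdivrMr ?ltr0Sn // mul1r ltr_nat ltnS leq_subr.
have fr_gt0 (j : 'I_n) : 0 < ((n - j)%:R / n.+1%:R : R).
  by rewrite divr_gt0 ?ltr0Sn // ltr0n subn_gt0.
have wE j : w 0 j = (b 0 j)%:R + (n - j)%:R / n.+1%:R by rewrite !mxE.
rewrite /count (bigD1 (b, 1%g)) //= [X in _ + X]big1 ?addr0; last first.
  move=> [d s] /andP[cT cb].
  have dM j : (d 0%R j <= M)%N by exact: (TM _ _ cT).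
  have vE k j : coords (vert (d, s) k) 0 j = (d 0 j)%:R + ((s^-1)%g j < k)%N%:R.
    by rewrite coords_vert //= mxE.
  suff [u u0] : exists u, forall k, (k <= n)%N -> 0 < dot u (coords (vert (d, s) k) - w).
    (* The inverse transpose carries a separating form through the linear map. *)
    rewrite (@simplex_halfspace _ _ _ _ _ (u *m (invmx A)^T)) ?mulr0 //.
      exact: (generic_comp (phi := fun j : 'I_n.+1 => vert (d, s) j) ga).
    by move=> k; rewrite /a dot_contragredient // dotZr mulr_gt0 // u0 // -ltnS.
  have [db|] := eqVneq d b; last first.
    move=> db; have [j dj] : exists j, d 0 j != b 0 j.
      apply/existsP; apply: contraNT db; rewrite negb_exists => /forallP e.
      by apply/eqP/rowP => j; have := e j; rewrite negbK => /eqP.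
    have [bd|bd] := ltnP (b 0%R j) (d 0%R j).
      exists (delta_mx 0 j) => k kn; rewrite dot_delta mxE vE mxE wE.
      have h1 : ((b 0%R j)%:R + 1 : R) <= (d 0%R j)%:R by rewrite natr1 ler_nat.
      have h2 : 0 <= (((s^-1)%g j < k)%N%:R : R) by [].
      have lin (d' y b' x : R) : b' + 1 <= d' -> 0 <= y -> x < 1 -> 0 < d' + y - (b' + x) by lra.
      exact: lin.
    exists (- delta_mx 0 j) => k kn; rewrite dotC dotNr dotC dot_delta mxE vE mxE wE.
    have h1 : ((d 0%R j)%:R + 1 : R) <= (b 0%R j)%:R.
      by rewrite natr1 ler_nat ltn_neqAle bd andbT.
    have h2 : (((s^-1)%g j < k)%N%:R : R) <= 1 by case: (_ < k)%N.
    have lin (d' y b' x : R) : d' + 1 <= b' -> y <= 1 -> 0 < x -> 0 < - (d' + y - (b' + x)) by lra.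
    exact: lin.
  have s1 : (s^-1)%g != 1%g by rewrite eq_invg1; apply: contra cb => /eqP ->; rewrite db.
  have [i [j [ij sij]]] : exists i j : 'I_n, (i < j)%N /\ ((s^-1)%g j < (s^-1)%g i)%N.
    apply: contrapT => no; move/eqP: s1; apply; apply: perm_mono_id => i j ij.
    rewrite ltnNge leq_eqVlt; apply/negP => /orP[/eqP/val_inj/perm_inj e|sij].
      by rewrite e ltnn in ij.
    by apply: no; exists i, j.
  (* This cell increases coordinate [j] before coordinate [i], whereas the fractional parts of [w]
     decrease strictly with the index. *)
  exists (delta_mx 0 j - delta_mx 0 i) => k kn.
  rewrite dotC dotBr !(dotC _ (delta_mx _ _)) !dot_delta.
  have cE l : (coords (vert (d, s) k) - w) 0 l =
      ((s^-1)%g l < k)%N%:R - (n - l)%:R / n.+1%:R.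
    by rewrite mxE vE db mxE wE; ring.
  have h1 : (((s^-1)%g i < k)%N%:R : R) <= ((s^-1)%g j < k)%N%:R.
    by rewrite ler_nat; case: ltnP => // /(ltn_trans sij) ->.
  have h2 : ((n - j)%:R / n.+1%:R : R) < (n - i)%:R / n.+1%:R.
    by rewrite ltr_pM2r ?invr_gt0 ?ltr0Sn // ltr_nat ltn_sub2l.
  have lin (x y x' y' : R) : x <= y -> y' < x' -> 0 < y - y' - (x - x') by lra.
  by rewrite !cE; exact: lin.
rewrite odd_perm1 expr0 mul1r.
(* The rows of [B] are the vertices other than the base, seen from [w]. Adding to each row the sum
   of all rows yields the unitriangular [U], whence the sign of the determinant of [B]. *)
pose U : 'M[R]_n := \matrix_(i, j) (j <= i)%N%:R.
pose B : 'M[R]_n := \matrix_(i, j) ((j <= i)%N%:R - (n - j)%:R / n.+1%:R).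
have vE (k : nat) j : (coords (vert (b, 1%g) k) - w) 0 j = (j < k)%N%:R - (n - j)%:R / n.+1%:R.
  rewrite mxE coords_vert; last exact: TM.
  by rewrite invg1 perm1 [(- w) _ _]mxE wE mxE; ring.
have sumB j : \sum_(l < n) ((j <= l)%N%:R : R) = (n - j)%:R.
  by rewrite -(sum_ltn j n) big_ord_recl /= natr_sum; apply: eq_bigr.
have JB : (1%:M + const_mx 1) *m B = U.
  apply/matrixP => i j; rewrite mulmxDl mul1mx !mxE.
  transitivity ((j <= i)%N%:R - (n - j)%:R / n.+1%:R + \sum_l B l j).
    by congr (_ + _); apply: eq_bigr => l _; rewrite mxE mul1r.
  under eq_bigr do rewrite mxE.
  rewrite sumrB sumB sumr_const card_ord -mulr_natr -natr1.
  field; by rewrite natr1 pnatr_eq0.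
have detU : \det U = 1.
  rewrite det_trig; first by rewrite big1 // => i _; rewrite mxE leqnn.
  by apply/is_trig_mxP => i j ij; rewrite mxE leqNgt ij.
have detB : 0 < \det B.
  have := congr1 determinant JB; rewrite det_mulmx det_rank1 detU => e.
  by rewrite -(pmulr_rgt0 _ (ltr0Sn R n)) e.
have aE : \matrix_(i < n) a (vert (b, 1%g) (lift 0 i)) = (h *: B) *m A.
  apply/matrixP => i j; rewrite !mxE; apply: eq_bigr => k _; congr (_ * _).
  rewrite [LHS]mxE [RHS]mxE; congr (_ * _).
  by rewrite vE mxE.
have detE : \det (\matrix_(i < n) a (vert (b, 1%g) (lift 0 i))) = h ^+ n * \det B * \det A.
  by rewrite aE det_mulmx detZ.
rewrite simplex_barycenter.
- by rewrite detE sgz_pmul // mulr_gt0 // exprn_gt0.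
- exact: (generic_comp (phi := fun j : 'I_n.+1 => vert (b, 1%g) j) ga).
- rewrite -mulmx_suml -scaler_sumr; have -> : \sum_(k < n.+1) (coords (vert (b, 1%g) k) - w) = 0.
    apply/rowP => j; rewrite summxE [RHS]mxE; under eq_bigr do rewrite vE.
    rewrite sumrB -natr_sum sum_ltn sumr_const card_ord -[_ *+ n.+1]mulr_natr divfK ?subrr ?pnatr_eq0 //.
  by rewrite scaler0 mul0mx.
- rewrite expr0 mul1r detE; apply: mulf_neq0; last by rewrite -unitfE -unitmxE.
  by apply: mulf_neq0; [rewrite expf_neq0 // gt_eqF|rewrite gt_eqF].
Qed.
End Count.

Local Open Scope classical_set_scope.
Local Open Scope ring_scope.

(** * Norms and compactness *)

Section Norms.
Variables (R : realType) (n : nat).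
Implicit Types (u v x : 'rV[R]_n).

Lemma coord_le_norm x i : `|x 0 i| <= `|x|.
Proof.
by rewrite [leRHS]/Num.norm /= mx_normrE; apply/bigmax_geP; right; exists (0, i).
Qed.

Lemma norm_le_coord x (e : R) : 0 <= e -> (forall i, `|x 0 i| <= e) -> `|x| <= e.
Proof.
move=> e0 xe; rewrite [leLHS]/Num.norm /= mx_normrE; apply: bigmax_le => // -[i j] _ /=.
by rewrite ord1.
Qed.

Lemma norm_lt_coord x (e : R) : 0 < e -> (forall i, `|x 0 i| < e) -> `|x| < e.
Proof.
move=> e0 xe; rewrite [ltLHS]/Num.norm /= mx_normrE; apply: bigmax_lt => // -[i j] _ /=.
by rewrite ord1.
Qed.

Lemma ballE x e v : ball x e v = (`|v - x| < e) :> Prop.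
Proof. by rewrite mx_norm_ball /ball_ /= distrC. Qed.

Lemma dot_le_norm u v : `|dot u v| <= (\sum_i `|u 0 i|) * `|v|.
Proof.
rewrite mulr_suml; apply: le_trans (ler_norm_sum _ _ _) _; apply: ler_sum => i _.
by rewrite normrM ler_wpM2l // coord_le_norm.
Qed.

Lemma dot_bounded u : exists2 c, 0 < c & forall v, `|dot u v| <= c * `|v|.
Proof.
exists (\sum_i `|u 0 i| + 1) => [|v]; first by rewrite ltr_wpDl // sumr_ge0.
by apply: le_trans (dot_le_norm u v) _; rewrite ler_wpM2r // lerDl.
Qed.

Lemma dot_gt0_near u v : 0 < dot u v ->
  exists2 d, 0 < d & forall w, `|w - v| < d -> 0 < dot u w.
Proof.
move=> uv; have [c c0 cP] := dot_bounded u.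
exists (dot u v / c); first by rewrite divr_gt0.
move=> w; rewrite ltr_pdivlMr // mulrC => /(le_lt_trans (cP _)).
by rewrite dotBr ltr_norml => /andP[]; lra.
Qed.

Lemma dot_cauchy_schwarz u v : (dot u v) ^+ 2 <= dot u u * dot v v.
Proof.
have [->|v0] := eqVneq v 0; first by rewrite !dot0r expr0n mulr0.
have vv := dot_gt0 v0; pose t := dot u v / dot v v.
have := dot_ge0 (u - t *: v).
rewrite dotBr !dotZr ![dot (u - _) _]dotC !dotBr !dotZr (dotC v u) => h.
have e : dot u u - t * dot u v - t * (dot u v - t * dot v v) = dot u u - dot u v ^+ 2 / dot v v.
  by rewrite /t; field; rewrite gt_eqF.
by move: h; rewrite e subr_ge0 ler_pdivrMr.
Qed.

End Norms.

Section Compactness.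
Variables (R : realType) (n : nat).
Implicit Types (K : set 'rV[R]_n).

(** Lebesgue's number lemma for a property [Q] monotone in the radius: the radius tends to [0] from
    the right in the near-covering form of compactness. *)
Lemma compact_uniform K (Q : R -> 'rV[R]_n -> Prop) : compact K ->
  (forall d d' x, d' <= d -> Q d x -> Q d' x) ->
  (forall x, K x -> exists2 d, 0 < d & forall x', `|x' - x| < d -> K x' -> Q d x') ->
  exists2 d, 0 < d & forall x, K x -> Q d x.
Proof.
move=> /compact_near_coveringP/near_covering_withinP cK anti loc.
have := cK _ (0 : R)^'+ Q _; case.
  move=> x /loc[d d0 xd]; exists (ball x d, [set e | 0 < e < d]) => /=.
    split; first exact: nbhsx_ballx.
    by near=> e => /=; apply/andP; split; [near: e; exact: nbhs_right_gt|near: e; exact: nbhs_right_lt].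
  move=> [x' e] /= [xx' /andP[_ /ltW ed]] Kx'; apply: anti ed _; apply: xd => //.
  by move: xx'; rewrite ballE.
move=> /= d d0 dK; exists (d / 2); first by rewrite divr_gt0.
move=> x; apply: dK => //=; last by rewrite divr_gt0.
by rewrite sub0r normrN gtr0_norm ?divr_gt0 // ltr_pdivrMr // ltr_pMr // ltr1n.
Unshelve. all: by end_near. Qed.

(** If [K] were infinite, the sets missing only finitely many points of [K] would form a proper
    filter, whose cluster point is not isolated. *)
Lemma compact_isolated_finite K : compact K ->
  (forall x, K x -> exists2 d, 0 < d & forall x', `|x' - x| < d -> K x' -> x' = x) ->
  finite_set K.
Proof.
move=> cK iso; apply: contrapT => infK.
pose F := [set A : set 'rV[R]_n | finite_set (K `\` A)].
have FF : ProperFilter F.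
  split; first by rewrite /F /= setD0.
  split; first by rewrite /F /= setDT.
    by move=> A B; rewrite /F /= setDIr finite_setU.
  by move=> A B AB; rewrite /F /=; apply: sub_finite_set => x [Kx nB]; split=> // /AB.
have FK : F K by rewrite /F /= setDv.
have [x [Kx clx]] := cK F FF FK.
have [d d0 xd] := iso x Kx.
have F1 : F (K `\ x) by rewrite /F /= setDD; apply: sub_finite_set (finite_set1 x) => y [].
have [y [[Ky yx] xy]] := clx _ _ F1 (nbhsx_ballx x d d0).
by apply: yx; apply: xd => //; move: xy; rewrite ballE.
Qed.

Lemma bounded_setP K : bounded_set K -> exists2 L, 0 < L & forall x, K x -> `|x| <= L.
Proof.
move=> [M [_ hM]]; exists (`|M| + 1); first by rewrite ltr_pwDr.
by move=> x Kx; apply: hM => //; rewrite (le_lt_trans (ler_norm _)) // ltrDl.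
Qed.

Lemma compact_closure_bounded K : bounded_set K -> compact (closure K).
Proof.
move=> bK; apply: bounded_closed_compact; last exact: closed_closure.
have [L L0 KL] := bounded_setP bK; exists L; split; first exact: num_real.
move=> M LM x clx; apply/ler_addgt0Pr => e e0.
have [y [Ky xy]] := clx _ (nbhsx_ballx x e e0).
rewrite -[x](subrK y) (le_trans (ler_normD _ _)) // addrC lerD //.
  by rewrite (le_trans (KL _ Ky)) // ltW.
by move: xy; rewrite mx_norm_ball /ball_ /= => /ltW.
Qed.

Lemma within_continuousP K (F : 'rV[R]_n -> 'rV[R]_n) x :
  {within K, continuous F} -> K x -> forall e, 0 < e ->
  exists2 d, 0 < d & forall z, K z -> `|z - x| < d -> `|F z - F x| < e.
Proof.
move=> cF Kx e e0.
have := (subspace_continuousP _ _).1 cF x Kx.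
move=> /cvgrPdist_lt/(_ e e0)/nbhs_ballP[d /= d0 dP]; exists d => // z Kz zx.
rewrite distrC; apply: dP => //.
by rewrite ballE.
Qed.

Lemma continuousP_norm (F : 'rV[R]_n -> 'rV[R]_n) x :
  {for x, continuous F} -> forall e, 0 < e ->
  exists2 d, 0 < d & forall z, `|z - x| < d -> `|F z - F x| < e.
Proof.
move=> cF e e0.
have := cF; move=> /cvgrPdist_lt/(_ e e0)/nbhs_ballP[d /= d0 dP]; exists d => // z zx.
rewrite distrC; apply: dP => //.
by rewrite ballE.
Qed.

Lemma continuous_normP (F : 'rV[R]_n -> 'rV[R]_n) x :
  (forall e, 0 < e -> exists2 d, 0 < d & forall z, `|z - x| < d -> `|F z - F x| < e) ->
  {for x, continuous F}.
Proof.
move=> h P /nbhs_ballP[e /= /h[d d0 dF] eP]; apply/nbhs_ballP; exists d => //= z.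
rewrite ballE => /dF zx; apply: eP.
by rewrite ballE.
Qed.

Lemma open_ballP (W : set 'rV[R]_n) x : open W -> W x ->
  exists2 d, 0 < d & forall z, `|z - x| < d -> W z.
Proof.
move=> oW Wx; have /nbhs_ballP[d /= d0 dW] : nbhs x W by exact: open_nbhs_nbhs.
by exists d => // z zx; apply: dW; rewrite ballE.
Qed.

End Compactness.

(** * The count of a continuous map *)

Section GridCount.
Variables (R : realType) (n : nat) (L : R).
Hypothesis L0 : 0 < L.

(* The grid of mesh [step M] covers the cube of radius [L + 1]. *)
Definition step (M : nat) : R := (2 * L + 2) / M.+1%:R.

Definition pos M (p : vertex n M) : 'rV[R]_n :=
  const_mx (- (L + 1)) + step M *: coords R p.

Definition cells M (W : set 'rV[R]_n) : {set cell n M} :=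
  finset (fun c : cell n M => `[< forall k, (k <= n)%N -> W (pos (vert c k)) >]).

Lemma step_gt0 M : 0 < step M.
Proof. by rewrite divr_gt0 ?ltr0Sn //; have := L0; lra. Qed.

Lemma step_small e : 0 < e -> exists M0, forall M, (M0 <= M)%N -> step M < e.
Proof.
move=> e0; have L2 : 0 <= (2 * L + 2) / e by rewrite divr_ge0 ?ltW //; have := L0; lra.
exists (Num.bound ((2 * L + 2) / e)) => M h.
rewrite ltr_pdivrMr ?ltr0Sn // [e * _]mulrC -ltr_pdivrMr //.
by apply: lt_trans (archi_boundP L2) _; rewrite ltr_nat ltnS.
Qed.

Lemma posE M (p : vertex n M) j : pos p 0 j = - (L + 1) + step M * (p 0 j : nat)%:R.
Proof. by rewrite !mxE. Qed.

(** The margin of [1] around the cube of radius [L] keeps the extreme indices [0] and [M + 1], which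
    are neighbours on the torus, outside it. *)
Lemma pos_in_box M (p : vertex n M) j : `|pos p| <= L -> (0 < p 0%R j <= M)%N.
Proof.
move=> pL; have := le_trans (coord_le_norm _ j) pL; rewrite posE ler_norml => /andP[h1 h2].
have s0 := step_gt0 M; apply/andP; split.
  by rewrite lt0n; apply/eqP => e; move: h1; rewrite e mulr0; lra.
rewrite -ltnS -(ltr_nat R) -(ltr_pM2l s0) {2}/step divfK ?pnatr_eq0 //; lra.
Qed.

(** From a base coordinate [M + 1] a vertex can only have that coordinate equal to [M + 1] or, after
    wrapping, to [0]. Both lie outside the box. *)
Lemma cell_nowrap M (c : cell n M) k : `|pos (vert c k)| <= L -> forall j, (c.1 0%R j <= M)%N.
Proof.
move=> h j; have := pos_in_box j h; rewrite vertE => /andP[v0 vM].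
rewrite leqNgt; apply/negP => Mc; have cM : c.1 0 j = M.+1 :> nat.
  by apply/eqP; rewrite eqn_leq Mc andbT -ltnS ltn_ord.
move: v0 vM; case: (_ < k)%N; last by rewrite addr0 cM ltnn.
by rewrite /= cM [(1 %% _)%N]modn_small // addn1 modnn.
Qed.

Lemma cell_diam M (c : cell n M) k k' : (forall j, (c.1 0%R j <= M)%N) ->
  `|pos (vert c k) - pos (vert c k')| <= step M.
Proof.
move=> cM; apply: norm_le_coord => [|j]; first exact/ltW/step_gt0.
rewrite mxE [(- pos _) 0 j]mxE.
have pE i : pos (vert c i) 0 j = - (L + 1) + step M * (coords R c.1 0 j + (((c.2^-1)%g j < i)%N : nat)%:R).
  by rewrite -coords_vert // !mxE.
rewrite !pE; set x := coords R _ 0 j; set a := _%:R; set b := _%:R.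
have -> : - (L + 1) + step M * (x + a) - (- (L + 1) + step M * (x + b)) = step M * (a - b) by ring.
rewrite normrM gtr0_norm ?step_gt0 // ger_pMr ?step_gt0 //.
by rewrite /a /b; case: (_ < k)%N; case: (_ < k')%N; rewrite ?subrr ?subr0 ?sub0r ?normrN ?normr0 ?normr1.
Qed.

Definition values M (F : 'rV[R]_n -> 'rV[R]_n) y s : vertex n M -> 'rV[R]_n :=
  fun p => F (pos p + s) - y.

Definition sum_fun (I J : Type) (a : I -> 'rV[R]_n) (b : J -> 'rV[R]_n) (x : I + J) :=
  match x with inl i => a i | inr j => b j end.

(** A cell with a noninterior vertex lies within a step of the complement of [W], where the boundary
    condition provides a common [u]. The shift [s] allows a linear map to be sampled with its zero
    at the barycenter of a cell, as in [count_linear]. *)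
Lemma count_homotopy_domain (W : set 'rV[R]_n) (F G : 'rV[R]_n -> 'rV[R]_n) y :
  open W -> (forall x, W x -> `|x| <= L) ->
  {within closure W, continuous F} -> continuous G ->
  (forall z, boundary W z -> exists u, 0 < dot u (F z - y) /\ 0 < dot u (G z - y)) ->
  exists M0, forall M, (M0 <= M)%N -> forall s, `|s| <= step M ->
  forall q, generic (sum_fun (values (M := M) F y 0) (values (M := M) G y s)) q ->
  count q (values (M := M) F y 0) (cells M W) = count q (values (M := M) G y s) (cells M W).
Proof.
move=> oW WL cF cG bW.
(* Near a point of [W] the premise on [p'] fails for small [d]. Near a boundary point, the [u] found
   there persists by continuity. *)
pose Q (d : R) x' := W x' -> (exists2 p', ~ W p' & `|x' - p'| <= d) ->
  exists u, forall p, W p -> `|x' - p| <= d -> 0 < dot u (F p - y) /\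
    forall s, `|s| <= d -> 0 < dot u (G (p + s) - y).
have cW : compact (closure W).
  by apply: compact_closure_bounded; exists L; split; [exact: num_real|move=> M LM x /WL xL; exact: le_trans xL (ltW LM)].
have [d d0 dQ] : exists2 d, 0 < d & forall x, closure W x -> Q d x.
  apply: compact_uniform => // [d d' x d'd Qd Wx [p' Wp' xp']|x clx].
    have [u uP] := Qd Wx (ex_intro2 _ _ p' Wp' (le_trans xp' d'd)).
    exists u => p Wp xp; have [h1 h2] := uP p Wp (le_trans xp d'd).
    by split=> // s sd; apply: h2; apply: le_trans d'd.
  have [Wx|nWx] := pselect (W x).
    have [e e0 eW] := open_ballP oW Wx; exists (e / 2); first by rewrite divr_gt0.
    move=> x' x'x _ Wx' [p' Wp' x'p']; exfalso; apply: Wp'; apply: eW.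
    have -> : p' - x = (x' - x) - (x' - p') by rewrite opprB [RHS]addrC subrKA.
    by rewrite (le_lt_trans (ler_normB _ _)) // (splitr e) ltr_leD.
  have bx : boundary W x by split=> // /interior_subset.
  have [u [uF uG]] := bW x bx.
  have [dF dF0 dFP] := dot_gt0_near uF; have [dG dG0 dGP] := dot_gt0_near uG.
  have [eF eF0 eFP] := within_continuousP cF clx dF0.
  have [eG eG0 eGP] := continuousP_norm (cG x) dG0.
  pose e := Num.min eF eG; have e0 : 0 < e by rewrite lt_min eF0.
  have eeF : e <= eF by rewrite ge_min lexx.
  have eeG : e <= eG by rewrite ge_min lexx orbT.
  exists (e / 4); first by rewrite divr_gt0.
  move=> x' x'x _ Wx' _; exists u => p Wp x'p.
  have px : `|p - x| < e / 2.
    have -> : p - x = (x' - x) - (x' - p) by rewrite opprB [RHS]addrC subrKA.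
    rewrite (le_lt_trans (ler_normB _ _)) //.
    have -> : e / 2 = e / 4 + e / 4 by field.
    by rewrite ltr_leD.
  split.
    apply: dFP; rewrite opprB subrKA; apply: eFP; first exact: subset_closure.
    by apply: lt_le_trans px _; lra.
  move=> s se; apply: dGP; rewrite opprB subrKA; apply: eGP.
  rewrite addrAC (le_lt_trans (ler_normD _ _)) //; lra.
have [M0 M0P] := step_small d0; exists M0 => M /M0P Md s sM q gq.
apply: count_homotopy => //.
move=> c; rewrite inE => /asboolP cT [k kn /existsNP[c' /existsNP[k' /not_implyP[k'n /not_implyP[vE c'T]]]]].
have [k2 k2n nW] : exists2 k2, (k2 <= n)%N & ~ W (pos (vert c' k2)).
  apply: contrapT => no; apply: c'T; rewrite inE; apply/asboolP => k2 k2n.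
  by apply: contrapT => nW; apply: no; exists k2.
have Wp := cT k kn; have pL := WL _ Wp.
have c'M := cell_nowrap (c := c') (k := k') (eq_rect_r (fun v => `|pos v| <= L) pL vE).
have cM := cell_nowrap pL.
have [|u uP] := dQ _ (subset_closure Wp) Wp.
  exists (pos (vert c' k2)) => //; rewrite -vE; apply: le_trans (ltW Md); exact: cell_diam.
exists u => l ln; have [|h1 h2] := uP _ (cT l ln).
  by apply: le_trans (ltW Md); exact: cell_diam.
by rewrite /values addr0; split=> //; apply: h2; exact: le_trans (ltW Md).
Qed.

End GridCount.

Section EventuallyGeneric.
Variables (R : realType) (n : nat).
Implicit Types E : nat -> 'rV[R]_n -> Prop.

(* For all fine enough grids and all [q] in general position with respect to
   some finite family depending on the grid. *)
Definition ev_generic E : Prop := exists M0, forall M, (M0 <= M)%N ->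
  exists (I : finType) (a : I -> 'rV[R]_n), forall q, generic a q -> E M q.

Lemma ev_generic_and E E' : ev_generic E -> ev_generic E' ->
  ev_generic (fun M q => E M q /\ E' M q).
Proof.
move=> [M0 h] [M1 h']; exists (maxn M0 M1) => M; rewrite geq_max => /andP[/h[I [a ha]] /h'[J [b hb]]].
exists (I + J)%type, (sum_fun a b) => q gq; split.
- by apply: ha; exact: (generic_comp (phi := inl) gq).
- by apply: hb; exact: (generic_comp (phi := inr) gq).
Qed.

Lemma ev_generic_imp E E' : (forall M q, E M q -> E' M q) -> ev_generic E -> ev_generic E'.
Proof.
move=> EE' [M0 h]; exists M0 => M /h[I [a ha]]; exists I, a => q /ha; exact: EE'.
Qed.

Lemma ev_generic_all (T : eqType) (s : seq T) (E : T -> nat -> 'rV[R]_n -> Prop) :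
  (forall x, x \in s -> ev_generic (E x)) ->
  ev_generic (fun M q => forall x, x \in s -> E x M q).
Proof.
elim: s => [_|x s IH h].
  by exists 0%N => M _; exists void, (fun v : void => match v with end).
apply: ev_generic_imp (ev_generic_and (h x (mem_head _ _)) (IH _)).
  by move=> M q [h1 h2] z; rewrite inE => /orP[/eqP ->//|/h2].
by move=> z zs; apply: h; rewrite inE zs orbT.
Qed.

Lemma ev_generic_large (P : nat -> Prop) M0 : (forall M, (M0 <= M)%N -> P M) ->
  ev_generic (fun M _ => P M).
Proof.
move=> h; exists M0 => M /h PM; exists void, (fun v : void => match v with end) => q _; exact: PM.
Qed.

Lemma ev_generic_family (I : nat -> finType) (a : forall M, I M -> 'rV[R]_n) :
  ev_generic (fun M q => generic (a M) q).
Proof. by exists 0%N => M _; exists (I M), (a M). Qed.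

Lemma ev_generic_ex E : ev_generic E -> exists M q, E M q.
Proof.
move=> [M0 /(_ M0 (leqnn _))[I [a ha]]]; have [q gq] := generic_exists a.
by exists M0, q; exact: ha.
Qed.

End EventuallyGeneric.

Lemma pos_min_seq (R : realDomainType) (T : eqType) (s : seq T) (P : T -> R -> Prop) :
  (forall x, x \in s -> exists2 d, 0 < d & forall d', 0 < d' -> d' <= d -> P x d') ->
  exists2 d, 0 < d & forall d', 0 < d' -> d' <= d -> forall x, x \in s -> P x d'.
Proof.
elim: s => [_|x s IH h]; first by exists 1.
have [|d d0 dP] := IH; first by move=> z zs; apply: h; rewrite inE zs orbT.
have [e e0 eP] := h x (mem_head _ _).
exists (Num.min d e); first by rewrite lt_min d0.
move=> d' d'0; rewrite le_min => /andP[dd' de'] z; rewrite inE => /orP[/eqP ->|zs].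
  exact: eP.
exact: (dP d').
Qed.

(** * Localisation of the count at the zeros *)

Section ZeroCount.
Variables (R : realType) (n : nat) (L : R).
Hypothesis L0 : 0 < L.
Implicit Types (W : set 'rV[R]_n) (F G : 'rV[R]_n -> 'rV[R]_n) (A : 'M[R]_n).

Lemma ev_homotopy W F G y (s : nat -> 'rV[R]_n) :
  open W -> (forall x, W x -> `|x| <= L) ->
  {within closure W, continuous F} -> continuous G ->
  (forall z, boundary W z -> exists u, 0 < dot u (F z - y) /\ 0 < dot u (G z - y)) ->
  (forall M, `|s M| <= step L M) ->
  ev_generic (fun M q => count q (values L (M := M) F y 0) (cells L M W) =
                         count q (values L (M := M) G y (s M)) (cells L M W)).
Proof.
move=> oW WL cF cG bW sL; have [M0 h] := count_homotopy_domain L0 oW WL cF cG bW.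
exists M0 => M M0M; exists (vertex n M + vertex n M)%type.
exists (sum_fun (values L (M := M) F y 0) (values L (M := M) G y (s M))) => q; exact: h.
Qed.

(* [F - y] and the linear map [A] centred at [x] are nowhere opposite near [x]. *)
Definition linear_like F y x A : Prop := exists2 r, 0 < r &
  forall z, z != x -> `|z - x| < r ->
  exists u, 0 < dot u (F z - y) /\ 0 < dot u ((z - x) *m A).

Lemma mulmx_norm_le (A : 'M[R]_n) : exists2 c, 0 < c &
  forall v : 'rV[R]_n, `|v *m A| <= c * `|v|.
Proof.
exists (\sum_j \sum_i `|A i j| + 1).
  by rewrite ltr_pwDr // sumr_ge0 // => j _; rewrite sumr_ge0.
move=> z; apply: norm_le_coord => [|j].
  by rewrite mulr_ge0 // addr_ge0 // sumr_ge0 // => j _; rewrite sumr_ge0.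
rewrite mxE (le_trans (ler_norm_sum _ _ _)) //.
apply: (@le_trans _ _ (\sum_i `|A i j| * `|z|)).
  by apply: ler_sum => i _; rewrite normrM mulrC ler_wpM2l // coord_le_norm.
rewrite -mulr_suml ler_wpM2r // [X in _ <= X + 1](bigD1 j) //= -addrA lerDl addr_ge0 //.
by rewrite sumr_ge0 // => k _; rewrite sumr_ge0.
Qed.

Lemma mulmx_continuous A : continuous (fun z : 'rV[R]_n => z *m A).
Proof.
have [c c0 cA] := mulmx_norm_le A.
move=> x; apply: continuous_normP => e e0; exists (e / c); first by rewrite divr_gt0.
move=> z; rewrite ltr_pdivlMr // => xz.
by rewrite -mulmxBl (le_lt_trans (cA _)) // mulrC.
Qed.

Lemma affine_continuous x A y : continuous (fun z : 'rV[R]_n => (z - x) *m A + y).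
Proof.
move=> z; apply: continuous_normP => e e0.
have [d d0 dP] := continuousP_norm (@mulmx_continuous A z) e0; exists d => // w /dP.
by rewrite !mulmxBl opprD addrACA subrr addr0 opprB addrA subrK.
Qed.

Definition norm_ball (x : 'rV[R]_n) (r : R) := [set z : 'rV[R]_n | `|z - x| < r].

Lemma norm_ball_open x r : open (norm_ball x r).
Proof.
have -> : norm_ball x r = ball x r.
  by apply/seteqP; split => z; rewrite mx_norm_ball /ball_ /norm_ball /= distrC.
exact: ball_open.
Qed.

Lemma closure_norm_ball x r z : closure (norm_ball x r) z -> `|z - x| <= r.
Proof.
move=> clz; apply/ler_addgt0Pr => e e0.
have [w [wx]] := clz _ (nbhsx_ballx z e e0).
rewrite mx_norm_ball /ball_ /= => zw.
by rewrite -(subrKA w) (le_trans (ler_normD _ _)) // addrC lerD // ltW.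
Qed.

Lemma boundary_norm_ball x r z : boundary (norm_ball x r) z -> `|z - x| = r.
Proof.
move=> [/closure_norm_ball zr zi]; apply/eqP; rewrite eq_le zr leNgt; apply/negP => zx.
by apply: zi; rewrite ((interior_id _).1 (@norm_ball_open x r)).
Qed.

Lemma count_linear_like F y x r A : 0 < r -> A \in unitmx ->
  (forall z, norm_ball x r z -> `|z| <= L) ->
  {within closure (norm_ball x r), continuous F} ->
  (forall z, `|z - x| = r -> exists u, 0 < dot u (F z - y) /\ 0 < dot u ((z - x) *m A)) ->
  ev_generic (fun M q => count q (values L (M := M) F y 0) (cells L M (norm_ball x r)) = sgz (\det A)).
Proof.
move=> r0 uA BL cF bF.
have xL : `|x| <= L by apply: BL; rewrite /norm_ball /= subrr normr0.
(* [t] gives [x] in grid units and its integer part [b] is the base of the cube containing [x]. The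
   shift [s] carries the barycenter [w] of the cell [(b, 1)] to [x]; both lie in the same cube, so
   it is at most one step. *)
pose t M j : R := (x 0 j + L + 1) / step L M.
have t0 M j : 0 <= t M j.
  rewrite divr_ge0 ?ltW ?step_gt0 //; have := le_trans (coord_le_norm x j) xL.
  by rewrite ler_norml => /andP[]; lra.
have tM M j : t M j < M.+1%:R.
  rewrite ltr_pdivrMr ?step_gt0 // /step mulrC divfK ?pnatr_eq0 //.
  have := le_trans (coord_le_norm x j) xL.
  by rewrite ler_norml => /andP[]; lra.
pose b M : vertex n M := \row_j inord (Num.truncn (t M j)).
have bE M j : b M 0 j = Num.truncn (t M j) :> nat.
  rewrite mxE inordK // ltnS; apply: ltnW; rewrite -(ltr_nat R).
  by apply: le_lt_trans (tM M j); rewrite truncn_le.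
have bt M j : (b M 0%R j)%:R <= t M j < (b M 0%R j)%:R + 1.
  by rewrite bE natr1 truncn_itv.
pose w M := coords R (b M) + \row_j ((n - j)%:R / n.+1%:R).
pose s M := x - const_mx (- (L + 1)) - step L M *: w M.
have sM M : `|s M| <= step L M.
  apply: norm_le_coord => [|j]; first by rewrite ltW // step_gt0.
  have fr_lt1 : ((n - j)%:R / n.+1%:R : R) <= 1.
    by rewrite ler_pdivrMr ?ltr0Sn // mul1r ler_nat (leq_trans (leq_subr _ _)).
  have fr_gt0 : 0 <= ((n - j)%:R / n.+1%:R : R) by rewrite divr_ge0.
  have -> : s M 0 j = step L M * (t M j - ((b M 0%R j)%:R + (n - j)%:R / n.+1%:R)).
    rewrite mulrBr [step L M * t M j]mulrC divfK ?gt_eqF ?step_gt0 //.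
    by rewrite /s /w !mxE; ring.
  rewrite normrM gtr0_norm ?step_gt0 // ger_pMr ?step_gt0 // ler_norml.
  have lin (a c d : R) : c <= a < c + 1 -> d <= 1 -> 0 <= d -> -1 <= a - (c + d) <= 1.
    by move=> /andP[h1 h2] h3 h4; apply/andP; split; lra.
  exact: lin.
have [M0 M0P] := step_small L0 r0.
have bcells M : step L M < r -> (b M, 1%g) \in cells L M (norm_ball x r).
  move=> Mr; rewrite inE; apply/asboolP => k kn; apply: le_lt_trans Mr.
  apply: norm_le_coord => [|j]; first by rewrite ltW // step_gt0.
  have bM : (b M 0%R j <= M)%N.
    by rewrite -ltnS -(ltr_nat R) bE (le_lt_trans _ (tM M j)) // truncn_le.
  have -> : (pos L (vert (b M, 1%g) k) - x) 0 j =
      step L M * ((b M 0%R j)%:R + ((((b M, 1%g : 'S_n).2^-1)%g j < k)%N : nat)%:R - t M j).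
    have e : coords R (vert (b M, 1%g : 'S_n) k) 0 j = (b M 0%R j)%:R + ((((b M, 1%g : 'S_n).2^-1)%g j < k)%N : nat)%:R.
      by rewrite coords_vert //= mxE.
    rewrite mulrBr [step L M * t M j]mulrC divfK ?gt_eqF ?step_gt0 // -e.
    by rewrite !mxE; ring.
  rewrite normrM gtr0_norm ?step_gt0 // ger_pMr ?step_gt0 // ler_norml.
  have lin (a c d : R) : c <= a < c + 1 -> d <= 1 -> 0 <= d -> -1 <= c + d - a <= 1.
    by move=> /andP[h1 h2] h3 h4; apply/andP; split; lra.
  by apply: lin => //; case: (_ < k)%N.
pose G z := (z - x) *m A + y.
have hom := fun bW => ev_homotopy (y := y) (@norm_ball_open x r) BL cF (@affine_continuous x A y) bW sM.
have gen := @ev_generic_family R n (fun M => vertex n M) (fun M => values L (M := M) G y (s M)).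
have lrg := @ev_generic_large R n (fun M => step L M < r) M0 M0P.
apply: ev_generic_imp (ev_generic_and (ev_generic_and gen lrg) (hom _)) => [M q [[gq Mr] ->]|z /boundary_norm_ball /bF[u [h1 h2]]].
  have vE : values L (M := M) G y (s M) = fun p => (step L M *: (coords R p - w M)) *m A.
    apply: funext => p; rewrite /values /G addrK; congr (_ *m A).
    by rewrite /s /pos; apply/rowP => j; rewrite !mxE; ring.
  rewrite -/G vE; apply: count_linear => //; [exact: bcells| |exact: step_gt0|by rewrite -vE].
  move=> c j; rewrite inE => /asboolP/(_ 0%N (leq0n _))/BL cL.
  exact: cell_nowrap cL j.
by exists u; rewrite addrK.
Qed.

End ZeroCount.

Section ZeroSum.
Variables (R : realType) (n : nat).
Implicit Types (W : set 'rV[R]_n) (F G : 'rV[R]_n -> 'rV[R]_n) (A : 'rV[R]_n -> 'M[R]_n).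

Definition zeros W F (y : 'rV[R]_n) := [set x | W x /\ F x = y].

Lemma boundary_zeros W F y x : open W -> (forall z, boundary W z -> F z <> y) ->
  closure W x -> F x = y -> W x.
Proof.
move=> oW bF clx Fx; apply: contrapT => nWx; apply: (bF x) => //.
by split=> // /interior_subset.
Qed.

Lemma zeros_finite W F y A : open W -> bounded_set W ->
  {within closure W, continuous F} -> (forall z, boundary W z -> F z <> y) ->
  (forall x, zeros W F y x -> linear_like F y x (A x)) ->
  finite_set (zeros W F y).
Proof.
move=> oW bW cF bF lin.
apply: compact_isolated_finite => [|x zx].
  apply: (@subclosed_compact _ _ (closure W)); last first.
  - by move=> x [/subset_closure].
  - exact: compact_closure_bounded.
  move=> x clx; have clWx : closure W x by apply: closure_subset clx => z [].
  have Fx : F x = y.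
    apply/eqP; rewrite -subr_eq0 -normr_eq0 eq_le normr_ge0 andbT.
    apply/ler_addgt0Pr => e e0; rewrite add0r.
    have [d d0 dF] := within_continuousP cF clWx e0.
    have [z [[Wz Fz] xz]] := clx _ (nbhsx_ballx x d d0).
    rewrite distrC -Fz ltW // dF //; first exact: subset_closure.
    by move: xz; rewrite ballE.
  by split=> //; exact: boundary_zeros clWx Fx.
have [r r0 rP] := lin x zx; exists r => // z zxr [Wz Fz]; apply: contrapT => /eqP zNx.
by have [u] := rP z zNx zxr; rewrite Fz subrr dot0r ltxx => -[].
Qed.

(** A cell inside the ball around a zero is counted by [count_linear_like]. Any other cell of [W]
    has a vertex away from all zeros, so its values lie in a half-space. *)
Lemma ev_count_zeros L W F y (Z : seq 'rV[R]_n) A : 0 < L ->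
  open W -> (forall x, W x -> `|x| <= L) ->
  {within closure W, continuous F} -> (forall z, boundary W z -> F z <> y) ->
  uniq Z -> (forall x, x \in Z <-> zeros W F y x) ->
  (forall x, x \in Z -> A x \in unitmx) ->
  (forall x, x \in Z -> linear_like F y x (A x)) ->
  ev_generic (fun M q => count q (values L (M := M) F y 0) (cells L M W) =
                         \sum_(x <- Z) sgz (\det (A x))).
Proof.
move=> L0 oW WL cF bF uZ ZP uA lin.
(* The factor [3] covers a vertex in the ball of one zero, another vertex of the same cell less than
   [r] away, and a remaining distance [r] to any other zero. *)
have [r r0 /(_ r r0 (lexx r)) rP] : exists2 r, 0 < r & forall r', 0 < r' -> r' <= r ->
    forall x, x \in Z -> [/\ forall z, `|z - x| <= r' -> W z,
      forall z, z != x -> `|z - x| <= r' -> exists u, 0 < dot u (F z - y) /\ 0 < dot u ((z - x) *m A x)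
      & forall x', x' \in Z -> x' != x -> 3 * r' <= `|x' - x|].
  apply: pos_min_seq => x xZ; have [Wx Fx] := (ZP x).1 xZ.
  have [d1 d10 d1P] := open_ballP oW Wx; have [d2 d20 d2P] := lin x xZ.
  have [d3 d30 d3P] : exists2 d, 0 < d & forall d', 0 < d' -> d' <= d ->
      forall x', x' \in Z -> x' != x -> 3 * d' <= `|x' - x|.
    apply: (@pos_min_seq R _ Z (fun x' d => x' != x -> 3 * d <= `|x' - x|)) => x' x'Z.
    have [->|x'x] := eqVneq x' x; first by exists 1.
    exists (`|x' - x| / 3); first by rewrite divr_gt0 // normr_gt0 subr_eq0.
    by move=> d' d'0 h _; lra.
  pose d := Num.min (d1 / 2) (Num.min (d2 / 2) d3).
  have d0 : 0 < d by rewrite !lt_min d30 !divr_gt0.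
  have h1 : d <= d1 / 2 by rewrite /d !ge_min lexx.
  have h2 : d <= d2 / 2 by rewrite /d !ge_min lexx !orbT.
  have h3 : d <= d3 by rewrite /d !ge_min lexx !orbT.
  exists d => // d' d'0 d'd; split=> [z zx|z zNx zx|x' x'Z x'x].
  - by apply: d1P; apply: le_lt_trans zx _; lra.
  - by apply: d2P => //; apply: le_lt_trans zx _; lra.
  - by apply: (d3P d') => //; lra.
(* Away from the zeros, [u] is the value of [F - y] at the point itself. *)
pose Q (d : R) x' := (forall x, x \in Z -> r <= `|x' - x|) ->
  exists u, forall p, closure W p -> `|p - x'| <= d -> 0 < dot u (F p - y).
have [d d0 dQ] : exists2 d, 0 < d & forall x, closure W x -> Q d x.
  apply: compact_uniform => [|d d' x d'd Qd xr|x clx].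
  - by apply: compact_closure_bounded; exists L; split; [exact: num_real|move=> M LM x /WL xL; exact: le_trans xL (ltW LM)].
  - have [u uP] := Qd xr; exists u => p Wp px; apply: uP => //; exact: le_trans px _.
  have [Fx|Fx] := eqVneq (F x) y.
    have xZ : x \in Z by apply/ZP; split=> //; exact: boundary_zeros clx Fx.
    by exists r => // x' x'x _ /(_ x xZ); rewrite leNgt x'x.
  have u0 : 0 < dot (F x - y) (F x - y) by apply: dot_gt0; rewrite subr_eq0.
  have [e e0 eP] := dot_gt0_near u0; have [d d0 dP] := within_continuousP cF clx e0.
  exists (d / 2); first by rewrite divr_gt0.
  move=> x' x'x _ _; exists (F x - y) => p clp px'; apply: eP; rewrite opprB subrKA.
  by apply: dP => //; rewrite -(subrKA x') (le_lt_trans (ler_normD _ _)) // (splitr d) ler_ltD.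
have ballW x z : x \in Z -> norm_ball x r z -> W z.
  by move=> /rP[h _ _] zx; apply: h; exact: ltW.
have [M0 M0P] := step_small L0 (ltac:(by rewrite lt_min r0) : 0 < Num.min r d).
have lrg := @ev_generic_large R n (fun M => step L M < Num.min r d) M0 M0P.
have gen := @ev_generic_family R n (fun M => vertex n M) (fun M => values L (M := M) F y 0).
have loc : ev_generic (fun M q => forall x, x \in Z -> count q (values L (M := M) F y 0)
    (cells L M (norm_ball x r)) = sgz (\det (A x))).
  apply: ev_generic_all => x xZ; have [h1 h2 h3] := rP x xZ.
  apply: count_linear_like => //.
  - exact: uA.
  - by move=> z zx; apply: WL; apply: ballW zx.
  - apply: continuous_subspaceW cF; apply: closure_subset => z; exact: ballW.
  - move=> z zx; apply: h2; last by rewrite zx.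
    by apply: contraTneq r0 => zEx; rewrite -zx zEx subrr normr0 ltxx.
apply: ev_generic_imp (ev_generic_and (ev_generic_and lrg gen) loc) => M q [[Md gq] cnt].
rewrite -(eq_big_seq _ cnt) /count /=.
under [RHS]eq_bigr do rewrite big_mkcond.
rewrite exchange_big /= big_mkcond; apply: eq_bigr => c _.
move: Md; rewrite lt_min => /andP[Mr Md].
have cellW x : x \in Z -> c \in cells L M (norm_ball x r) -> c \in cells L M W.
  move=> xZ; rewrite !inE => /asboolP h; apply/asboolP => k kn.
  exact: ballW xZ (h k kn).
have [[x [xZ cx]]|no] := pselect (exists x, x \in Z /\ c \in cells L M (norm_ball x r)).
  rewrite (cellW x) // (bigD1_seq x) //= cx big_seq_cond big1 ?addr0 // => x' /andP[x'Z x'x].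
  case: ifP => // cx'; exfalso.
  move: cx cx'; rewrite !inE => /asboolP/(_ 0%N (leq0n _)) h /asboolP/(_ 0%N (leq0n _)) h'.
  have [_ _ /(_ x' x'Z x'x)] := rP x xZ; apply/negP; rewrite -ltNge.
  rewrite -(subrKA (pos L (vert c 0))) (le_lt_trans (ler_normD _ _)) //.
  by rewrite [ `|x' - _|]distrC; move: h h'; rewrite /norm_ball /=; lra.
rewrite [RHS]big_seq big1 => [|x xZ]; last first.
  by case: ifP => // cx; case: no; exists x.
case: ifP => // cW; move: (cW); rewrite inE => /asboolP cWP.
have cM := cell_nowrap L0 (WL _ (cWP 0%N (leq0n _))).
(* If vertex [0] is outside all balls it will do. Otherwise some vertex leaves the ball of that
   zero, and the separation of zeros keeps it out of the other balls. *)
have [k kn kout] : exists2 k, (k <= n)%N & forall x, x \in Z -> r <= `|pos L (vert c k) - x|.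
  have [[x [xZ x0]]|no0] := pselect (exists x, x \in Z /\ norm_ball x r (pos L (vert c 0))); last first.
    exists 0%N => // x xZ; rewrite leNgt; apply/negP => x0; by apply: no0; exists x.
  have [k [kn kx]] : exists k, (k <= n)%N /\ r <= `|pos L (vert c k) - x|.
    apply: contrapT => nok; apply: no; exists x; split=> //; rewrite inE; apply/asboolP => k kn.
    by rewrite /norm_ball /= ltNge; apply/negP => kx; apply: nok; exists k.
  exists k => // x' x'Z; have [->//|x'x] := eqVneq x' x.
  have [_ _ /(_ x' x'Z x'x)] := rP x xZ.
  rewrite -(subrKA (pos L (vert c 0))) => sep.
  have := le_trans sep (ler_normD _ _).
  have := ler_normB (pos L (vert c k) - x') (pos L (vert c k) - pos L (vert c 0)).
  rewrite opprB [_ + (pos L _ - _)]addrC subrKA [ `|x' - _|]distrC.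
  by have := cell_diam L0 k 0 cM; move: x0; rewrite /norm_ball /=; lra.
have [u uP] := dQ _ (subset_closure (cWP k kn)) kout.
rewrite (@simplex_halfspace _ _ _ _ _ u) ?mulr0 // => [|l].
  exact: (generic_comp (phi := fun j : 'I_n.+1 => vert c j) gq).
have ln : (l <= n)%N by rewrite -ltnS.
rewrite /values addr0; apply: uP; first exact/subset_closure/cWP.
by apply: le_trans (ltW Md); apply: cell_diam.
Qed.
End ZeroSum.

(** * Computing the degree *)

Section Uniqueness.
Variables (R : realType) (n : nat).
Implicit Types (W : set 'rV[R]_n) (f g : 'rV[R]_n -> 'rV[R]_n) (A : 'rV[R]_n -> 'M[R]_n).

Lemma enormE (v : 'rV[R]_n) : enorm v = Num.sqrt (dot v v).
Proof. by congr (Num.sqrt _); apply: eq_bigr => i _; rewrite expr2. Qed.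

Lemma enorm_ge0 (v : 'rV[R]_n) : 0 <= enorm v.
Proof. exact: sqrtr_ge0. Qed.

Lemma sqr_enorm (v : 'rV[R]_n) : enorm v ^+ 2 = dot v v.
Proof. by rewrite enormE sqr_sqrtr // dot_ge0. Qed.

Lemma dot_le_enorm (u v : 'rV[R]_n) : `|dot u v| <= enorm u * enorm v.
Proof.
rewrite -(ler_pXn2r (n := 2)) ?nnegrE ?mulr_ge0 ?enorm_ge0 //.
by rewrite exprMn !sqr_enorm real_normK ?num_real // dot_cauchy_schwarz.
Qed.

Lemma norm_le_enorm (v : 'rV[R]_n) : `|v| <= enorm v.
Proof.
apply: norm_le_coord => [|i]; first exact: enorm_ge0.
rewrite -(ler_pXn2r (n := 2)) ?nnegrE ?enorm_ge0 // sqr_enorm real_normK ?num_real //.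
rewrite /dot (bigD1 i) //= -expr2 lerDl sumr_ge0 // => j _.
by rewrite -expr2 sqr_ge0.
Qed.

Lemma enorm_le_norm (v : 'rV[R]_n) : enorm v <= n.+1%:R * `|v|.
Proof.
rewrite -(ler_pXn2r (n := 2)) ?nnegrE ?enorm_ge0 ?mulr_ge0 // sqr_enorm.
apply: (@le_trans _ _ (\sum_(i < n) `|v| ^+ 2)).
  apply: ler_sum => i _; rewrite -expr2 -real_normK ?num_real // ler_pXn2r ?nnegrE //.
  exact: coord_le_norm.
rewrite sumr_const card_ord -[_ *+ n]mulr_natl exprMn ler_wpM2r ?sqr_ge0 //.
by rewrite -natrX ler_nat; nia.
Qed.

(** By Cauchy-Schwarz, [u] itself is the common direction. This turns the estimates on [g - f] into
    the angular condition of the count. *)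
Lemma approximation_aligned (u v : 'rV[R]_n) : enorm (v - u) < enorm u ->
  0 < dot u u /\ 0 < dot u v.
Proof.
move=> vu; have u0 : 0 < enorm u by apply: le_lt_trans vu; exact: enorm_ge0.
have uu : 0 < dot u u by rewrite -sqr_enorm exprn_gt0.
split=> //; have := dot_le_enorm u (v - u); rewrite dotBr ler_norml => /andP[h _].
have : enorm u * enorm (v - u) < dot u u by rewrite -sqr_enorm expr2 ltr_pM2l.
by move: h; lra.
Qed.

Lemma differentiable_remainder g x : differentiable g x -> forall e, 0 < e ->
  exists2 d, 0 < d & forall z, `|z - x| < d ->
  `|g z - g x - (z - x) *m jacobian g x| <= e * `|z - x|.
Proof.
move=> dg e e0.
have /eqaddoP/(_ e)/(_ e0)/nbhs_ballP[d /= d0 dP] := diff_locally dg.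
exists d => // z zx; have := dP (z - x).
rewrite mx_norm_ball /ball_ /= sub0r normrN => /(_ zx).
by rewrite !fctE /= subrK /jacobian mul_rV_lin1 /= opprD addrA.
Qed.

Lemma linear_like_differentiable g x : differentiable g x ->
  jacobian g x \in unitmx -> linear_like g (g x) x (jacobian g x).
Proof.
move=> dg uJ; set J := jacobian g x in uJ *.
have [c c0 cP] := mulmx_norm_le (invmx J).
(* [c] bounds the inverse of [J], [n + 1] compares the Euclidean with the sup norm, and the factor
   [2] makes the inequality strict. *)
have e0 : 0 < (2 * n.+1%:R * c)^-1 :> R by rewrite invr_gt0 !mulr_gt0 ?ltr0Sn.
have [d d0 dP] := differentiable_remainder dg e0; exists d => // z zNx zx.
exists ((z - x) *m J).
suff /approximation_aligned[h1 h2] : enorm (g z - g x - (z - x) *m J) < enorm ((z - x) *m J) by [].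
have zx0 : 0 < `|z - x| by rewrite normr_gt0 subr_eq0.
apply: le_lt_trans (enorm_le_norm _) _.
apply: (@lt_le_trans _ _ `|(z - x) *m J|); last exact: norm_le_enorm.
have h := cP ((z - x) *m J); rewrite mulmxK // in h.
have := dP z zx; rewrite -/J => h'.
have n0 : 0 < n.+1%:R :> R by rewrite ltr0Sn.
apply: (@le_lt_trans _ _ (n.+1%:R * ((2 * n.+1%:R * c)^-1 * `|z - x|))).
  by rewrite ler_pM2l.
have -> : n.+1%:R * ((2 * n.+1%:R * c)^-1 * `|z - x|) = `|z - x| / (2 * c).
  by field; rewrite !gt_eqF.
rewrite ltr_pdivrMr ?mulr_gt0 //; apply: le_lt_trans h _.
have : 0 < `|(z - x) *m J|.
  rewrite normr_gt0; apply: contraTneq zx0 => e.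
  by rewrite -[z - x](mulmxK uJ) e mul0mx normr0 ltxx.
by move=> p; rewrite mulrCA mulrC; nra.
Qed.

Lemma smooth_differentiable g x : smooth g -> differentiable g x.
Proof. by move=> /(_ 1%N)[h _]; exact: h. Qed.

Lemma smooth_continuous g : smooth g -> continuous g.
Proof. by move=> sg x; apply: differentiable_continuous; exact: smooth_differentiable. Qed.

(** Three counts are evaluated on one grid with one [q]: [f] at its zeros, [g] at its zeros, and the
    equality of the two by homotopy. The right-hand side does not mention [g], hence independence of
    the approximation. *)
Lemma degree_approximation_sum W f g y A : open W -> bounded_set W ->
  {within closure W, continuous f} -> (forall z, boundary W z -> f z <> y) ->
  (forall x, zeros W f y x -> A x \in unitmx /\ linear_like f y x (A x)) ->
  degree_approximation f W y g ->
  \sum_(x \in zeros W g y) sgz (\det (jacobian g x)) =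
  \sum_(x \in zeros W f y) sgz (\det (A x)).
Proof.
move=> oW bW cf bf Af [sg fg rg].
have [L L0 WL] := bounded_setP bW.
have al z : boundary W z -> 0 < dot (f z - y) (f z - y) /\ 0 < dot (f z - y) (g z - y).
  move=> bz; apply: approximation_aligned; rewrite opprB subrKA; apply: fg => //.
  by case: bz.
have bg z : boundary W z -> g z <> y.
  by move=> /al[_ +] gz; rewrite gz subrr dot0r ltxx.
have Ag x : zeros W g y x -> jacobian g x \in unitmx /\ linear_like g y x (jacobian g x).
  move=> [Wx gx]; have uJ : jacobian g x \in unitmx by rewrite unitmxE unitfE; exact: rg.
  by split=> //; rewrite -gx; apply: linear_like_differentiable => //; exact: smooth_differentiable.
have cg : {within closure W, continuous g} by apply: continuous_subspaceT; exact: smooth_continuous.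
have finf := zeros_finite oW bW cf bf (fun x zx => (Af x zx).2).
have fing := zeros_finite oW bW cg bg (fun x zx => (Ag x zx).2).
rewrite !fsbig_finite //=.
have inZ F x (finF : finite_set (zeros W F y)) : x \in fset_set (zeros W F y) <-> zeros W F y x.
  by rewrite in_fset_set //; split => [/set_mem|/mem_set].
have evf := ev_count_zeros (A := A) L0 oW WL cf bf (fset_uniq _) (fun x => inZ f x finf)
  (fun x xZ => (Af x ((inZ f x finf).1 xZ)).1) (fun x xZ => (Af x ((inZ f x finf).1 xZ)).2).
have evg := ev_count_zeros (A := jacobian g) L0 oW WL cg bg (fset_uniq _) (fun x => inZ g x fing)
  (fun x xZ => (Ag x ((inZ g x fing).1 xZ)).1) (fun x xZ => (Ag x ((inZ g x fing).1 xZ)).2).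
have evh := ev_homotopy L0 oW WL cf (smooth_continuous sg) (fun z bz => ex_intro _ _ (al z bz))
  (s := fun=> 0) (fun M => _).
have [|M [q [[e1 e2] e3]]] := ev_generic_ex (ev_generic_and (ev_generic_and evf evg) (evh _)).
  by move=> M; rewrite normr0 ltW // step_gt0.
by rewrite -e1 -e2 e3.
Qed.

Lemma degreeE W f y A : open W -> bounded_set W ->
  {within closure W, continuous f} -> (forall z, boundary W z -> f z <> y) ->
  (forall x, zeros W f y x -> A x \in unitmx /\ linear_like f y x (A x)) ->
  (exists g, degree_approximation f W y g) ->
  degree f W y = \sum_(x \in zeros W f y) sgz (\det (A x)).
Proof.
move=> oW bW cf bf Af [g gf]; rewrite /degree.
set D := [set d | _]; have : D (xget 0 D).
  by apply: (xgetPex 0); exists (\sum_(x \in zeros W g y) sgz (\det (jacobian g x))); exists g.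
move=> [g' gf' ->]; exact: degree_approximation_sum gf'.
Qed.

End Uniqueness.

(** * Existence of degree approximations *)

Section Polynomials.
Variables (R : realType) (n : nat).

(** Polynomial functions as an inductive predicate: bounds on boxes, gradients and closure under
    composition follow by induction on it. *)
Inductive polyfun : ('rV[R]_n -> R) -> Prop :=
| polyfun_cst c : polyfun (fun=> c)
| polyfun_coord i : polyfun (fun x => x 0 i)
| polyfun_add f g : polyfun f -> polyfun g -> polyfun (fun x => f x + g x)
| polyfun_mul f g : polyfun f -> polyfun g -> polyfun (fun x => f x * g x).

Lemma polyfun_sum (I : Type) (s : seq I) (P : pred I) (F : I -> 'rV[R]_n -> R) :
  (forall i, P i -> polyfun (F i)) -> polyfun (fun x => \sum_(i <- s | P i) F i x).
Proof.
move=> PF; elim: s => [|i s IH].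
  by rewrite (_ : (fun x => _) = (fun=> 0)) //; [exact: polyfun_cst|apply: funext => x; rewrite big_nil].
have [Pi|Pi] := boolP (P i).
  rewrite (_ : (fun x => _) = (fun x => F i x + \sum_(j <- s | P j) F j x)).
    exact: (polyfun_add (PF i Pi)).
  by apply: funext => x; rewrite big_cons Pi.
by rewrite (_ : (fun x => _) = (fun x => \sum_(j <- s | P j) F j x)) //; apply: funext => x; rewrite big_cons (negbTE Pi).
Qed.

Lemma polyfun_prod (I : Type) (s : seq I) (P : pred I) (F : I -> 'rV[R]_n -> R) :
  (forall i, P i -> polyfun (F i)) -> polyfun (fun x => \prod_(i <- s | P i) F i x).
Proof.
move=> PF; elim: s => [|i s IH].
  by rewrite (_ : (fun x => _) = (fun=> 1)) //; [exact: polyfun_cst|apply: funext => x; rewrite big_nil].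
have [Pi|Pi] := boolP (P i).
  rewrite (_ : (fun x => _) = (fun x => F i x * \prod_(j <- s | P j) F j x)).
    exact: (polyfun_mul (PF i Pi)).
  by apply: funext => x; rewrite big_cons Pi.
by rewrite (_ : (fun x => _) = (fun x => \prod_(j <- s | P j) F j x)) //; apply: funext => x; rewrite big_cons (negbTE Pi).
Qed.

Lemma polyfun_exp f k : polyfun f -> polyfun (fun x => f x ^+ k).
Proof.
move=> pf; elim: k => [|k IH].
  by rewrite (_ : (fun x => _) = (fun=> 1)); [exact: polyfun_cst|apply: funext => x; rewrite expr0].
rewrite (_ : (fun x => _) = (fun x => f x * f x ^+ k)); first exact: polyfun_mul.
by apply: funext => x; rewrite exprS.
Qed.

Lemma polyfun_scale c f : polyfun f -> polyfun (fun x => c * f x).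
Proof. by move=> pf; exact: (polyfun_mul (polyfun_cst c) pf). Qed.

Lemma polyfun_bounded f : polyfun f -> forall L, exists2 B, 0 <= B &
  forall x, `|x| <= L -> `|f x| <= B.
Proof.
move=> pf L; elim: pf => [c|i|g h _ [B B0 gB] _ [C C0 hC]|g h _ [B B0 gB] _ [C C0 hC]].
- by exists `|c|.
- exists (Num.max 0 L); first by rewrite le_max lexx.
  by move=> x xL; rewrite le_max (le_trans (coord_le_norm x i) xL) orbT.
- exists (B + C); first exact: addr_ge0.
  by move=> x xL; rewrite (le_trans (ler_normD _ _)) // lerD ?gB ?hC.
- exists (B * C); first exact: mulr_ge0.
  by move=> x xL; rewrite normrM ler_pM ?gB ?hC.
Qed.

(** The second order, uniform on boxes, is what the counting proof of Sard's theorem needs;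
    differentiability alone would not bound the thickness of the slabs. *)
Definition quadratic_remainder f (G : 'rV[R]_n -> 'rV[R]_n) : Prop :=
  forall L, exists2 M, 0 <= M & forall x x', `|x| <= L -> `|x'| <= L ->
  `|f x' - f x - dot (x' - x) (G x)| <= M * `|x' - x| ^+ 2.

Lemma norm_diff_box (x x' : 'rV[R]_n) L : `|x| <= L -> `|x'| <= L -> `|x' - x| <= 2 * L.
Proof. by move=> h h'; rewrite (le_trans (ler_normB _ _)) //; lra. Qed.

Lemma dot_grad_bounded (G : 'rV[R]_n -> 'rV[R]_n) L :
  (forall i, polyfun (fun x => G x 0 i)) ->
  exists2 C, 0 <= C & forall x v, `|x| <= L -> `|dot v (G x)| <= C * `|v|.
Proof.
move=> pG; have /choice[B BP] : forall i, exists b, 0 <= b /\ forall x, `|x| <= L -> `|G x 0 i| <= b.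
  by move=> i; have [B B0 BP] := polyfun_bounded (pG i) L; exists B.
exists (\sum_i B i); first by apply: sumr_ge0 => i _; exact: (BP i).1.
move=> x v xL; rewrite dotC (le_trans (dot_le_norm _ _)) // ler_wpM2r //.
by apply: ler_sum => i _; exact: (BP i).2.
Qed.

Lemma polyfun_gradient f : polyfun f -> exists2 G : 'rV[R]_n -> 'rV[R]_n, forall i, polyfun (fun x => G x 0 i) &
  quadratic_remainder f G.
Proof.
elim=> [c|i|g h pg [G pG rG] ph [H pH rH]|g h pg [G pG rG] ph [H pH rH]].
- exists (fun=> 0) => [i|L]; first exact: polyfun_cst.
  by exists 0 => // x x' _ _; rewrite dot0r subr0 subrr normr0 mul0r.
- exists (fun=> delta_mx 0 i) => [j|L]; first exact: polyfun_cst.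
  by exists 0 => // x x' _ _; rewrite dotC dot_delta !mxE subrr normr0 mul0r.
- exists (fun x => G x + H x) => [i|L].
    rewrite (_ : (fun x => _) = (fun x => G x 0 i + H x 0 i)); first exact: polyfun_add.
    by apply: funext => x; rewrite mxE.
  have [M M0 MP] := rG L; have [N N0 NP] := rH L; exists (M + N); first exact: addr_ge0.
  move=> x x' xL x'L; rewrite dotDr mulrDl.
  have -> : g x' + h x' - (g x + h x) - (dot (x' - x) (G x) + dot (x' - x) (H x)) =
    (g x' - g x - dot (x' - x) (G x)) + (h x' - h x - dot (x' - x) (H x)) by ring.
  by rewrite (le_trans (ler_normD _ _)) // lerD ?MP ?NP.
- exists (fun x => g x *: H x + h x *: G x) => [i|L].
    rewrite (_ : (fun x => _) = (fun x => g x * H x 0 i + h x * G x 0 i)).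
      by apply: polyfun_add; apply: polyfun_mul.
    by apply: funext => x; rewrite !mxE.
  have [M M0 MP] := rG L; have [N N0 NP] := rH L.
  have [B B0 BP] := polyfun_bounded pg L; have [C C0 CP] := polyfun_bounded ph L.
  have [D D0 DP] := dot_grad_bounded L pG; have [E E0 EP] := dot_grad_bounded L pH.
  exists (M * C + B * N + D * (E + N * (2 * `|L|))).
    by rewrite !addr_ge0 ?mulr_ge0 ?addr_ge0 ?mulr_ge0.
  move=> x x' xL x'L; rewrite dotDr !dotZr.
  set dg := dot _ (G x); set dh := dot _ (H x); set v := x' - x.
  have vL : `|v| <= 2 * `|L|.
    by rewrite (le_trans (norm_diff_box xL x'L)) // ler_pM2l // ler_norm.
  have -> : g x' * h x' - g x * h x - (g x * dh + h x * dg) =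
    (g x' - g x - dg) * h x' + g x * (h x' - h x - dh) + dg * (h x' - h x) by ring.
  have e1 : `|(g x' - g x - dg) * h x'| <= M * C * `|v| ^+ 2.
    by rewrite normrM mulrAC ler_pM ?MP ?CP.
  have e2 : `|g x * (h x' - h x - dh)| <= B * N * `|v| ^+ 2.
    by rewrite normrM -mulrA ler_pM ?NP ?BP.
  have e3 : `|dg * (h x' - h x)| <= D * (E + N * (2 * `|L|)) * `|v| ^+ 2.
    have -> : D * (E + N * (2 * `|L|)) * `|v| ^+ 2 = (D * `|v|) * ((E + N * (2 * `|L|)) * `|v|) by ring.
    rewrite normrM ler_pM ?DP //.
    rewrite -[h x' - h x](subrK dh) (le_trans (ler_normD _ _)) // addrC mulrDl lerD ?EP //.
    rewrite (le_trans (NP x x' xL x'L)) // expr2 mulrA ler_wpM2r //.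
    by rewrite ler_wpM2l.
  rewrite [leRHS]mulrDl; apply: le_trans (ler_normD _ _) _; apply: lerD e3.
  by rewrite [leRHS]mulrDl; apply: le_trans (ler_normD _ _) _; exact: lerD.
Qed.

Definition polymap m (p : 'rV[R]_n -> 'rV[R]_m) := forall j, polyfun (fun x => p x 0 j).

Lemma polymap_derivative (p : 'rV[R]_n -> 'rV[R]_n) : polymap p -> exists2 J : 'rV[R]_n -> 'M[R]_n,
  forall i j, polyfun (fun x => J x i j) &
  forall L, exists2 M, 0 <= M & forall x x', `|x| <= L -> `|x'| <= L ->
  `|p x' - p x - (x' - x) *m J x| <= M * `|x' - x| ^+ 2.
Proof.
move=> pp.
have /choice[G GP] : forall j, exists G : 'rV[R]_n -> 'rV[R]_n,
    (forall i, polyfun (fun x => G x 0 i)) /\ quadratic_remainder (fun x => p x 0 j) G.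
  by move=> j; have [G h1 h2] := polyfun_gradient (pp j); exists G.
exists (fun x => \matrix_(i, j) G j x 0 i) => [i j|L].
  rewrite (_ : (fun x => _) = (fun x => G j x 0 i)); first exact: (GP j).1.
  by apply: funext => x; rewrite mxE.
have /choice[M MP] : forall j, exists M, 0 <= M /\ forall x x', `|x| <= L -> `|x'| <= L ->
    `|p x' 0 j - p x 0 j - dot (x' - x) (G j x)| <= M * `|x' - x| ^+ 2.
  by move=> j; have [M h1 h2] := (GP j).2 L; exists M.
exists (\sum_j M j) => [|x x' xL x'L]; first by apply: sumr_ge0 => j _; exact: (MP j).1.
apply: norm_le_coord => [|j].
  by rewrite mulr_ge0 ?sqr_ge0 // sumr_ge0 // => j _; exact: (MP j).1.
have -> : (p x' - p x - (x' - x) *m \matrix_(i, j) G j x 0 i) 0 j =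
    p x' 0 j - p x 0 j - dot (x' - x) (G j x).
  by rewrite !mxE; congr (_ - _); apply: eq_bigr => i _; rewrite !mxE.
rewrite (le_trans ((MP j).2 _ _ xL x'L)) // ler_wpM2r ?sqr_ge0 //.
by rewrite (bigD1 j) //= lerDl sumr_ge0 // => k _; exact: (MP k).1.
Qed.

Lemma remainder_differentiable (p : 'rV[R]_n -> 'rV[R]_n) x (J : 'M[R]_n) :
  (forall e, 0 < e -> exists2 d, 0 < d & forall z, `|z - x| < d ->
     `|p z - p x - (z - x) *m J| <= e * `|z - x|) ->
  differentiable p x /\ jacobian p x = J.
Proof.
move=> h.
pose df : {linear 'rV[R]_n -> 'rV[R]_n} := mulmxr J.
have oJ : p \o shift x = cst (p x) + df +o_ (0 : 'rV[R]_n) id.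
  apply/eqaddoP => e /h[d d0 dP]; apply/nbhs_ballP; exists d => //= v.
  rewrite mx_norm_ball /ball_ /= sub0r normrN => vd.
  have := dP (v + x); rewrite addrK => /(_ vd).
  by rewrite !fctE /= opprD addrA.
have cJ : continuous df.
  exact: mulmx_continuous.
have dE : 'd p x = df :> ('rV[R]_n -> 'rV[R]_n) by exact: diff_unique cJ oJ.
split; first by apply/diff_locallyP; rewrite dE.
apply/matrixP => i j; rewrite /jacobian /lin1_mx mxE dE /=.
by rewrite -rowE mxE.
Qed.

Lemma polymap_jacobian (p : 'rV[R]_n -> 'rV[R]_n) : polymap p ->
  (forall x, differentiable p x) /\
  (forall i j, polyfun (fun x => jacobian p x i j)) /\
  forall L, exists2 M, 0 <= M & forall x x', `|x| <= L -> `|x'| <= L ->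
  `|p x' - p x - (x' - x) *m jacobian p x| <= M * `|x' - x| ^+ 2.
Proof.
move=> /polymap_derivative[J pJ rJ].
have dJ x : differentiable p x /\ jacobian p x = J x.
  apply: remainder_differentiable => e e0.
  have [M M0 MP] := rJ (`|x| + 1).
  exists (Num.min 1 (e / (M + 1))).
    by rewrite lt_min ltr01 divr_gt0 // ltr_wpDl.
  move=> z; rewrite lt_min => /andP[z1]; rewrite ltr_pdivlMr ?ltr_wpDl // => ze.
  have zL : `|z| <= `|x| + 1.
    by rewrite -[z](subrK x) (le_trans (ler_normD _ _)) // addrC lerD2l ltW.
  rewrite (le_trans (MP x z _ zL)) ?lerDl // expr2 mulrA ler_wpM2r //.
  rewrite (le_trans _ (ltW ze)) // mulrC ler_wpM2l // lerDl //.
split=> [x|]; first exact: (dJ x).1.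
have -> : jacobian p = J by apply: funext => x; exact: (dJ x).2.
by [].
Qed.

Lemma polymap_smooth (p : 'rV[R]_n -> 'rV[R]_n) : polymap p -> smooth p.
Proof.
move=> + k; elim: k p => [|k IH] p pp.
  by move=> x _; apply: differentiable_continuous; exact: (polymap_jacobian pp).1.
have [dp [pJ _]] := polymap_jacobian pp.
split=> [x _|v]; first exact: dp.
apply: IH => j; rewrite (_ : (fun x => _) = (fun x => \sum_i v 0 i * jacobian p x i j)).
  by apply: polyfun_sum => i _; apply: polyfun_scale.
by apply: funext => x; rewrite deriveEjacobian // mxE.
Qed.

End Polynomials.

(** * Sard's theorem for polynomial maps *)

Section Sard.
Variables (R : realType) (n' : nat).
Let n := n'.+1.

(** A kernel vector of the transpose is divided by its largest entry. For a displacement along axis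
    [i], the pairing with [nu] is then the displacement itself. *)
Lemma singular_conormal (J : 'M[R]_n) : \det J = 0 ->
  exists (nu : 'rV[R]_n) (i : 'I_n), [/\ nu 0 i = 1, `|nu| <= 1 & forall v, dot (v *m J) nu = 0].
Proof.
move=> dJ; have /eqP/det0P[w w0 wJ] : \det J^T = 0 by rewrite det_tr.
have [i _ imax] := @arg_maxP _ _ _ ord0 predT (fun i => `|w 0 i|) isT.
have wi : w 0 i != 0.
  apply: contra w0 => /eqP wi; apply/eqP/rowP => j; rewrite mxE; apply/eqP.
  by rewrite -normr_eq0 eq_le normr_ge0 andbT (le_trans (imax j isT)) // wi normr0.
exists ((w 0 i)^-1 *: w), i; split.
- by rewrite mxE mulVf.
- apply: norm_le_coord => // j; rewrite mxE normrM normfV mulrC ler_pdivrMr ?normr_gt0 //.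
  by rewrite mul1r; exact: imax.
- move=> v; rewrite dotZr dot_mul -mulmxA -[J *m _]trmxK trmx_mul trmxK wJ.
  by rewrite trmx0 mulmx0 mxE mulr0.
Qed.

Lemma polymap_lipschitz (p : 'rV[R]_n -> 'rV[R]_n) L : polymap p ->
  exists2 K, 0 < K & forall x x', `|x| <= L -> `|x'| <= L -> `|p x' - p x| <= K * `|x' - x|.
Proof.
move=> pp; have [_ [pJ rJ]] := polymap_jacobian pp.
have [M M0 MP] := rJ L.
have /choice[C CP] : forall j, exists C, 0 <= C /\ forall x v, `|x| <= L ->
    `|dot v (\row_i jacobian p x i j)| <= C * `|v|.
  move=> j; have [|C C0 CP] := @dot_grad_bounded R n (fun x => \row_i jacobian p x i j) L.
    move=> i; rewrite (_ : (fun x => _) = (fun x => jacobian p x i j)) //.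
    by apply: funext => x; rewrite mxE.
  by exists C.
exists (\sum_j C j + M * (2 * `|L|) + 1).
  by rewrite ltr_wpDl // addr_ge0 ?mulr_ge0 // sumr_ge0 // => j _; exact: (CP j).1.
move=> x x' xL x'L; rewrite -[p x' - p x](subrK ((x' - x) *m jacobian p x)).
rewrite (le_trans (ler_normD _ _)) // [leRHS]mulrDl -[leLHS]addr0 lerD ?mul1r //.
rewrite mulrDl addrC lerD //.
  apply: norm_le_coord => [|j].
    by rewrite mulr_ge0 // sumr_ge0 // => j _; exact: (CP j).1.
  apply: (@le_trans _ _ (C j * `|x' - x|)).
    have -> : ((x' - x) *m jacobian p x) 0 j = dot (x' - x) (\row_i jacobian p x i j).
      by rewrite mxE; apply: eq_bigr => i _; congr (_ * _); rewrite [RHS]mxE.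
    exact: (CP j).2.
  by rewrite ler_wpM2r // (bigD1 j) //= lerDl sumr_ge0 // => k _; exact: (CP k).1.
rewrite (le_trans (MP x x' xL x'L)) // expr2 mulrA ler_wpM2r // ler_wpM2l //.
by rewrite (le_trans (norm_diff_box xL x'L)) // ler_pM2l // ler_norm.
Qed.

(** The right side counts sampled values. The left side counts codes, a grid cell together with
    [n - 1] bounded offsets. Their orders are [s ^ (2n)] and [s ^ (2n - 1)]. *)
Lemma counting_contradiction (B E s : nat) : (0 < B)%N -> (0 < E)%N -> (0 < s)%N ->
  ((2 * B) ^ n * (3 * E) ^ n' < s)%N ->
  ((B * s).+1 ^ n * (2 * (E * s)).+1 ^ n' < (s * s) ^ n)%N.
Proof.
move=> B0 E0 s0 h.
apply: (@leq_ltn_trans ((2 * B * s) ^ n * (3 * E * s) ^ n')).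
  have Bs : (0 < B * s)%N by rewrite muln_gt0 B0.
  have Es : (0 < E * s)%N by rewrite muln_gt0 E0.
  have le1 : ((B * s).+1 <= 2 * B * s)%N by rewrite -mulnA; lia.
  have le2 : ((2 * (E * s)).+1 <= 3 * E * s)%N by rewrite -[in leqRHS]mulnA; lia.
  by apply: leq_mul; [rewrite leq_exp2r|case: (n') => // k; rewrite leq_exp2r].
have e1 : ((2 * B * s) ^ n * (3 * E * s) ^ n' = ((2 * B) ^ n * (3 * E) ^ n') * (s ^ n * s ^ n'))%N.
  by rewrite !(expnMn _ s) mulnACA.
have e2 : ((s * s) ^ n = s * (s ^ n * s ^ n'))%N.
  by rewrite expnMn mulnCA -expnS.
by rewrite e1 e2 ltn_pmul2r // muln_gt0 !expn_gt0 s0.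
Qed.

Lemma card_ffun_ord (a b : nat) : #|{ffun 'I_a -> 'I_b}| = (b ^ a)%N.
Proof. by rewrite card_ffun !card_ord. Qed.

Lemma offset_inj (a b r D : nat) : (a <= r + D)%N -> (r <= a + D)%N ->
  (b <= r + D)%N -> (r <= b + D)%N ->
  inord (a + D - r) = inord (b + D - r) :> 'I_(2 * D).+1 -> a = b.
Proof. by move=> h1 h2 h3 h4 /(congr1 val) /=; rewrite !inordK; lia. Qed.

Lemma natr_dist_lt1 (a b : nat) : `|a%:R - b%:R : R| < 1 -> a = b.
Proof.
rewrite ltr_norml => /andP[h1 h2]; apply/eqP; rewrite eqn_leq -[(a <= b)%N]ltnS -[(b <= a)%N]ltnS.
by rewrite -!(ltr_nat R) -!natr1; apply/andP; split; lra.
Qed.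

(* Sard's theorem by counting: critical values lying in one cell of a grid of
   mesh [h] are confined to a slab of thickness [O(h^2)] and width [O(h)]. *)
Lemma sard_succ (p : 'rV[R]_n -> 'rV[R]_n) L y eta : polymap p -> 0 < L -> 0 < eta ->
  exists2 b : 'rV[R]_n, `|b| <= eta & forall x, `|x| <= L -> p x = y + b -> \det (jacobian p x) != 0.
Proof.
move=> pp L0 eta0; apply: contrapT => no.
have crit b : exists x, `|b| <= eta -> [/\ `|x| <= L, p x = y + b & \det (jacobian p x) = 0].
  have [be|be] := pselect (`|b| <= eta); last by exists 0.
  apply: contrapT => nox; apply: no; exists b => // x xL px; apply/eqP => dx.
  by apply: nox; exists x.
have {no crit}/choice[X XP] := crit.
have [_ [_ /(_ L)[M M0 MP]]] := polymap_jacobian pp.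
have [K K0 KP] := polymap_lipschitz L pp.
(* [B] makes twice the half-thickness [n * M * l ^ 2] of a slab smaller than the sampling step
   [tau]. *)
pose B := (Num.bound (8 * n%:R * M * L ^+ 2 / eta + 1)).+1.
have BP : 8 * n%:R * M * L ^+ 2 < eta * B%:R ^+ 2.
  have h0 : 0 <= 8 * n%:R * M * L ^+ 2 / eta by rewrite divr_ge0 ?mulr_ge0 ?sqr_ge0 // ltW.
  rewrite [eta * _]mulrC -ltr_pdivrMr //; apply: (@lt_le_trans _ _ B%:R).
    apply: (@lt_trans _ _ (8 * n%:R * M * L ^+ 2 / eta + 1)); first by rewrite ltrDl.
    apply: (lt_trans (archi_boundP _)); first by rewrite addr_ge0.
    by rewrite ltr_nat.
  by rewrite expr2 ler_peMl // ler1n.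
(* [E] gives [K * l <= D * tau]: two samples whose critical points share a cell differ by at most
   [D] in each index. *)
pose E := (Num.bound (2 * K * L / (B%:R * eta))).+1.
have EP : 2 * K * L <= E%:R * (B%:R * eta).
  have B0' : 0 < B%:R * eta by rewrite mulr_gt0 // ltr0n.
  rewrite -ler_pdivrMr //; apply: ltW; apply: (lt_trans (archi_boundP _)); last by rewrite ltr_nat.
  by rewrite divr_ge0 ?mulr_ge0 // ltW.
pose s := ((2 * B) ^ n * (3 * E) ^ n').+1.
pose N := (B * s)%N; pose D := (E * s)%N.
have := @counting_contradiction B E s isT isT isT (ltnSn _).
apply/negP; rewrite -leqNgt -/N -/D.
have s0 : 0 < s%:R :> R by rewrite ltr0n.
have B0 : 0 < B%:R :> R by rewrite ltr0n.
pose m := (s * s)%N; pose tau : R := eta / m%:R; pose l : R := 2 * L / N%:R.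
have m0 : 0 < m%:R :> R by rewrite ltr0n.
have N0 : 0 < N%:R :> R by rewrite ltr0n.
have tau0 : 0 < tau by rewrite divr_gt0.
have l0 : 0 < l by rewrite divr_gt0 // mulr_gt0.
pose T := {ffun 'I_n -> 'I_m}.
pose bv (k : T) : 'rV[R]_n := \row_j (tau * (k j : nat)%:R).
have bvP (k : T) : `|bv k| <= eta.
  apply: norm_le_coord => [|j]; first exact: ltW.
  rewrite mxE ger0_norm; last by rewrite mulr_ge0 // ltW.
  rewrite /tau mulrAC -mulrA ger_pMr //.
  by rewrite ler_pdivrMr // mul1r ler_nat ltnW.
pose x (k : T) := X (bv k).
have xP k : [/\ `|x k| <= L, p (x k) = y + bv k & \det (jacobian p (x k)) = 0] by exact: XP.
have /choice[nu nuP] : forall k, exists nu : 'rV[R]_n * 'I_n, [/\ nu.1 0 nu.2 = 1, `|nu.1| <= 1 &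
    forall v, dot (v *m jacobian p (x k)) nu.1 = 0].
  by move=> k; have [_ _ /singular_conormal[w [i ?]]] := xP k; exists (w, i).
pose t k j : R := (x k 0 j + L) / l.
have t0 k j : 0 <= t k j <= N%:R.
  have [xL _ _] := xP k; have := le_trans (coord_le_norm (x k) j) xL.
  rewrite ler_norml => /andP[h1 h2]; rewrite /t divr_ge0 ?(ltW l0) //=; last lra.
  rewrite ler_pdivrMr // /l mulrC divfK ?gt_eqF //; lra.
pose c k : {ffun 'I_n -> 'I_N.+1} := [ffun j => inord (Num.truncn (t k j))].
have cE k j : c k j = Num.truncn (t k j) :> nat.
  have /andP[h1 h2] := t0 k j.
  by rewrite ffunE inordK // ltnS -(ler_nat R) (le_trans _ h2) // truncn_le.
have cx k k' : c k = c k' -> `|x k - x k'| <= l.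
  move=> ckk'; apply: norm_le_coord => [|j]; first exact: ltW.
  have tt : `|t k j - t k' j| <= 1.
    have /andP[a0 _] := t0 k j; have /andP[b0 _] := t0 k' j.
    have := truncn_itv a0; have := truncn_itv b0; rewrite -!cE ckk' -natr1.
    by move=> /andP[h1 h2] /andP[h3 h4]; rewrite ler_norml; apply/andP; split; lra.
  have -> : (x k - x k') 0 j = l * (t k j - t k' j).
    by rewrite !mxE /t; field; rewrite gt_eqF.
  by rewrite normrM gtr0_norm // ger_pMr.
have kD k k' j : c k = c k' -> (k j <= k' j + D)%N.
  move=> ckk'; have [xL px _] := xP k; have [x'L px' _] := xP k'.
  have := KP _ _ x'L xL; rewrite px px' opprD addrACA subrr add0r => h.
  have {h} := le_trans (coord_le_norm _ j) (le_trans h _ : _ <= K * l).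
  rewrite ler_pM2l // => /(_ (cx _ _ ckk')); rewrite !mxE -mulrBr normrM gtr0_norm // => h.
  rewrite -(ler_nat R) natrD -lerBlDl.
  rewrite (le_trans (ler_norm _)) // -(ler_pM2l tau0) (le_trans h) //.
  rewrite /tau /l /D /N /m !natrM.
  have -> : K * (2 * L / (B%:R * s%:R)) = (2 * K * L) / (B%:R * s%:R) by ring.
  rewrite ler_pdivrMr ?mulr_gt0 //.
  have -> : eta / (s%:R * s%:R) * (E%:R * s%:R) * (B%:R * s%:R) = E%:R * (B%:R * eta).
    by field; rewrite gt_eqF.
  exact: EP.
pose rep (k : T) : T := odflt k [pick k0 | c k0 == c k].
have crep k : c (rep k) = c k by rewrite /rep; case: pickP => //= k0 /eqP.
have repE k k' : c k = c k' -> rep k = rep k'.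
  by move=> e; rewrite /rep e; case: pickP => // /(_ k'); rewrite eqxx.
pose i0 k : 'I_n := (nu (rep k)).2.
(* Offsets from the representative of the cell, in every index but [i0]. The slab determines the
   omitted index, so cell and offsets determine the sample. *)
pose d (k : T) : {ffun 'I_n' -> 'I_(2 * D).+1} := [ffun j : 'I_n' => inord (k (lift (i0 k) j) + D - rep k (lift (i0 k) j))].
suff inj : injective (fun k : T => (c k, d k)).
  by have := leq_card _ inj; rewrite card_prod !card_ffun_ord.
move=> k k' [ck dk].
have rk := repE _ _ ck.
have kj j : k (lift (i0 k) j) = k' (lift (i0 k) j).
  have := congr1 (fun f : {ffun 'I_n' -> 'I_(2 * D).+1} => f j) dk; rewrite !ffunE /i0 -rk.
  have h1 (k1 : T) (l1 : 'I_n) : (k1 l1 <= rep k1 l1 + D)%N by apply: kD; rewrite crep.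
  have h2 (k1 : T) (l1 : 'I_n) : (rep k1 l1 <= k1 l1 + D)%N by apply: kD; rewrite crep.
  have := h1 k' (lift (nu (rep k)).2 j); have := h2 k' (lift (nu (rep k)).2 j).
  rewrite -rk => a2 a1 e; apply: val_inj; exact: offset_inj (h1 k _) (h2 k _) a1 a2 e.
have [nu1 nuL nuJ] := nuP (rep k).
have slab (k1 : T) : c k1 = c k -> `|dot (bv k1 - bv (rep k)) (nu (rep k)).1| <= n%:R * M * l ^+ 2.
  move=> ck1; have [xL px _] := xP k1; have [x'L px' _] := xP (rep k).
  have -> : bv k1 - bv (rep k) = (p (x k1) - p (x (rep k)) - (x k1 - x (rep k)) *m jacobian p (x (rep k))) + (x k1 - x (rep k)) *m jacobian p (x (rep k)).
    by rewrite subrK px px' opprD addrACA subrr add0r.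
  rewrite dotC dotDr [X in _ + X]dotC nuJ addr0.
  rewrite (le_trans (dot_le_norm _ _)) // -mulrA ler_pM ?sumr_ge0 //.
    rewrite (le_trans (ler_sum _ (fun i _ => le_trans (coord_le_norm _ i) nuL))) //.
    by rewrite sumr_const card_ord.
  rewrite (le_trans (MP _ _ x'L xL)) // ler_wpM2l // ler_pXn2r ?nnegrE // ?(ltW l0) //.
  by apply: cx; rewrite crep.
have ki : k (i0 k) = k' (i0 k).
  have bE : bv k - bv k' = (tau * ((k (i0 k) : nat)%:R - (k' (i0 k) : nat)%:R)) *: delta_mx 0 (i0 k).
    apply/rowP => j; rewrite !mxE -mulrBr.
    have [->|] := eqVneq j (i0 k); first by rewrite mulr1.
    by case: (unliftP (i0 k) j) => [j' ->|->]; rewrite ?eqxx // kj subrr !mulr0.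
  have := le_trans (ler_normB _ _) (lerD (slab k erefl) (slab k' (esym ck))).
  rewrite -!(dotC (nu _).1) -dotBr opprB addrA subrK bE dotC.
  rewrite [dot _ _]dotC dotZr dotC dot_delta /i0 nu1 mulr1 normrM gtr0_norm // => h.
  apply: val_inj; apply: natr_dist_lt1; rewrite -(ltr_pM2l tau0) mulr1; apply: le_lt_trans h _.
  have -> : n%:R * M * l ^+ 2 + n%:R * M * l ^+ 2 = (8 * n%:R * M * L ^+ 2) / (B%:R ^+ 2 * m%:R).
    by rewrite /l /N /m !natrM; field; rewrite !gt_eqF.
  rewrite ltr_pdivrMr ?mulr_gt0 ?exprn_gt0 // /tau.
  by have -> : eta / m%:R * (B%:R ^+ 2 * m%:R) = eta * B%:R ^+ 2 by field; rewrite gt_eqF.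
apply/ffunP => j; case: (unliftP (i0 k) j) => [j' ->|->]; [exact: kj|exact: ki].
Qed.

End Sard.

Lemma sard (R : realType) n (p : 'rV[R]_n -> 'rV[R]_n) L y eta : polymap p -> 0 < L -> 0 < eta ->
  exists2 b : 'rV[R]_n, `|b| <= eta & forall x, `|x| <= L -> p x = y + b -> \det (jacobian p x) != 0.
Proof.
case: n p y => [|n] p y pp L0 eta0; last exact: sard_succ.
exists 0 => [|x _ _]; first by rewrite normr0 ltW.
by rewrite det_mx00 oner_neq0.
Qed.

(** * Approximation by Bernstein polynomials *)

Section Bernstein.
Variable R : realType.
Implicit Types t : R.

(* The probability of [k] successes in [N] trials. *)
Fixpoint bernstein (N k : nat) t : R :=
  if N is N'.+1 then
    (1 - t) * bernstein N' k t + t * (if k is k'.+1 then bernstein N' k' t else 0)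
  else (k == 0%N)%:R.

Lemma bernstein_small N k t : (N < k)%N -> bernstein N k t = 0.
Proof.
elim: N k => [|N IH] [|k] //= Nk; rewrite !IH ?mulr0 ?addr0 //.
exact: ltn_trans Nk.
Qed.

Lemma bernstein_ge0 N k t : 0 <= t <= 1 -> 0 <= bernstein N k t.
Proof.
move=> /andP[t0 t1]; elim: N k => [|N IH] k /=; first by rewrite ler0n.
by rewrite addr_ge0 ?mulr_ge0 ?subr_ge0 //; case: k.
Qed.

Definition mean N (phi : nat -> R) t := \sum_(k < N.+1) bernstein N k t * phi k.

Lemma meanS N phi t :
  mean N.+1 phi t = (1 - t) * mean N phi t + t * mean N (phi \o succn) t.
Proof.
rewrite /mean; under eq_bigr do rewrite /= mulrDl -!mulrA.
rewrite big_split /= -!mulr_sumr; congr (_ + _).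
  by rewrite big_ord_recr /= bernstein_small // mul0r addr0.
by rewrite big_ord_recl /= mul0r add0r mulr_sumr.
Qed.

Lemma mean_add N phi psi t : mean N (fun k => phi k + psi k) t = mean N phi t + mean N psi t.
Proof. by rewrite -big_split; apply: eq_bigr => k _; rewrite mulrDr. Qed.

Lemma mean_scale N c phi t : mean N (fun k => c * phi k) t = c * mean N phi t.
Proof. by rewrite mulr_sumr; apply: eq_bigr => k _; rewrite mulrCA. Qed.

Lemma mean1 N t : mean N (fun=> 1) t = 1.
Proof.
elim: N => [|N IH]; first by rewrite /mean big_ord1 /= mulr1.
by rewrite meanS !IH; ring.
Qed.

Lemma mean_cst N c t : mean N (fun=> c) t = c.
Proof.
rewrite (_ : (fun=> c) = (fun k : nat => c * (fun=> 1) k)) ?mean_scale ?mean1 ?mulr1 //.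
Qed.

Lemma mean_linear N t : mean N (fun k => k%:R - N%:R * t) t = 0.
Proof.
elim: N => [|N IH]; first by rewrite /mean big_ord1 /=; ring.
rewrite meanS.
have -> : mean N (fun k => k%:R - N.+1%:R * t) t = mean N (fun k => (k%:R - N%:R * t) + (- t)) t.
  by congr (mean N _ t); apply: funext => k; rewrite -natr1; ring.
have -> : mean N ((fun k => k%:R - N.+1%:R * t) \o succn) t = mean N (fun k => (k%:R - N%:R * t) + (1 - t)) t.
  by congr (mean N _ t); apply: funext => k /=; rewrite -!natr1; ring.
have e c : mean N (fun k => (k%:R - N%:R * t) + c) t = c.
  by rewrite (mean_add N (fun k => k%:R - N%:R * t) (fun=> c)) IH mean_cst add0r.
by rewrite !e; ring.
Qed.

Lemma mean_square N t : mean N (fun k => (k%:R - N%:R * t) ^+ 2) t = N%:R * (t * (1 - t)).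
Proof.
elim: N => [|N IH]; first by rewrite /mean big_ord1 /=; ring.
rewrite meanS.
have e c : mean N (fun k => (k%:R - N%:R * t + c) ^+ 2) t = N%:R * (t * (1 - t)) + c ^+ 2.
  rewrite (_ : (fun k => _) = (fun k : nat => ((k%:R - N%:R * t) ^+ 2 + (2 * c) * (k%:R - N%:R * t)) + c ^+ 2)).
    rewrite (mean_add N (fun k => _ + _) (fun=> c ^+ 2)) mean_cst.
    rewrite (mean_add N (fun k => (k%:R - N%:R * t) ^+ 2) (fun k => 2 * c * (k%:R - N%:R * t))).
    by rewrite IH mean_scale mean_linear mulr0 addr0.
  by apply: funext => k; ring.
have -> : mean N (fun k => (k%:R - N.+1%:R * t) ^+ 2) t = mean N (fun k => (k%:R - N%:R * t + (- t)) ^+ 2) t.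
  by congr (mean N _ t); apply: funext => k; rewrite -natr1; ring.
have -> : mean N ((fun k => (k%:R - N.+1%:R * t) ^+ 2) \o succn) t = mean N (fun k => (k%:R - N%:R * t + (1 - t)) ^+ 2) t.
  by congr (mean N _ t); apply: funext => k /=; rewrite -!natr1; ring.
by rewrite !e -natr1; ring.
Qed.

Lemma polyfun_bernstein n N k (f : 'rV[R]_n -> R) : polyfun f -> polyfun (fun x => bernstein N k (f x)).
Proof.
move=> pf; elim: N k => [|N IH] k /=; first exact: polyfun_cst.
apply: polyfun_add; apply: polyfun_mul => //.
  rewrite (_ : (fun x => _) = (fun x => 1 + (-1) * f x)).
    by apply: polyfun_add; [exact: polyfun_cst|exact: polyfun_scale].
  by apply: funext => x; rewrite mulN1r.
by case: k => [|k]; [exact: polyfun_cst|exact: IH].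
Qed.

End Bernstein.

Section Weierstrass.
Variables (R : realType) (n : nat).
Implicit Types (K : set 'rV[R]_n) (f : 'rV[R]_n -> 'rV[R]_n).

Lemma uniformly_continuous_on K f e : compact K -> {within K, continuous f} -> 0 < e ->
  exists2 d, 0 < d & forall x z, K x -> K z -> `|z - x| < d -> `|f z - f x| < e.
Proof.
move=> cK cf e0.
have [d d0 dP] : exists2 d, 0 < d & forall x, K x -> forall z, K z -> `|z - x| <= d -> `|f z - f x| < e.
  apply: compact_uniform => // [d d' x d'd h z Kz zx|x Kx]; first by apply: h => //; exact: le_trans d'd.
  have e20 : 0 < e / 2 by rewrite divr_gt0.
  have [d d0 dP] := within_continuousP cf Kx e20; exists (d / 2); first by rewrite divr_gt0.
  move=> x' x'x Kx' z Kz zx'.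
  have zx : `|z - x| < d.
    by rewrite -(subrKA x') (le_lt_trans (ler_normD _ _)) // (splitr d) ler_ltD.
  rewrite -(subrKA (f x)) (le_lt_trans (ler_normD _ _)) // (splitr e) ltrD ?dP //.
  by rewrite distrC dP //; apply: lt_trans x'x _; lra.
by exists d => // x z Kx Kz zx; apply: dP => //; exact: ltW.
Qed.

Lemma bounded_on K f : compact K -> {within K, continuous f} ->
  exists2 B, 0 < B & forall x, K x -> `|f x| <= B.
Proof.
move=> cK cf.
have [d d0 dP] : exists2 d, 0 < d & forall x, K x -> d * `|f x| <= 1.
  apply: compact_uniform => // [d d' x d'd h|x Kx]; first by apply: le_trans h; rewrite ler_wpM2r.
  have [d d0 dP] := within_continuousP cf Kx ltr01.
  have c0 : 0 < `|f x| + 1 by rewrite ltr_wpDl.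
  exists (Num.min d (`|f x| + 1)^-1); first by rewrite lt_min d0 invr_gt0.
  move=> x' + Kx'; rewrite lt_min => /andP[x'd _].
  apply: (@le_trans _ _ ((`|f x| + 1)^-1 * `|f x'|)); first by rewrite ler_wpM2r // ge_min lexx orbT.
  rewrite ler_pdivrMl // mulr1 -[f x'](subrK (f x)) (le_trans (ler_normD _ _)) // addrC lerD2l.
  by rewrite ltW // dP.
by exists d^-1 => [|x /dP]; rewrite ?invr_gt0 // -ler_pdivlMl // mulr1.
Qed.

Lemma almost_nearest K e (p : 'rV[R]_n) : K !=set0 -> 0 < e ->
  exists2 x, K x & forall z, K z -> `|x - p| <= `|z - p| + e.
Proof.
move=> [k0 Kk0] e0.
pose D := [set `|z - p| | z in K].
have iD : has_inf D by split; [exists `|k0 - p|; exists k0|exists 0 => _ [z _ <-]].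
have [_ [x Kx <-] xe] := inf_adherent e0 iD; exists x => // z Kz.
by rewrite (le_trans (ltW xe)) // lerD2r ge_inf //; [exact: iD.2|exists z].
Qed.

Lemma sum_ffun_prod (N : nat) (F : 'I_n -> 'I_N.+1 -> R) :
  \sum_(k : {ffun 'I_n -> 'I_N.+1}) \prod_i F i (k i) = \prod_i \sum_l F i l.
Proof. by rewrite bigA_distr_bigA. Qed.

Lemma weierstrass K f e : compact K -> bounded_set K -> {within K, continuous f} -> 0 < e ->
  exists2 p, polymap p & forall x, K x -> `|p x - f x| <= e.
Proof.
move=> cK bK cf e0; have [K0|/set0P K0] := eqVneq K set0.
  by exists (fun=> 0) => [j|x]; [exact: polyfun_cst|rewrite K0].
have [L L0 KL] := bounded_setP bK.
have e20 : 0 < e / 2 by rewrite divr_gt0.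
have [d d0 dP] := uniformly_continuous_on cK cf e20.
have [B B0 BP] := bounded_on cK cf.
have d40 : 0 < d / 4 by rewrite divr_gt0.
(* [f] is controlled on [K] only, so a grid point is replaced by a nearly nearest point of [K]. No
   continuous extension of [f] is required. *)
have /choice[pi piP] : forall p, exists x, K x /\ forall z, K z -> `|x - p| <= `|z - p| + d / 4.
  by move=> p; have [x Kx xp] := almost_nearest p K0 d40; exists x.
(* Chebyshev's inequality: [2 * B] bounds the error at distant nodes, [16 / d ^+ 2] comes from their
   distance [d / 4], and [4 * L ^+ 2] from rescaling the cube to the unit cube. *)
pose C := 2 * B * (16 / d ^+ 2) * (4 * L ^+ 2).
have C0 : 0 < C by rewrite !mulr_gt0 ?invr_gt0 ?exprn_gt0.
pose N := (Num.bound (C * n%:R / (e / 2))).+1.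
have N0 : 0 < N%:R :> R by rewrite ltr0n.
have NP : C * n%:R / N%:R <= e / 2.
  rewrite ler_pdivrMr // -ler_pdivrMl // mulrC ltW //.
  apply: (lt_trans (archi_boundP _)); last by rewrite ltr_nat.
  by apply: divr_ge0 (ltW e20); exact: mulr_ge0 (ltW C0) _.
pose t j (x : 'rV[R]_n) : R := (2 * L)^-1 * (x 0 j + L).
pose pt (k : {ffun 'I_n -> 'I_N.+1}) : 'rV[R]_n := \row_j (- L + 2 * L * (k j)%:R / N%:R).
pose w (k : {ffun 'I_n -> 'I_N.+1}) x := \prod_j bernstein N (k j) (t j x).
pose p x := \sum_k w k x *: f (pi (pt k)).
exists p.
  move=> j; rewrite (_ : (fun x => _) = (fun x => \sum_k w k x * f (pi (pt k)) 0 j)).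
    apply: polyfun_sum => k _; apply: polyfun_mul; last exact: polyfun_cst.
    apply: polyfun_prod => i _; apply: polyfun_bernstein; apply: polyfun_scale.
    by apply: polyfun_add; [exact: polyfun_coord|exact: polyfun_cst].
  by apply: funext => x; rewrite summxE; apply: eq_bigr => k _; rewrite mxE.
move=> x Kx.
have t01 j : 0 <= t j x <= 1.
  have := le_trans (coord_le_norm x j) (KL x Kx); rewrite ler_norml => /andP[h1 h2].
  rewrite mulr_ge0 ?invr_ge0 ?mulr_ge0 ?(ltW L0) //=; last lra.
  by rewrite ler_pdivrMl ?mulr_gt0 //; lra.
have w0 k : 0 <= w k x by apply: prodr_ge0 => j _; exact: bernstein_ge0.
have w1 : \sum_k w k x = 1.
  rewrite (sum_ffun_prod (fun j l => bernstein N l (t j x))) big1 // => j _.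
  rewrite -[RHS](mean1 N (t j x)); apply: eq_bigr => l _; by rewrite mulr1.
have var j : \sum_k w k x * ((k j)%:R / N%:R - t j x) ^+ 2 <= N%:R^-1.
  pose F i (l : 'I_N.+1) := bernstein N l (t i x) * (if i == j then ((l%:R : R) / N%:R - t j x) ^+ 2 else 1).
  have -> : \sum_k w k x * ((k j)%:R / N%:R - t j x) ^+ 2 = \sum_(k : {ffun 'I_n -> 'I_N.+1}) \prod_i F i (k i).
    apply: eq_bigr => k _; rewrite /F big_split /=; congr (_ * _).
    by rewrite (bigD1 j) //= eqxx big1 ?mulr1 // => i /negbTE ->.
  rewrite sum_ffun_prod (bigD1 j) //= [X in _ * X]big1 ?mulr1; last first.
    move=> i /negbTE ij; rewrite -[RHS](mean1 N (t i x)); apply: eq_bigr => l _.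
    by rewrite /F ij.
  have -> : \sum_l F j l = N%:R^-1 ^+ 2 * mean N (fun k => (k%:R - N%:R * t j x) ^+ 2) (t j x).
    rewrite mulr_sumr; apply: eq_bigr => l _; rewrite /F eqxx [RHS]mulrCA; congr (_ * _).
    by rewrite /= -exprMn; congr (_ ^+ 2); field; rewrite gt_eqF.
  rewrite mean_square expr2 -mulrA mulKf ?gt_eqF // ler_piMr ?invr_ge0 ?ltW //.
  by have /andP[h1 h2] := t01 j; nra.
have -> : p x - f x = \sum_k w k x *: (f (pi (pt k)) - f x).
  under [RHS]eq_bigr do rewrite scalerBr.
  by rewrite sumrB -scaler_suml w1 scale1r.
rewrite (le_trans (ler_norm_sum _ _ _)) //.
apply: (@le_trans _ _ (\sum_k w k x * (e / 2 + C * \sum_j ((k j)%:R / N%:R - t j x) ^+ 2))).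
  apply: ler_sum => k _; rewrite normrZ ger0_norm // ler_wpM2l //.
  have [Kpi piN] := piP (pt k); have := piN x Kx; set D := `|x - pt k| => piD.
  have S0 : 0 <= \sum_j ((k j)%:R / N%:R - t j x) ^+ 2 by apply: sumr_ge0 => j _; exact: sqr_ge0.
  (* For a node at distance [D < d / 4] the chosen point of [K] is within [2 * D + d / 4 < d] of
     [x]. *)
  have [Dd|dD] := ltP D (d / 4).
    rewrite -[leLHS]addr0; apply: lerD; last exact: mulr_ge0 (ltW C0) S0.
    apply/ltW/dP => //.
    rewrite -(subrKA (pt k)) (le_lt_trans (ler_normD _ _)) // (distrC (pt k)) -/D; lra.
  rewrite -[leLHS]add0r; apply: lerD; first exact: ltW.
  apply: (@le_trans _ _ (2 * B)).
    by rewrite (le_trans (ler_normB _ _)) //; have := BP _ Kpi; have := BP _ Kx; lra.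
  have DS : D ^+ 2 <= 4 * L ^+ 2 * \sum_j ((k j)%:R / N%:R - t j x) ^+ 2.
    apply: (@le_trans _ _ (dot (x - pt k) (x - pt k))).
      by rewrite /D -sqr_enorm ler_pXn2r ?nnegrE ?enorm_ge0 //; exact: norm_le_enorm.
    rewrite mulr_sumr; apply: ler_sum => j _; rewrite -expr2.
    have -> : (x - pt k) 0 j = - (2 * L) * ((k j)%:R / N%:R - t j x).
      by rewrite !mxE /t; field; rewrite !gt_eqF.
    by rewrite exprMn sqrrN exprMn -natrX.
  have d2 : 1 <= 16 / d ^+ 2 * D ^+ 2.
    rewrite mulrAC ler_pdivlMr ?exprn_gt0 // mul1r.
    have : 0 <= d by exact: ltW.
    nra.
  apply: (@le_trans _ _ (2 * B * (16 / d ^+ 2 * D ^+ 2))).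
    by rewrite ler_peMr // mulr_ge0 // ltW.
  have -> : C * \sum_j ((k j)%:R / N%:R - t j x) ^+ 2 =
      2 * B * (16 / d ^+ 2 * (4 * L ^+ 2 * \sum_j ((k j)%:R / N%:R - t j x) ^+ 2)).
    by rewrite /C; ring.
  by rewrite ler_wpM2l ?mulr_ge0 ?(ltW B0) // ler_wpM2l // divr_ge0 ?exprn_ge0 ?(ltW d0).
under eq_bigr do rewrite mulrDr.
rewrite big_split /= -mulr_suml w1 mul1r [leRHS]splitr lerD2l.
apply: le_trans NP.
have -> : \sum_k w k x * (C * \sum_j ((k j)%:R / N%:R - t j x) ^+ 2) =
   C * \sum_j \sum_k w k x * ((k j)%:R / N%:R - t j x) ^+ 2.
  rewrite exchange_big /= mulr_sumr; apply: eq_bigr => k _.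
  by rewrite mulrCA mulr_sumr.
rewrite -mulrA ler_pM2l // (le_trans (ler_sum _ (fun j _ => var j))) //.
by rewrite sumr_const card_ord mulr_natl.
Qed.

End Weierstrass.

Section Existence.
Variables (R : realType) (n : nat).

Lemma boundary_gap (W : set 'rV[R]_n) (f : 'rV[R]_n -> 'rV[R]_n) (y : 'rV[R]_n) : open W -> bounded_set W ->
  {within closure W, continuous f} -> (forall z, boundary W z -> f z <> y) ->
  exists2 d, 0 < d & forall z, boundary W z -> d <= `|f z - y|.
Proof.
move=> oW bW cf bf.
have [d d0 dP] : exists2 d, 0 < d & forall x, closure W x -> boundary W x -> d <= `|f x - y|.
  apply: compact_uniform => [|d d' x d'd h /h|x clx]; first exact: compact_closure_bounded.
    exact: le_trans.
  have [fx|fx] := eqVneq (f x) y.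
    have [e e0 eW] := open_ballP oW (boundary_zeros oW bf clx fx).
    exists e => // x' x'x _ [_]; rewrite ((interior_id _).1 oW) => nW.
    by case: nW; exact: eW.
  have c0 : 0 < `|f x - y| / 2 by rewrite divr_gt0 // normr_gt0 subr_eq0.
  have [e e0 eP] := within_continuousP cf clx c0.
  exists (Num.min e (`|f x - y| / 2)); first by rewrite lt_min e0.
  move=> x'; rewrite lt_min => /andP[x'x _] clx' _; rewrite ge_min; apply/orP; right.
  have := ler_normD (f x - f x') (f x' - y); rewrite subrKA (distrC (f x) (f x')).
  by have := eP x' clx' x'x; lra.
by exists d => // z bz; apply: dP => //; case: bz.
Qed.

Lemma degree_approximation_exists (W : set 'rV[R]_n) (f : 'rV[R]_n -> 'rV[R]_n) (y : 'rV[R]_n) : open W -> bounded_set W ->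
  {within closure W, continuous f} -> (forall z, boundary W z -> f z <> y) ->
  exists g, degree_approximation f W y g.
Proof.
move=> oW bW cf bf.
have [d d0 dP] := boundary_gap oW bW cf bf.
have [L L0 WL] := bounded_setP bW.
(* The polynomial and the translation [b] each cost at most [e]. Multiplied by [n + 1] for the
   Euclidean norm, the total is [d / 2]. *)
pose e := d / (4 * n.+1%:R); have n0 : 0 < n.+1%:R :> R by rewrite ltr0n.
have e0 : 0 < e by rewrite divr_gt0 // mulr_gt0.
have bclW : bounded_set (closure W).
  exact/compact_bounded/compact_closure_bounded.
have [p pp pf] := weierstrass (compact_closure_bounded bW) bclW cf e0.
have [b be breg] := sard y pp L0 e0.
pose g x := p x - b.
have gp : polymap g.
  move=> j; rewrite (_ : (fun x => _) = (fun x => p x 0 j + (- b 0 j))).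
    by apply: polyfun_add; [exact: pp|exact: polyfun_cst].
  by apply: funext => x; rewrite !mxE.
have [dp _] := polymap_jacobian pp.
exists g; split.
- exact: polymap_smooth.
- move=> x z clx bz; apply: lt_le_trans (norm_le_enorm _); apply: lt_le_trans (dP z bz).
  apply: le_lt_trans (enorm_le_norm _) _; rewrite mulrC -ltr_pdivlMr //.
  have -> : g x - f x = (p x - f x) - b by rewrite /g addrAC.
  rewrite (le_lt_trans (ler_normB _ _)) //.
  apply: (@le_lt_trans _ _ (e + e)); first by rewrite lerD // pf.
  have -> : d / n.+1%:R = 4 * e by rewrite /e; field; rewrite gt_eqF.
  lra.
- move=> x Wx gx.
  have -> : jacobian g x = jacobian p x.
    apply: (remainder_differentiable _).2 => r r0.
    have [c c0 cP] := differentiable_remainder (dp x) r0; exists c => // z zx.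
    by rewrite /g opprB addrA subrK; exact: cP.
  by apply: breg; [exact: WL|rewrite -gx subrK].
Qed.

End Existence.

(** * Definable sets *)

Section PolyMaps.
Variable R : realType.

Lemma polyfun_mpoly n (f : 'rV[R]_n -> R) : polyfun f ->
  exists p : mpoly n R, forall x : 'rV[R]_n, meval (fun i => x 0 i) p = f x.
Proof.
elim=> [c|i|g h _ [p pE] _ [q qE]|g h _ [p pE] _ [q qE]].
- by exists (mpolyC n c) => x; rewrite mevalC.
- by exists (mpolyX R (mnm1 i)) => x; rewrite mevalXU.
- by exists (p + q) => x; rewrite mevalD pE qE.
- by exists (p * q) => x; rewrite mevalM pE qE.
Qed.

Lemma polyfun_comp m n (phi : 'rV[R]_m -> 'rV[R]_n) (f : 'rV[R]_n -> R) :
  polymap phi -> polyfun f -> polyfun (fun z => f (phi z)).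
Proof.
move=> pphi; elim=> [c|i|g h _ pg _ ph|g h _ pg _ ph].
- exact: polyfun_cst.
- exact: pphi.
- exact: polyfun_add.
- exact: polyfun_mul.
Qed.

Lemma polyfun_opp n (f : 'rV[R]_n -> R) : polyfun f -> polyfun (fun z => - f z).
Proof.
move=> pf; rewrite (_ : (fun z => _) = (fun z => (-1) * f z)); first exact: polyfun_scale.
by apply: funext => z; rewrite mulN1r.
Qed.

Lemma polyfun_sub n (f g : 'rV[R]_n -> R) : polyfun f -> polyfun g -> polyfun (fun z => f z - g z).
Proof. by move=> pf pg; apply: polyfun_add pf (polyfun_opp pg). Qed.

Lemma polymap_id n : polymap (@id 'rV[R]_n).
Proof. by move=> j; exact: polyfun_coord. Qed.

Lemma polymap_comp m n k (phi : 'rV[R]_m -> 'rV[R]_n) (psi : 'rV[R]_n -> 'rV[R]_k) :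
  polymap phi -> polymap psi -> polymap (fun z => psi (phi z)).
Proof. by move=> pphi ppsi j; exact: polyfun_comp (ppsi j). Qed.

Lemma polymap_lsubmx m n : polymap (fun z : 'rV[R]_(m + n) => lsubmx z).
Proof.
move=> j; rewrite (_ : (fun z => _) = (fun z : 'rV[R]_(m + n) => z 0 (lshift n j))); first exact: polyfun_coord.
by apply: funext => z; rewrite mxE.
Qed.

Lemma polymap_rsubmx m n : polymap (fun z : 'rV[R]_(m + n) => rsubmx z).
Proof.
move=> j; rewrite (_ : (fun z => _) = (fun z : 'rV[R]_(m + n) => z 0 (rshift m j))); first exact: polyfun_coord.
by apply: funext => z; rewrite mxE.
Qed.

Lemma polymap_row_mx m n k (phi : 'rV[R]_k -> 'rV[R]_m) (psi : 'rV[R]_k -> 'rV[R]_n) :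
  polymap phi -> polymap psi -> polymap (fun z => row_mx (phi z) (psi z)).
Proof.
move=> pphi ppsi j.
case: (split_ordP j) => i ->.
  rewrite (_ : (fun z => _) = (fun z => phi z 0 i)); first exact: pphi.
  by apply: funext => z; rewrite row_mxEl.
rewrite (_ : (fun z => _) = (fun z => psi z 0 i)); first exact: ppsi.
by apply: funext => z; rewrite row_mxEr.
Qed.

Lemma polymap_add m n (phi psi : 'rV[R]_m -> 'rV[R]_n) :
  polymap phi -> polymap psi -> polymap (fun z => phi z + psi z).
Proof.
move=> pphi ppsi j; rewrite (_ : (fun z => _) = (fun z => phi z 0 j + psi z 0 j)).
  exact: polyfun_add.
by apply: funext => z; rewrite mxE.
Qed.

Lemma polymap_scale m n (f : 'rV[R]_m -> R) (phi : 'rV[R]_m -> 'rV[R]_n) :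
  polyfun f -> polymap phi -> polymap (fun z => f z *: phi z).
Proof.
move=> pf pphi j; rewrite (_ : (fun z => _) = (fun z => f z * phi z 0 j)).
  exact: polyfun_mul.
by apply: funext => z; rewrite mxE.
Qed.

Lemma polymap_cst m n (c : 'rV[R]_n) : polymap (fun _ : 'rV[R]_m => c).
Proof. by move=> j; exact: polyfun_cst. Qed.

Lemma polymap_scalar m (f : 'rV[R]_m -> R) :
  polyfun f -> polymap (fun z => const_mx (f z) : 'rV[R]_1).
Proof.
move=> pf j; rewrite (_ : (fun z => _) = f) //.
by apply: funext => z; rewrite mxE.
Qed.

Lemma polyfun_dot m n (phi psi : 'rV[R]_m -> 'rV[R]_n) :
  polymap phi -> polymap psi -> polyfun (fun z => dot (phi z) (psi z)).
Proof. by move=> pphi ppsi; apply: polyfun_sum => i _; apply: polyfun_mul. Qed.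

End PolyMaps.

Section Definable.
Variables (R : realType) (D : forall n : nat, set (set 'rV[R]_n)).
Arguments D {n}.
Hypothesis hD : ominimal (@D).

Lemma definable_setI n (X Y : set 'rV[R]_n) : D X -> D Y -> D (X `&` Y).
Proof.
by move=> DX DY; rewrite -(setCK (X `&` Y)) setCI; apply/(ominimal_setC hD)/(ominimal_setU hD);
  exact: (ominimal_setC hD).
Qed.

Lemma definable_setT n : D [set: 'rV[R]_n].
Proof. by rewrite -setC0; exact/(ominimal_setC hD)/(ominimal_set0 hD). Qed.

Lemma definable_cst n (P : Prop) : D [set _ : 'rV[R]_n | P].
Proof.
have [p|p] := pselect P.
  by rewrite (_ : mkset _ = setT); [exact: definable_setT|apply/seteqP; split].
by rewrite (_ : mkset _ = set0); [exact: (ominimal_set0 hD)|apply/seteqP; split].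
Qed.

Lemma definable_and n (P Q : 'rV[R]_n -> Prop) : D [set x | P x] -> D [set x | Q x] ->
  D [set x | P x /\ Q x].
Proof. exact: definable_setI. Qed.

Lemma definable_or n (P Q : 'rV[R]_n -> Prop) : D [set x | P x] -> D [set x | Q x] ->
  D [set x | P x \/ Q x].
Proof. exact: (ominimal_setU hD). Qed.

Lemma definable_not n (P : 'rV[R]_n -> Prop) : D [set x | P x] -> D [set x | ~ P x].
Proof. exact: (ominimal_setC hD). Qed.

Lemma definable_imp n (P Q : 'rV[R]_n -> Prop) : D [set x | P x] -> D [set x | Q x] ->
  D [set x | P x -> Q x].
Proof.
move=> DP DQ; rewrite (_ : mkset _ = [set x | ~ P x \/ Q x]).
  exact: definable_or (definable_not DP) DQ.
by apply/seteqP; split => x /=; [move=> PQ; have [/PQ|] := pselect (P x); [right|left]|case].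
Qed.

Lemma definable_cast n n' (e : n' = n) (X : set 'rV[R]_n) : D X ->
  D [set x : 'rV[R]_n' | X (castmx (erefl, e) x)].
Proof.
by case: n / e X => X DX; rewrite (_ : mkset _ = X) //; apply/seteqP; split=> x /=; rewrite castmx_id.
Qed.

(** The axiom projects away one coordinate at a time; the casts only reassociate [n + m + 1]. *)
Lemma definable_proj n m (X : set 'rV[R]_(n + m)) : D X ->
  D [set x : 'rV[R]_n | exists w : 'rV[R]_m, X (row_mx x w)].
Proof.
elim: m n X => [|m IH] n X DX.
  have castE (x : 'rV[R]_n) (w : 'rV[R]_0) : row_mx x w = castmx (erefl, esym (addn0 n)) x.
    apply/rowP => j; rewrite castmxE /=; case: (split_ordP j) => [i ->|[]//].
    by rewrite row_mxEl ord1; congr (x _ _); apply: val_inj.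
  rewrite (_ : mkset _ = [set x | X (castmx (erefl, esym (addn0 n)) x)]).
    exact: definable_cast.
  apply/seteqP; split=> x /=; first by move=> [w]; rewrite castE.
  by move=> Xx; exists 0; rewrite castE.
have e : (n + m + 1 = n + m.+1)%N by rewrite addn1 addnS.
have := IH n _ (ominimal_proj hD (definable_cast e DX)).
rewrite (_ : mkset _ = [set x | exists w : 'rV[R]_m.+1, X (row_mx x w)]) //.
have castE (x : 'rV[R]_n) (w : 'rV[R]_m) (t : 'rV[R]_1) :
    castmx (erefl, e) (row_mx (row_mx x w) t) = row_mx x (castmx (erefl, addn1 m) (row_mx w t)).
  apply/rowP => j; rewrite castmxE /= cast_ord_id; case: (split_ordP j) => [i ->|i ->].
    rewrite row_mxEl (_ : cast_ord _ _ = lshift 1 (lshift m i)); last exact: val_inj.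
    by rewrite !row_mxEl.
  rewrite row_mxEr castmxE cast_ord_id /=; set k := cast_ord (esym (addn1 m)) i.
  case: (split_ordP k) => [l kE|l kE]; rewrite kE.
    rewrite (_ : cast_ord _ _ = lshift 1 (rshift n l)); last first.
      by apply: val_inj => /=; rewrite -[val l]/(val (lshift 1 l)) -kE.
    by rewrite !row_mxEl row_mxEr.
  rewrite (_ : cast_ord _ _ = rshift (n + m) l); last first.
    by apply: val_inj => /=; rewrite -addnA -[(m + l)%N]/(val (rshift m l)) -kE.
  by rewrite !row_mxEr.
apply/seteqP; split=> x /=.
  move=> [w [z Xz zE]]; exists (castmx (erefl, addn1 m) (row_mx w (rsubmx z))).
  by rewrite -castE -zE hsubmxK.
move=> [v Xv]; pose v' := castmx (erefl, esym (addn1 m)) v.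
exists (lsubmx v'), (row_mx (row_mx x (lsubmx v')) (rsubmx v')); last by rewrite row_mxKl.
by rewrite /= castE hsubmxK castmxKV.
Qed.

Lemma definable_zeros n m (F : 'I_m -> 'rV[R]_n -> R) : (forall j, polyfun (F j)) ->
  D [set z | forall j, F j z = 0].
Proof.
move=> pF; have /choice[p pE] : forall j, exists p : mpoly n R, forall x : 'rV[R]_n, meval (fun i => x 0 i) p = F j x.
  by move=> j; exact: polyfun_mpoly.
apply: (ominimal_algebraic hD); exists [seq p j | j <- enum 'I_m].
apply/seteqP; split=> z /= h.
  by move=> _ /mapP[j _ ->]; rewrite pE.
by move=> j; rewrite -pE; apply: h; apply: map_f; rewrite mem_enum.
Qed.

(** The preimage is the projection of the algebraic graph of [phi] cut by the cylinder over [X]. *)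
Lemma definable_preimage n m (X : set 'rV[R]_m) (phi : 'rV[R]_n -> 'rV[R]_m) :
  D X -> polymap phi -> D [set z | X (phi z)].
Proof.
move=> DX pphi.
pose G := [set z : 'rV[R]_(n + m) | forall j, rsubmx z 0 j - phi (lsubmx z) 0 j = 0].
have DG : D G.
  apply: definable_zeros => j; apply: polyfun_sub.
    exact: polymap_rsubmx.
  exact: polyfun_comp (@polymap_lsubmx _ _ _) (pphi j).
have DP := ominimal_prod hD (definable_setT n) DX.
have := definable_proj (definable_setI DG DP).
rewrite (_ : mkset _ = [set z | X (phi z)]) //; apply/seteqP; split=> z /=.
  move=> [w]; rewrite /G /= row_mxKl row_mxKr => -[e [_ Xw]].
  by rewrite (_ : phi z = w) //; apply/rowP => j; move/eqP: (e j); rewrite subr_eq0 => /eqP.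
move=> Xz; exists (phi z); rewrite /G /= row_mxKl row_mxKr; split=> // j.
by rewrite subrr.
Qed.

Lemma definable_ex n m (P : 'rV[R]_n -> 'rV[R]_m -> Prop) :
  D [set z : 'rV[R]_(n + m) | P (lsubmx z) (rsubmx z)] -> D [set x | exists w, P x w].
Proof.
move=> /definable_proj; rewrite (_ : mkset _ = [set x | exists w, P x w]) //.
by apply/seteqP; split=> x /= [w Pw]; exists w; move: Pw; rewrite row_mxKl row_mxKr.
Qed.

Lemma definable_all n m (P : 'rV[R]_n -> 'rV[R]_m -> Prop) :
  D [set z : 'rV[R]_(n + m) | P (lsubmx z) (rsubmx z)] -> D [set x | forall w, P x w].
Proof.
move=> /definable_not DP; have := definable_not (@definable_ex n m (fun x w => ~ P x w) DP).
rewrite (_ : mkset _ = [set x | forall w, P x w]) //.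
apply/seteqP; split=> x /= h; last by move=> [w]; apply.
by move=> w; apply: contrapT => nP; apply: h; exists w.
Qed.

Lemma rV1E (t : 'rV[R]_1) : const_mx (t 0 0) = t.
Proof. by apply/rowP => j; rewrite mxE ord1. Qed.

Lemma definable_exR n (P : 'rV[R]_n -> R -> Prop) :
  D [set z : 'rV[R]_(n + 1) | P (lsubmx z) (rsubmx z 0 0)] -> D [set x | exists t, P x t].
Proof.
move=> /(@definable_ex n 1 (fun x w => P x (w 0 0))).
rewrite (_ : mkset _ = [set x | exists t, P x t]) //.
apply/seteqP; split=> x /= [w Pw]; first by exists (w 0 0).
by exists (const_mx w); rewrite mxE.
Qed.

Lemma definable_allR n (P : 'rV[R]_n -> R -> Prop) :
  D [set z : 'rV[R]_(n + 1) | P (lsubmx z) (rsubmx z 0 0)] -> D [set x | forall t, P x t].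
Proof.
move=> /(@definable_all n 1 (fun x w => P x (w 0 0))).
rewrite (_ : mkset _ = [set x | forall t, P x t]) //.
apply/seteqP; split=> x /= h w; last exact: h.
by have := h (const_mx w); rewrite mxE.
Qed.

Lemma definable_ge0 n (f : 'rV[R]_n -> R) : polyfun f -> D [set z | 0 <= f z].
Proof.
move=> pf.
have -> : [set z | 0 <= f z] = [set z | exists t, f z = t ^+ 2].
  apply/seteqP; split=> z /=; last by move=> [t ->]; exact: sqr_ge0.
  by move=> f0; exists (Num.sqrt (f z)); rewrite sqr_sqrtr.
apply: definable_exR.
rewrite (_ : mkset _ = [set z : 'rV[R]_(n + 1) | forall _ : 'I_1, f (lsubmx z) - rsubmx z 0 0 ^+ 2 = 0]).
  apply: definable_zeros => _; apply: polyfun_sub.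
    exact: polyfun_comp (@polymap_lsubmx _ _ _) pf.
  apply: polyfun_exp; exact: polymap_rsubmx.
apply/seteqP; split=> z /= h; first by move=> _; rewrite h subrr.
by apply/eqP; rewrite -subr_eq0 (h 0).
Qed.

Lemma definable_le n (f g : 'rV[R]_n -> R) : polyfun f -> polyfun g -> D [set z | f z <= g z].
Proof.
move=> pf pg; rewrite (_ : mkset _ = [set z | 0 <= g z - f z]).
  by apply: definable_ge0; exact: polyfun_sub.
by apply/seteqP; split=> z /=; rewrite subr_ge0.
Qed.

Lemma definable_lt n (f g : 'rV[R]_n -> R) : polyfun f -> polyfun g -> D [set z | f z < g z].
Proof.
move=> pf pg; rewrite (_ : mkset _ = [set z | ~ g z <= f z]).
  by apply: definable_not; exact: definable_le.
by apply/seteqP; split=> z /=; rewrite ltNge => /negP.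
Qed.

(** Positivity of [r] is part of the condition because the coordinatewise inequalities are vacuous
    for [n = 0]. *)
Lemma definable_ball N n (phi psi : 'rV[R]_N -> 'rV[R]_n) (r : 'rV[R]_N -> R) :
  polymap phi -> polymap psi -> polyfun r ->
  D [set e | 0 < r e /\ `|phi e - psi e| < r e].
Proof.
move=> pphi ppsi pr.
have -> : [set e | 0 < r e /\ `|phi e - psi e| < r e] =
    [set e | 0 < r e] `&` \big[setI/setT]_(i < n) ([set e | phi e 0 i - psi e 0 i < r e] `&` [set e | - r e < phi e 0 i - psi e 0 i]).
  rewrite -bigcap_seq /=.
  apply/seteqP; split=> e /= [r0 h]; split=> //.
    move=> i _ /=; have := le_lt_trans (coord_le_norm (phi e - psi e) i) h.
    by rewrite !mxE ltr_norml => /andP[].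
  apply: norm_lt_coord => // i; have [/=] := h i (mem_index_enum _).
  by rewrite !mxE ltr_norml => -> ->.
apply: definable_setI; first by apply: definable_lt pr; exact: polyfun_cst.
apply: (big_ind (fun X : set 'rV[R]_N => D X)) => [|X Y|i _]; [exact: definable_setT|exact: definable_setI|].
by apply: definable_setI; apply: definable_lt; rewrite /=; try exact: polyfun_opp; try exact: polyfun_sub.
Qed.

Section Compare.
Variables (n : nat) (A : set 'rV[R]_n) (f : 'rV[R]_n -> 'rV[R]_n).
Hypothesis fD : definable_map (@D) A f.

(** Membership in [A] is included because the definable graph describes [f] over [A] only. *)
Lemma definable_increment N u (alpha beta : 'rV[R]_N -> 'rV[R]_n) (l : 'rV[R]_N -> R) :
  polymap alpha -> polymap beta -> polyfun l ->
  D [set e | [/\ A (alpha e), A (beta e) & dot u (f (beta e)) - dot u (f (alpha e)) <= l e]].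
Proof.
move=> pa pb pl.
pose G (x w : 'rV[R]_n) := A x /\ w = f x.
have DG k (x w : 'rV[R]_k -> 'rV[R]_n) : polymap x -> polymap w -> D [set e | G (x e) (w e)].
  move=> px pw; have := definable_preimage fD (polymap_row_mx px pw).
  by rewrite (_ : mkset _ = [set e | G (x e) (w e)]) //; apply/seteqP; split=> e /=; rewrite row_mxKl row_mxKr.
have -> : [set e | [/\ A (alpha e), A (beta e) & dot u (f (beta e)) - dot u (f (alpha e)) <= l e]] =
    [set e | exists w, exists w', G (alpha e) w /\ (G (beta e) w' /\ dot u w' - dot u w <= l e)].
  apply/seteqP; split=> e /=.
    by move=> [h1 h2 h3]; exists (f (alpha e)), (f (beta e)).
  by move=> [w [w' [[h1 ->] [[h2 ->] h3]]]].
have pl1 := @polymap_lsubmx R N n.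
have pr1 := @polymap_rsubmx R N n.
have pl2 := @polymap_lsubmx R (N + n) n.
have pr2 := @polymap_rsubmx R (N + n) n.
apply: definable_ex.
apply: (@definable_ex (N + n) n (fun z w' => G (alpha (lsubmx z)) (rsubmx z) /\
  (G (beta (lsubmx z)) w' /\ dot u w' - dot u (rsubmx z) <= l (lsubmx z)))).
have pll := polymap_comp pl2 pl1; have plr := polymap_comp pl2 pr1.
apply: definable_and; first exact: DG (polymap_comp pll pa) plr.
apply: definable_and; first exact: DG (polymap_comp pll pb) pr2.
apply: definable_le; last exact: polyfun_comp pll pl.
by apply: polyfun_sub; apply: polyfun_dot => //; exact: polymap_cst.
Qed.

End Compare.
End Definable.

(** * Baire's theorem and interiors of definable sets *)

Section BaireRow.
Variables (R : realType) (n : nat).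
Implicit Types (U V : set 'rV[R]_n).

#[local] HB.instance Definition _ := Complete.on 'rV[R]_n.

Definition open_ne U := open U /\ U !=set0.

Definition dense_in (E V : set 'rV[R]_n) := forall O, open_ne O -> O `<=` V -> (O `&` E) !=set0.

Lemma baire_row (F : nat -> set 'rV[R]_n) :
  (forall i, open (F i) /\ dense (F i)) -> dense (\bigcap_i (F i)).
Proof. exact: Baire. Qed.

(** If no [E i] were dense in an open part of [U], the complements of the closures of the [E i] in
    [U] would be dense open sets with no common point in [U]. *)
Lemma baire_union U (E : nat -> set 'rV[R]_n) : open_ne U -> U `<=` \bigcup_i E i ->
  exists i V, [/\ open_ne V, V `<=` U & dense_in (E i) V].
Proof.
move=> [oU U0] UE; apply: contrapT => no.
pose F i := ~` closure (E i `&` U).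
have FP i : open (F i) /\ dense (F i).
  split; first by apply: closed_openC; exact: closed_closure.
  move=> O O0 oO; apply: contrapT => /set0P/negP; rewrite negbK => /eqP OF.
  have OE : O `<=` closure (E i `&` U).
    by move=> x Ox; apply: contrapT => nx; have : (O `&` F i) x by []; rewrite OF.
  apply: no; exists i, (O `&` U); split; first split.
  - exact: openI.
  - have [x Ox] := O0; have [y [[_ Uy] Oy]] := OE x Ox O (open_nbhs_nbhs (conj oO Ox)).
    by exists y.
  - by move=> x [].
  - move=> P [oP [x Px]] POU; have [Ox _] := POU x Px.
    have [y [[Ey _] Py]] := OE x Ox P (open_nbhs_nbhs (conj oP Px)).
    by exists y.
have [x [Ux Fx]] := baire_row FP U0 oU.
have [i _ Ei] := UE x Ux; apply: (Fx i I); exact: subset_closure.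
Qed.

End BaireRow.

Section OneDim.
Variable R : realType.
Implicit Types (S : set R) (a b : R).

Definition has_interval S := exists p q, p < q /\ forall t, p < t -> t < q -> S t.

Lemma finite_or_interval (s : seq (interval R)) a b :
  has_interval [set t | a < t < b /\ exists2 I, I \in s & t \in I] \/
  finite_set [set t | a < t < b /\ exists2 I, I \in s & t \in I].
Proof.
elim: s => [|I s [[p [q [pq pqP]]]|fin]].
- by right; rewrite (_ : mkset _ = set0) //; apply/seteqP; split=> t // [_ []].
- left; exists p, q; split=> // t pt tq; have [h [J Js tJ]] := pqP t pt tq.
  by split=> //; exists J => //; rewrite inE Js orbT.
have [[p [q [pq pI qI]]]|no] := pselect (exists p q, [/\ p < q, p \in I /\ a < p < b & q \in I /\ a < q < b]).
  left; exists p, q; split=> // t pt tq; split.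
    by move: pI qI => [_ /andP[ap _]] [_ /andP[_ qb]]; rewrite (lt_trans ap) // (lt_trans tq).
  exists I; first exact: mem_head.
  have := @interval_is_interval R I p q pI.1 qI.1 t; rewrite (ltW pt) (ltW tq) => /(_ isT).
  by [].
right; pose T := [set t | t \in I /\ a < t < b].
have finT : finite_set T.
  have [[t Tt]|noT] := pselect (exists t, T t); last first.
    by rewrite (_ : T = set0) //; apply/seteqP; split=> // t Tt; apply: noT; exists t.
  apply: sub_finite_set (finite_set1 t) => t' Tt' /=.
  by case: (ltgtP t' t) => // h; case: no; [exists t', t|exists t, t'].
have finU : finite_set ([set t | a < t < b /\ exists2 I, I \in s & t \in I] `|` T).
  by rewrite finite_setU.
apply: sub_finite_set finU.
move=> t /= [tab [J]]; rewrite inE => /orP[/eqP ->|Js] tJ; [right|left] => //.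
by split=> //; exists J.
Qed.

Lemma open_interval_infinite a b : a < b -> ~ finite_set [set t | a < t < b].
Proof.
move=> ab fin; pose g (n : nat) := a + (b - a) / n.+2%:R.
have gi : injective g.
  move=> i j; rewrite /g => /addrI /(mulfI _) h; have {}h := h (negbT (gt_eqF _)).
  have := h; rewrite subr_gt0 => /(_ ab)/invr_inj/eqP.
  by rewrite eqr_nat => /eqP[].
apply: infinite_nat; rewrite (_ : setT = g @^-1` [set t | a < t < b]).
  by apply: finite_preimage => // x y _ _; exact: gi.
apply/seteqP; split=> // i _ /=; rewrite /g.
have ba : 0 < b - a by rewrite subr_gt0.
rewrite ltrDl divr_gt0 ?ltr0n //= -ltrBrDl ltr_pdivrMr ?ltr0n // ltr_pMr //.
by rewrite ltr1n.
Qed.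

(** Rational endpoints leave countably many cases, as Baire's theorem demands. *)
Lemma rational_interval S : has_interval S ->
  exists p q : rat, ratr p < ratr q :> R /\ forall t, ratr p < t -> t < ratr q -> S t.
Proof.
move=> [p [q [pq pqS]]].
have [x] := rat_in_itvoo pq; rewrite in_itv /= => /andP[px xq].
have [y] := rat_in_itvoo xq; rewrite in_itv /= => /andP[xy yq].
exists x, y; split=> // t xt ty; apply: pqS; [exact: lt_trans xt|exact: lt_trans yq].
Qed.

End OneDim.

Section DenseInterior.
Variables (R : realType) (D : forall n : nat, set (set 'rV[R]_n)).
Arguments D {n}.
Hypothesis hD : ominimal (@D).

Lemma open_normP n (W : set 'rV[R]_n) :
  (forall x, W x -> exists2 d, 0 < d & forall z, `|z - x| < d -> W z) -> open W.
Proof.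
move=> h; rewrite openE => x /h[d d0 dW]; apply/nbhs_ballP; exists d => //= z.
by rewrite ballE => /dW.
Qed.

Lemma norm_lsubmx m n (z : 'rV[R]_(m + n)) : `|lsubmx z| <= `|z|.
Proof. by apply: norm_le_coord => // i; rewrite mxE coord_le_norm. Qed.

Lemma norm_row_mx m n (x : 'rV[R]_m) (y : 'rV[R]_n) r : 0 < r -> `|x| < r -> `|y| < r -> `|row_mx x y| < r.
Proof.
move=> r0 xr yr; apply: norm_lt_coord => // j.
case: (split_ordP j) => i ->; rewrite ?row_mxEl ?row_mxEr; apply: le_lt_trans; try exact: coord_le_norm; by [].
Qed.

Lemma definable_line (X : set 'rV[R]_1) a b : D X ->
  has_interval [set t | a < t < b /\ X (const_mx t)] \/ finite_set [set t | a < t < b /\ X (const_mx t)].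
Proof.
move=> /(ominimal_dim1 hD)[s ->].
rewrite (_ : mkset _ = [set t | a < t < b /\ exists2 I, I \in s & t \in I]); first exact: finite_or_interval.
by apply/seteqP; split=> t /= [tab]; rewrite mxE.
Qed.

(** By induction on the dimension: above each base point, [X] or [Y] contains an interval of the
    fibre. Baire's theorem fixes one rational interval and one of the two sets for a dense set of
    base points, and the induction hypothesis turns this set into one containing an open set. *)
Lemma definable_dichotomy n (X Y U : set 'rV[R]_n) : D X -> D Y -> open_ne U ->
  U `<=` X `|` Y -> exists V, [/\ open_ne V, V `<=` U & V `<=` X \/ V `<=` Y].
Proof.
elim: n X Y U => [|n IH].
  move=> X Y U DX DY [oU [z Uz]] UXY.
  have all0 (x : 'rV[R]_0) : x = z by apply/rowP => -[].
  exists U; split=> //; first by split=> //; exists z.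
  by case: (UXY z Uz) => h; [left|right] => x _; rewrite (all0 x).
rewrite -[n.+1]addn1 => X Y U DX DY [oU [z Uz]] UXY.
have [r r0 rU] := open_ballP oU Uz.
pose a0 := lsubmx z; pose c := rsubmx z 0 0.
have boxU a t : `|a - a0| < r -> c - r < t < c + r -> U (row_mx a (const_mx t)).
  move=> ar /andP[t1 t2]; apply: rU; rewrite -[z]hsubmxK opp_row_mx add_row_mx.
  apply: norm_row_mx => //; apply: norm_lt_coord => // i; rewrite !mxE ord1 /c in t1 t2 *.
  have -> : z 0 (rshift n 0) = rsubmx z 0 0 by rewrite mxE.
  by rewrite ltr_norml; apply/andP; split; lra.
pose Z (b : bool) := if b then X else Y.
have DZ b : D (Z b) by case: b.
(* The bounds by [c - r] and [c + r] keep the product of the base with the interval inside [U]. *)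
pose E (i : nat) : set 'rV[R]_n := if choice.unpickle i : option (bool * (rat * rat)) is Some (b, (p, q)) then
  [set a | ratr p < ratr q :> R /\ forall t, (ratr p < t /\ t < ratr q) -> c - r < t /\ (t < c + r /\ Z b (row_mx a (const_mx t)))] else set0.
have DE i : D (E i).
  rewrite /E; case: (choice.unpickle i) => [[b [p q]]|]; last exact: (ominimal_set0 hD).
  apply: (definable_and hD); first exact: (definable_cst hD).
  apply: (definable_allR hD).
  have pt := @polymap_rsubmx R n 1 0.
  apply: (definable_imp hD).
    by apply: (definable_and hD); apply: (definable_lt hD) => //; exact: polyfun_cst.
  apply: (definable_and hD); first by apply: (definable_lt hD) => //; exact: polyfun_cst.
  apply: (definable_and hD); first by apply: (definable_lt hD) => //; exact: polyfun_cst.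
  apply: (definable_preimage hD) => //; apply: polymap_row_mx.
    exact: polymap_lsubmx.
  exact: polymap_scalar.
have UE : norm_ball a0 r `<=` \bigcup_i E i.
  move=> a ar.
  have DZa b : D [set t : 'rV[R]_1 | Z b (row_mx a t)].
    apply: (definable_preimage hD (DZ b)); apply: polymap_row_mx.
      exact: polymap_cst.
    exact: polymap_id.
  have [b [p [q [pq pqZ]]]] : exists b (p q : rat), ratr p < ratr q :> R /\ forall t, ratr p < t -> t < ratr q -> c - r < t < c + r /\ Z b (row_mx a (const_mx t)).
    have [/rational_interval[p [q h]]|f1] := definable_line (c - r) (c + r) (DZa true).
      by exists true, p, q.
    have [/rational_interval[p [q h]]|f2] := definable_line (c - r) (c + r) (DZa false).
      by exists false, p, q.
    exfalso; apply: (@open_interval_infinite R (c - r) (c + r)); first lra.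
    have fU : finite_set ([set t | c - r < t < c + r /\ [set t : 'rV[R]_1 | Z true (row_mx a t)] (const_mx t)] `|`
      [set t | c - r < t < c + r /\ [set t : 'rV[R]_1 | Z false (row_mx a t)] (const_mx t)]).
      by rewrite finite_setU.
    apply: sub_finite_set fU => t tI; case: (UXY _ (boxU a t ar tI)) => h; [left|right]; by split.
  exists (choice.pickle (b, (p, q))) => //; rewrite /E choice.pickleK /=; split=> // t [pt tq].
  by have [/andP[h1 h2] h3] := pqZ t pt tq.
have ballne : open_ne (norm_ball a0 r).
  by split; [exact: norm_ball_open|exists a0; rewrite /norm_ball /= subrr normr0].
have [i [V [oV VU dV]]] := baire_union ballne UE.
have [V' [oV' V'V h]] : exists V', [/\ open_ne V', V' `<=` V & V' `<=` E i \/ V' `<=` ~` E i].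
  apply: IH => //; first exact: (ominimal_setC hD).
  by move=> x _; case: (pselect (E i x)) => ?; [left|right].
have {h} V'E : V' `<=` E i.
  by case: h => // V'nE; have [x [V'x Ex]] := dV V' oV' V'V; have := V'nE x V'x Ex.
move: V'E; rewrite /E; case: (choice.unpickle i) => [[b [p q]]|] V'E; last first.
  by have [_ [x /V'E]] := oV'.
have [oV'' [x V'x]] := oV'.
have [pq _] := V'E x V'x.
exists [set w | V' (lsubmx w) /\ ratr p < rsubmx w 0 0 < ratr q]; split.
- split; last first.
    exists (row_mx x (const_mx ((ratr p + ratr q) / 2))); rewrite /= row_mxKl row_mxKr mxE.
    by split=> //; apply/andP; split; lra.
  apply: open_normP => w [V'w /andP[pw wq]].
  have [d d0 dV'] := open_ballP oV'' V'w.
  pose m := Num.min (rsubmx w 0 0 - ratr p) (ratr q - rsubmx w 0 0).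
  have m0 : 0 < m by rewrite lt_min !subr_gt0 pw.
  exists (Num.min d m); first by rewrite lt_min d0.
  move=> w'; rewrite lt_min => /andP[wd wm]; split.
    by apply: dV'; apply: le_lt_trans wd; rewrite -linearB norm_lsubmx.
  have : `|rsubmx w' 0 0 - rsubmx w 0 0| < m.
    apply: le_lt_trans wm; have := coord_le_norm (w' - w) (rshift n 0).
    by rewrite !mxE.
  rewrite lt_min => /andP[]; rewrite !ltr_norml => /andP[h1 h2] /andP[h3 h4].
  by apply/andP; split; lra.
- move=> w /= [V'w /andP[pw wq]]; have [_ /(_ (rsubmx w 0 0) (conj pw wq))[h1 [h2 _]]] := V'E _ V'w.
  rewrite -[w]hsubmxK -[rsubmx w]rV1E; apply: boxU; last by rewrite h1.
  exact: VU (V'V _ V'w).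
- have h w : V' (lsubmx w) /\ ratr p < rsubmx w 0 0 < ratr q -> Z b w.
    move=> [V'w /andP[pw wq]]; have [_ /(_ (rsubmx w 0 0) (conj pw wq))[_ [_]]] := V'E _ V'w.
    by rewrite rV1E hsubmxK.
  by case: (b) h => h; [left|right] => w /= /h.
Qed.

(** Some [E i] is dense in an open set; its complement cannot contain an open part of that set, so
    the dichotomy leaves only [E i]. *)
Lemma definable_baire n U (E : nat -> set 'rV[R]_n) : (forall i, D (E i)) ->
  open_ne U -> U `<=` \bigcup_i E i -> exists i V, [/\ open_ne V, V `<=` U & V `<=` E i].
Proof.
move=> DE oU UE; have [i [V [oV VU dV]]] := baire_union oU UE.
have [V' [oV' V'V h]] : exists V', [/\ open_ne V', V' `<=` V & V' `<=` E i \/ V' `<=` ~` E i].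
  apply: definable_dichotomy => //; first exact: (ominimal_setC hD).
  by move=> x _; case: (pselect (E i x)) => ?; [left|right].
exists i, V'; split=> //; first exact: subset_trans VU.
by case: h => // V'nE; have [x [V'x Ex]] := dV V' oV' V'V; have := V'nE x V'x Ex.
Qed.

End DenseInterior.

(** * Generic differentiability *)

Section Monotone.
Variable R : realType.

Lemma infinite_avoid (S : set R) a b : a < b -> finite_set S -> exists t, a < t < b /\ ~ S t.
Proof.
move=> ab fS; apply: contrapT => no; apply: (open_interval_infinite ab).
by apply: sub_finite_set fS => t tab; apply: contrapT => nS; apply: no; exists t.
Qed.

(* Choosing a level outside the image of the exceptional set, the last point
   at or above this level is not exceptional. *)
Lemma nondecreasing_except_finite (chi : R -> R) a b (S : set R) : a <= b ->
  (forall t, a <= t <= b -> forall e, 0 < e -> exists2 d, 0 < d &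
     forall s, a <= s <= b -> `|s - t| < d -> `|chi s - chi t| < e) ->
  finite_set S ->
  (forall t, a <= t < b -> ~ S t -> forall d, 0 < d -> exists2 t', 0 < t' < d & chi t < chi (t + t')) ->
  chi a <= chi b.
Proof.
move=> ab cchi fS inc; rewrite leNgt; apply/negP => ba.
have [l [/andP[bl la] lS]] := infinite_avoid ba (finite_image chi fS).
pose T := [set t | a <= t <= b /\ l <= chi t].
have aT : T a by split; [rewrite lexx|exact: ltW].
have supT : has_sup T by split; [exists a|exists b => t [/andP[]]].
pose c := sup T.
have ac : a <= c by exact: ub_le_sup supT.2 _ aT.
have cb : c <= b by apply: ge_sup; [exists a|move=> t [/andP[]]].
have cab : a <= c <= b by rewrite ac.
have lc : l <= chi c.
  rewrite leNgt; apply/negP => cl; have e0 : 0 < l - chi c by rewrite subr_gt0.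
  have [d d0 dP] := cchi c cab _ e0.
  have [t Tt ct] := sup_adherent d0 supT.
  have tc : t <= c by exact: ub_le_sup supT.2 _ Tt.
  have [tab lt] := Tt; have := dP t tab; rewrite ler0_norm ?subr_le0 //.
  have h : - (t - c) < d by move: ct; rewrite -/c; lra.
  by move=> /(_ h); rewrite ltr_norml => /andP[]; lra.
have clb : c < b by rewrite lt_neqAle cb andbT; apply: contraTneq lc => ->; rewrite -ltNge.
have cE : chi c = l.
  apply/eqP; rewrite eq_le lc andbT leNgt; apply/negP => lc'.
  have e0 : 0 < chi c - l by rewrite subr_gt0.
  have [d d0 dP] := cchi c cab _ e0.
  pose m := Num.min (d / 2) (b - c).
  have m0 : 0 < m by rewrite lt_min divr_gt0 // subr_gt0.
  have md : m <= d / 2 by rewrite ge_min lexx.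
  have mb : m <= b - c by rewrite ge_min lexx orbT.
  have tab : a <= c + m <= b by apply/andP; split; lra.
  have := dP _ tab; rewrite addrAC subrr add0r gtr0_norm // => /(_ ltac:(lra)).
  rewrite ltr_norml => /andP[h _].
  have : T (c + m) by split=> //; lra.
  by move/(ub_le_sup supT.2); rewrite -/c; lra.
have nSc : ~ S c by move=> Sc; apply: lS; exists c.
have acb : a <= c < b by rewrite ac.
have bc0 : 0 < b - c by rewrite subr_gt0.
have [t' /andP[t'0 t'd] t'c] := inc c acb nSc _ bc0.
have : T (c + t') by split; [apply/andP; split; lra|rewrite -cE ltW].
by move/(ub_le_sup supT.2); rewrite -/c; lra.
Qed.

End Monotone.

(** * One-sided slopes and mean value inequalities *)

Section Increments.
Variables (R : realType) (D : forall n : nat, set (set 'rV[R]_n)).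
Arguments D {n}.
Hypothesis hD : ominimal (@D).
Variables (n : nat) (Omega : set 'rV[R]_n) (f : 'rV[R]_n -> 'rV[R]_n).
Hypothesis Omega_open : open Omega.
Hypothesis f_continuous : {within closure Omega, continuous f}.
Hypothesis f_definable : definable_map (@D) (closure Omega) f.
Let A := closure Omega.

Section Direction.
Variables u v : 'rV[R]_n.

Let inc t z := dot u (f (z + t *: v)) - dot u (f z).

(** Eventual domination of the right difference quotients by [q]: unlike a derivative it presupposes
    no limit, and it is definable. *)
Definition upper_slope q z := exists d, 0 < d /\ forall t, 0 < t /\ t < d ->
  [/\ A z, A (z + t *: v) & inc t z <= q * t].

Lemma definable_upper_slope N (q : 'rV[R]_N -> R) (alpha : 'rV[R]_N -> 'rV[R]_n) :
  polyfun q -> polymap alpha -> D [set e | upper_slope (q e) (alpha e)].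
Proof.
move=> pq pa; apply: (definable_exR hD).
have pl1 := @polymap_lsubmx R N 1.
have pr1 := @polymap_rsubmx R N 1.
have pl2 := @polymap_lsubmx R (N + 1) 1.
have pr2 := @polymap_rsubmx R (N + 1) 1.
have pll := polymap_comp pl2 pl1.
have pd1 : polyfun (fun z : 'rV[R]_(N + 1) => rsubmx z 0 0) by exact: pr1.
have pd : polyfun (fun z : 'rV[R]_(N + 1 + 1) => rsubmx (lsubmx z) 0 0) by exact: (polymap_comp pl2 pr1).
have pt : polyfun (fun z : 'rV[R]_(N + 1 + 1) => rsubmx z 0 0) by exact: pr2.
apply: (definable_and hD); first by apply: (definable_lt hD) => //; exact: polyfun_cst.
apply: (@definable_allR _ _ hD _ (fun (z : 'rV[R]_(N + 1)) t => 0 < t /\ t < rsubmx z 0 0 ->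
  [/\ A (alpha (lsubmx z)), A (alpha (lsubmx z) + t *: v) & inc t (alpha (lsubmx z)) <= q (lsubmx z) * t])).
apply: (definable_imp hD).
  by apply: (definable_and hD); apply: (definable_lt hD) => //; exact: polyfun_cst.
have pal : polymap (fun z : 'rV[R]_(N + 1 + 1) => alpha (lsubmx (lsubmx z))).
  exact: polymap_comp pll pa.
apply: (definable_increment hD f_definable u pal (beta := fun z => alpha (lsubmx (lsubmx z)) + rsubmx z 0 0 *: v)).
  by apply: polymap_add => //; apply: polymap_scale => //; exact: polymap_cst.
by apply: polyfun_mul => //; exact: polyfun_comp pll pq.
Qed.

Lemma line_in_open (U : set 'rV[R]_n) x : open U -> U x ->
  exists2 d, 0 < d & forall t, 0 <= t -> t < d -> U (x + t *: v).
Proof.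
move=> oU Ux; have [d d0 dU] := open_ballP oU Ux.
exists (d / (`|v| + 1)); first by rewrite divr_gt0 // ltr_wpDl.
move=> t t0; rewrite ltr_pdivlMr ?ltr_wpDl // => td; apply: dU.
rewrite addrAC subrr add0r normrZ ger0_norm //; apply: le_lt_trans td.
by rewrite ler_wpM2l // lerDl.
Qed.

Lemma not_upper_slope q z : Omega z -> ~ upper_slope q z ->
  forall d, 0 < d -> exists2 t, 0 < t < d & q * t < inc t z.
Proof.
move=> Oz nP d d0; apply: contrapT => no; apply: nP.
have [e e0 eO] := line_in_open Omega_open Oz.
exists (Num.min d e); split; first by rewrite lt_min d0.
move=> t [t0]; rewrite lt_min => /andP[td te]; split.
- exact: subset_closure.
- by apply/subset_closure/eO => //; exact: ltW.
- by rewrite leNgt; apply/negP => h; apply: no; exists t => //; rewrite t0.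
Qed.

Lemma line_continuous x s (k : R) : (forall t, 0 <= t <= s -> A (x + t *: v)) ->
  forall t, 0 <= t <= s -> forall e, 0 < e -> exists2 d, 0 < d &
  forall t', 0 <= t' <= s -> `|t' - t| < d ->
  `|(dot u (f (x + t' *: v)) + k * t') - (dot u (f (x + t *: v)) + k * t)| < e.
Proof.
move=> xA t ts e e0.
have [c c0 cP] := dot_bounded u.
have e1 : 0 < e / 2 / c by rewrite !divr_gt0.
have [d d0 dP] := within_continuousP f_continuous (xA t ts) e1.
have k0 : 0 < `|k| + 1 by rewrite ltr_wpDl.
have v0 : 0 < `|v| + 1 by rewrite ltr_wpDl.
exists (Num.min (d / (`|v| + 1)) (e / 2 / (`|k| + 1))).
  by rewrite lt_min !divr_gt0.
move=> t' t's; rewrite lt_min ltr_pdivlMr // => /andP[h1]; rewrite ltr_pdivlMr // => h2.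
have fd : `|f (x + t' *: v) - f (x + t *: v)| < e / 2 / c.
  apply: dP; first exact: xA.
  rewrite opprD addrACA subrr add0r -scalerBl normrZ; apply: le_lt_trans h1.
  by rewrite ler_wpM2l // lerDl.
have -> : dot u (f (x + t' *: v)) + k * t' - (dot u (f (x + t *: v)) + k * t) =
  dot u (f (x + t' *: v) - f (x + t *: v)) + k * (t' - t) by rewrite dotBr; ring.
rewrite (le_lt_trans (ler_normD _ _)) // [ltRHS]splitr ltrD //.
  by move: fd; rewrite ltr_pdivlMr // mulrC => /(le_lt_trans (cP _)).
by rewrite normrM mulrC; apply: le_lt_trans h2; rewrite ler_wpM2l // lerDl.
Qed.

Lemma upper_mean q x s : 0 <= s -> (forall t, 0 <= t <= s -> A (x + t *: v)) ->
  (forall t, 0 <= t < s -> upper_slope q (x + t *: v)) -> inc s x <= q * s.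
Proof.
move=> s0 xA up; rewrite /inc.
have [->|sN0] := eqVneq s 0; first by rewrite scale0r addr0 subrr mulr0.
have sp : 0 < s by rewrite lt_neqAle eq_sym sN0.
apply/ler_addgt0Pr => e e0; pose r := q + e / s.
(* The slope is enlarged by [e / s] because the monotonicity lemma wants strict increase while
   [upper_slope] gives a weak inequality. *)
have h := @nondecreasing_except_finite R (fun t => - (dot u (f (x + t *: v)) + (- r) * t)) 0 s set0 s0.
have : - (dot u (f (x + 0 *: v)) + - r * 0) <= - (dot u (f (x + s *: v)) + - r * s).
  apply: h => [t ts e' e'0||t ts _ d d0].
  - have [d d0 dP] := line_continuous (- r) xA ts e'0; exists d => // t' t's t't.
    by rewrite -opprD normrN; apply: dP.
  - exact: finite_set0.
  - have [d' [d'0 d'P]] := up t ts; pose m := Num.min d d' / 2.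
    have m0 : 0 < m by rewrite divr_gt0 // lt_min d0.
    have md : m < d by rewrite ltr_pdivrMr // gt_min ltr_pMr // ltr1n.
    have md' : m < d' by rewrite ltr_pdivrMr // gt_min [d' < d' * 2]ltr_pMr // ltr1n orbT.
    exists m; first by rewrite m0.
    have [_ _] := d'P m (conj m0 md'); rewrite /inc -addrA -scalerDl => hm.
    have : 0 < e / s * m by apply: mulr_gt0 => //; exact: divr_gt0.
    have lin (X Y q' e' t' m' : R) : X - Y <= q' * m' -> 0 < e' * m' ->
      X + - (q' + e') * (t' + m') < Y + - (q' + e') * t' by move=> *; lra.
    by rewrite ltrN2; exact: lin hm.
have -> : q * s + e = r * s by rewrite /r mulrDl divfK.
by rewrite scale0r addr0 mulr0 addr0; lra.
Qed.

(** The finite exceptional set [S] matches o-minimality on a line, where a definable set without an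
    interval is finite. *)
Lemma lower_mean q x s (S : set R) : 0 <= s -> (forall t, 0 <= t <= s -> Omega (x + t *: v)) ->
  finite_set S -> (forall t, 0 <= t < s -> ~ S t -> ~ upper_slope q (x + t *: v)) -> q * s <= inc s x.
Proof.
move=> s0 xO fS low; rewrite /inc.
have xA t : 0 <= t <= s -> A (x + t *: v) by move=> /xO; exact: subset_closure.
have : dot u (f (x + 0 *: v)) + - q * 0 <= dot u (f (x + s *: v)) + - q * s.
  apply: (@nondecreasing_except_finite R (fun t => (dot u (f (x + t *: v)) + (- q) * t)) 0 s S s0) => //.
    exact: line_continuous.
  move=> t ts nS d d0.
  have Oxt : Omega (x + t *: v) by apply: xO; move: ts => /andP[-> /ltW].
  have [t' t'd] := not_upper_slope Oxt (low t ts nS) d0; rewrite /inc -addrA -scalerDl => h.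
  by exists t' => //; lra.
by rewrite scale0r addr0 mulr0 addr0; lra.
Qed.

Lemma norm_ball_segment (a z : 'rV[R]_n) r s t : norm_ball a r z -> norm_ball a r (z + s *: v) ->
  0 <= t <= s -> norm_ball a r (z + t *: v).
Proof.
rewrite /norm_ball /= => h0 h1 /andP[t0 ts].
have [s0|s0] := eqVneq s 0; first by have -> : t = 0; [lra|rewrite scale0r addr0].
have sp : 0 < s by rewrite lt_neqAle eq_sym s0 (le_trans t0).
have -> : z + t *: v - a = (1 - t / s) *: (z - a) + (t / s) *: (z + s *: v - a).
  by apply/rowP => j; rewrite !mxE; field.
have c0 : 0 <= t / s by rewrite divr_ge0 // ltW.
have c1 : t / s <= 1 by rewrite ler_pdivrMr // mul1r.
have c2 : 0 <= 1 - t / s by rewrite subr_ge0.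
rewrite (le_lt_trans (ler_normD _ _)) // (normrZ (1 - t / s)) (normrZ (t / s)) (ger0_norm c2) (ger0_norm c0).
have [->|cN] := eqVneq (t / s) 0; first by rewrite subr0 mul1r mul0r addr0.
have cp : 0 < t / s by rewrite lt_neqAle eq_sym cN.
have -> : r = (1 - t / s) * r + t / s * r by ring.
by apply: ler_ltD; [rewrite ler_wpM2l // ltW|rewrite ltr_pM2l].
Qed.

Definition slopes_between q e (V : set 'rV[R]_n) := forall z t, V z -> 0 < t -> V (z + t *: v) ->
  q * t <= inc t z <= (q + e) * t.

Lemma upper_slope_le q q' z : q <= q' -> upper_slope q z -> upper_slope q' z.
Proof.
move=> qq' [d [d0 h]]; exists d; split=> // t td; have [h1 h2 h3] := h t td; split=> //.
by apply: le_trans h3 _; rewrite ler_wpM2r //; move: td => [/ltW].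
Qed.

(* Baire's theorem for the sets where the upper slope lies in a given interval of
   length [e]. *)
Lemma slopes_locally (U : set 'rV[R]_n) e : open_ne U -> U `<=` Omega -> 0 < e ->
  exists q a r, [/\ 0 < r, norm_ball a r `<=` U & slopes_between q e (norm_ball a r)].
Proof.
move=> oU UO e0.
(* Integer [k] stands for a threshold slope between [k * e] and [(k + 1) * e]. The two booleans
   stand for thresholds at minus and plus infinity, which the mean inequalities exclude on an open
   set since increments are finite. *)
pose E (i : nat) : set 'rV[R]_n := match choice.unpickle i : option (int + bool) with
  | Some (inl k) => [set z | ~ upper_slope (k%:~R * e) z /\ upper_slope ((k + 1)%:~R * e) z]
  | Some (inr true) => [set z | forall q, upper_slope q z]
  | Some (inr false) => [set z | forall q, ~ upper_slope q z]
  | None => set0 end.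
have DE i : D (E i).
  have plR := @polymap_lsubmx R n 1.
  have prR := @polymap_rsubmx R n 1 0.
  rewrite /E; case: (choice.unpickle i) => [[k|[]]|]; last exact: (ominimal_set0 hD).
  - apply: (definable_and hD); last by apply: definable_upper_slope; [exact: polyfun_cst|exact: polymap_id].
    by apply: (definable_not hD); apply: definable_upper_slope; [exact: polyfun_cst|exact: polymap_id].
  - by apply: (definable_allR hD); exact: definable_upper_slope.
  - by apply: (definable_allR hD); apply: (definable_not hD); exact: definable_upper_slope.
have UE : U `<=` \bigcup_i E i.
  move=> z Uz.
  have [allP|/existsNP[q0 nq0]] := pselect (forall q, upper_slope q z).
    by exists (choice.pickle (inr true : int + bool)) => //; rewrite /E choice.pickleK.
  have [[q1 Pq1]|noP] := pselect (exists q, upper_slope q z); last first.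
    exists (choice.pickle (inr false : int + bool)) => //; rewrite /E choice.pickleK => q Pq.
    by apply: noP; exists q.
  pose k0 : int := Num.floor (q0 / e).
  have k0q : k0%:~R * e <= q0 by rewrite -ler_pdivlMr // floor_le_tmp.
  pose Q (m : nat) := `[< upper_slope ((k0 + m%:Z)%:~R * e) z >].
  have exQ : exists m, Q m.
    exists (Num.bound `|q1 / e - k0%:~R|); apply/asboolP; apply: upper_slope_le Pq1.
    rewrite -ler_pdivrMr // intrD -lerBlDl.
    apply: le_trans (ler_norm _) _; apply: ltW; exact: (archi_boundP (normr_ge0 _)).
  case: (ex_minnP exQ) => -[|m] /asboolP Qm minQ.
    by case: nq0; apply: upper_slope_le Qm; rewrite addr0.
  exists (choice.pickle (inl (k0 + m%:Z) : int + bool)); first exact: I.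
  rewrite /E choice.pickleK; split.
    by move=> Pm; have := minQ m (asboolT Pm); rewrite ltnn.
  suff <- : (k0 + m.+1%:Z = k0 + m%:Z + 1) by exact: Qm.
  by rewrite -addn1 PoszD addrA.
have [i [V [[oV [a Va]] VU VE]]] := definable_baire hD DE oU UE.
have [r r0 rV] := open_ballP oV Va.
have BO z : norm_ball a r z -> Omega z by move=> /rV /VU /UO.
have aB : norm_ball a r a by rewrite /norm_ball /= subrr normr0.
have [d d0 dB] := line_in_open (@norm_ball_open R n a r) aB.
have d2 : 0 <= d / 2 by rewrite divr_ge0 // ltW.
have d2p : 0 < d / 2 by rewrite divr_gt0.
have d2d : d / 2 < d by lra.
have segB t : 0 <= t <= d / 2 -> norm_ball a r (a + t *: v).
  by move=> /andP[t0 td]; apply: dB => //; exact: le_lt_trans d2d.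
move: VE; rewrite /E; case: (choice.unpickle i) => [[k|[]]|] VE; last by have := VE a Va.
- exists (k%:~R * e), a, r; split=> // [z /rV /VU //|z t Bz t0 Bt].
  have seg s : 0 <= s <= t -> norm_ball a r (z + s *: v) by exact: norm_ball_segment.
  have segl s : 0 <= s < t -> norm_ball a r (z + s *: v).
    by move=> /andP[s0 /ltW st]; apply: seg; rewrite s0.
  apply/andP; split.
    apply: (@lower_mean _ _ _ set0); [exact: ltW|by move=> s /seg /BO|exact: finite_set0|].
    by move=> s /segl /rV /VE[].
  have -> : k%:~R * e + e = (k + 1)%:~R * e by rewrite intrD; ring.
  apply: upper_mean; first exact: ltW.
    by move=> s /seg /BO; exact: subset_closure.
  by move=> s /segl /rV /VE[].
- exfalso; have h q : inc (d / 2) a <= q * (d / 2).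
    apply: upper_mean => // t h; first by apply/subset_closure/BO/segB.
    by apply: VE; apply/rV/segB; move: h => /andP[-> /ltW].
  have := h ((inc (d / 2) a - 1) / (d / 2)); rewrite divfK ?gt_eqF //; lra.
- exfalso; have h q : q * (d / 2) <= inc (d / 2) a.
    apply: (@lower_mean _ _ _ set0) => // [t h|t h _]; first exact/BO/segB.
    by apply: VE; apply/rV/segB; move: h => /andP[-> /ltW].
  have := h ((inc (d / 2) a + 1) / (d / 2)); rewrite divfK ?gt_eqF //; lra.
Qed.

End Direction.
End Increments.

(** * Strict differentiability on open sets *)

Section GenericC1.
Variables (R : realType) (D : forall n : nat, set (set 'rV[R]_n)).
Arguments D {n}.
Hypothesis hD : ominimal (@D).
Variables (n : nat) (Omega : set 'rV[R]_n) (f : 'rV[R]_n -> 'rV[R]_n).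
Hypothesis Omega_open : open Omega.
Hypothesis f_continuous : {within closure Omega, continuous f}.
Hypothesis f_definable : definable_map (@D) (closure Omega) f.
Let A := closure Omega.

(* The slopes of [dot u \o f] in the direction [v] oscillate by at most [e] near
   [x]; the redundant conditions make every conjunct a set already known to be
   definable. *)
Definition slopes_oscillate u v e x := exists d, 0 < d /\ exists q, forall z t,
  0 < t /\ ((0 < d /\ `|z - x| < d) /\ (0 < d /\ `|z + t *: v - x| < d)) ->
  [/\ A z, A (z + t *: v) & dot u (f (z + t *: v)) - dot u (f z) <= (q + e) * t] /\
  [/\ A z, A (z + t *: v) & dot (- u) (f (z + t *: v)) - dot (- u) (f z) <= - q * t].

Lemma definable_slopes_oscillate u v N (e : 'rV[R]_N -> R) (alpha : 'rV[R]_N -> 'rV[R]_n) :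
  polyfun e -> polymap alpha -> D [set w | slopes_oscillate u v (e w) (alpha w)].
Proof.
move=> pe pa.
(* The quantified variables [d], [q], [z], [t] are appended to the [N] parameters in this order. *)
pose E1 := (N + 1)%N; pose E2 := (E1 + 1)%N; pose E3 := (E2 + n)%N; pose E4 := (E3 + 1)%N.
have l1 := @polymap_lsubmx R N 1.
have l2 := @polymap_lsubmx R E1 1.
have l3 := @polymap_lsubmx R E2 n.
have l4 := @polymap_lsubmx R E3 1.
have r1 := @polymap_rsubmx R N 1.
have r2 := @polymap_rsubmx R E1 1.
have r3 := @polymap_rsubmx R E2 n.
have r4 := @polymap_rsubmx R E3 1.
have l43 := polymap_comp l4 l3; have l432 := polymap_comp l43 l2.
have l4321 := polymap_comp l432 l1.
have px := polymap_comp l4321 pa.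
have pe4 := polyfun_comp l4321 pe.
have pd := polymap_comp l432 r1 0.
have pq := polymap_comp l43 r2 0.
have pz := polymap_comp l4 r3.
have pt := r4 0.
apply: (definable_exR hD); apply: (definable_and hD).
  by apply: (definable_lt hD); [exact: polyfun_cst|exact: r1 0].
apply: (@definable_exR _ _ hD E1 (fun w q => forall z t, 0 < t /\
    ((0 < rsubmx w 0 0 /\ `|z - alpha (lsubmx w)| < rsubmx w 0 0) /\
     (0 < rsubmx w 0 0 /\ `|z + t *: v - alpha (lsubmx w)| < rsubmx w 0 0)) ->
  [/\ A z, A (z + t *: v) & dot u (f (z + t *: v)) - dot u (f z) <= (q + e (lsubmx w)) * t] /\
  [/\ A z, A (z + t *: v) & dot (- u) (f (z + t *: v)) - dot (- u) (f z) <= - q * t])).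
apply: (@definable_all _ _ hD E2 n (fun w z => forall t, 0 < t /\
    ((0 < rsubmx (lsubmx w) 0 0 /\ `|z - alpha (lsubmx (lsubmx w))| < rsubmx (lsubmx w) 0 0) /\
     (0 < rsubmx (lsubmx w) 0 0 /\ `|z + t *: v - alpha (lsubmx (lsubmx w))| < rsubmx (lsubmx w) 0 0)) ->
  [/\ A z, A (z + t *: v) & dot u (f (z + t *: v)) - dot u (f z) <= (rsubmx w 0 0 + e (lsubmx (lsubmx w))) * t] /\
  [/\ A z, A (z + t *: v) & dot (- u) (f (z + t *: v)) - dot (- u) (f z) <= - rsubmx w 0 0 * t])).
apply: (@definable_allR _ _ hD E3 (fun w t => 0 < t /\
    ((0 < rsubmx (lsubmx (lsubmx w)) 0 0 /\ `|rsubmx w - alpha (lsubmx (lsubmx (lsubmx w)))| < rsubmx (lsubmx (lsubmx w)) 0 0) /\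
     (0 < rsubmx (lsubmx (lsubmx w)) 0 0 /\ `|rsubmx w + t *: v - alpha (lsubmx (lsubmx (lsubmx w)))| < rsubmx (lsubmx (lsubmx w)) 0 0)) ->
  [/\ A (rsubmx w), A (rsubmx w + t *: v) & dot u (f (rsubmx w + t *: v)) - dot u (f (rsubmx w)) <= (rsubmx (lsubmx w) 0 0 + e (lsubmx (lsubmx (lsubmx w)))) * t] /\
  [/\ A (rsubmx w), A (rsubmx w + t *: v) & dot (- u) (f (rsubmx w + t *: v)) - dot (- u) (f (rsubmx w)) <= - rsubmx (lsubmx w) 0 0 * t])).
have pzt : polymap (fun w : 'rV[R]_E4 => rsubmx (lsubmx w) + rsubmx w 0 0 *: v).
  by apply: polymap_add pz _; apply: polymap_scale pt _; exact: polymap_cst.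
apply: (definable_imp hD).
  apply: (definable_and hD); first by apply: (definable_lt hD) => //; exact: polyfun_cst.
  by apply: (definable_and hD); exact: (definable_ball hD).
apply: (definable_and hD).
  apply: (definable_increment hD f_definable u pz pzt).
  by apply: polyfun_mul pt; exact: polyfun_add.
apply: (definable_increment hD f_definable (- u) pz pzt).
by apply: polyfun_mul pt; exact: polyfun_opp.
Qed.

Lemma slopes_oscillate_le u v e e' x : e <= e' -> slopes_oscillate u v e x -> slopes_oscillate u v e' x.
Proof.
move=> ee' [d [d0 [q h]]]; exists d; split=> //; exists q => z t zt.
have [[h1 h2 h3] h4] := h z t zt; split=> //; split=> //.
by apply: le_trans h3 _; rewrite ler_wpM2r ?lerD2l //; move: zt => [/ltW].
Qed.

(** Baire's theorem on the good set and the sets where oscillation at most [1 / (k + 1)] fails. The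
    latter contain no open set, by [slopes_locally]. *)
Lemma slopes_regular u v (U : set 'rV[R]_n) : open_ne U -> U `<=` Omega ->
  exists V, [/\ open_ne V, V `<=` U & forall x, V x -> forall e, 0 < e -> slopes_oscillate u v e x].
Proof.
move=> oU UO.
pose E i : set 'rV[R]_n := if i is k.+1 then [set x | ~ slopes_oscillate u v (k.+1%:R^-1) x]
  else [set x | forall e, 0 < e -> slopes_oscillate u v e x].
have DE i : D (E i).
  case: i => [|k]; last first.
    apply: (definable_not hD); apply: definable_slopes_oscillate; first exact: polyfun_cst.
    exact: polymap_id.
  have pr := @polymap_rsubmx R n 1 0.
  apply: (definable_allR hD); apply: (definable_imp hD).
    by apply: (definable_lt hD) => //; exact: polyfun_cst.
  apply: definable_slopes_oscillate => //.
  exact: polymap_lsubmx.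
have UE : U `<=` \bigcup_i E i.
  move=> x _; have [|/existsNP[e /not_implyP[e0 ne]]] := pselect (forall e, 0 < e -> slopes_oscillate u v e x).
    by exists 0%N.
  exists (Num.bound e^-1).+1 => // h; apply: ne; apply: slopes_oscillate_le h.
  rewrite invf_ple ?posrE //; apply: ltW; apply: (lt_trans (archi_boundP _)).
    by rewrite invr_ge0 ltW.
  by rewrite ltr_nat.
have [[|k] [V [oV VU VE]]] := definable_baire hD DE oU UE; first by exists V.
exfalso; have k0 : 0 < k.+1%:R^-1 :> R by rewrite invr_gt0 ltr0n.
have [q [a [r [r0 aV slopes]]]] := slopes_locally hD Omega_open f_continuous f_definable u v oV (subset_trans VU UO) k0.
have Va : V a by apply: aV; rewrite /norm_ball /= subrr normr0.
apply: (VE a Va); exists r; split=> //; exists q => z t [t0 [[_ za] [_ zta]]].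
have /andP[h1 h2] := slopes z t za t0 zta.
have Az : A z by apply/subset_closure/UO/VU/aV.
have Azt : A (z + t *: v) by apply/subset_closure/UO/VU/aV.
split; split=> //; rewrite ![dot (- u) _]dotC !dotNr -!(dotC u) mulNr.
by rewrite opprK; lra.
Qed.

Lemma slopes_regular_seq (s : seq ('rV[R]_n * 'rV[R]_n)) (U : set 'rV[R]_n) : open_ne U -> U `<=` Omega ->
  exists V, [/\ open_ne V, V `<=` U & forall x, V x -> forall uv, uv \in s ->
    forall e, 0 < e -> slopes_oscillate uv.1 uv.2 e x].
Proof.
elim: s U => [|[u v] s IH] U oU UO; first by exists U; split.
have [V [oV VU VP]] := IH U oU UO.
have [V' [oV' V'V V'P]] := slopes_regular u v oV (subset_trans VU UO).
exists V'; split=> //; first exact: subset_trans VU.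
move=> x V'x uv; rewrite inE => /orP[/eqP ->|uvs] e e0; first exact: V'P.
exact: VP (V'V _ V'x) _ uvs _ e0.
Qed.

Lemma slope_limit u v x : (forall e, 0 < e -> slopes_oscillate u v e x) ->
  exists J, forall e, 0 < e -> exists2 d, 0 < d & forall z t, 0 < t -> `|z - x| < d -> `|z + t *: v - x| < d ->
    `|dot u (f (z + t *: v)) - dot u (f z) - J * t| <= e * t.
Proof.
move=> osc.
have /choice[dq dqP] : forall e : R, exists dq : R * R, 0 < e -> 0 < dq.1 /\ forall z t, 0 < t ->
    `|z - x| < dq.1 -> `|z + t *: v - x| < dq.1 ->
    dq.2 * t <= dot u (f (z + t *: v)) - dot u (f z) <= (dq.2 + e) * t.
  move=> e; have [e0|ne] := pselect (0 < e); last by exists (0, 0).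
  have [d [d0 [q h]]] := osc e e0; exists (d, q) => _ /=; split=> // z t t0 zx ztx.
  have [[_ _ h1] [_ _ h2]] := h z t (conj t0 (conj (conj d0 zx) (conj d0 ztx))).
  by move: h2; rewrite ![dot (- u) _]dotC !dotNr -!(dotC u) mulNr => h2; apply/andP; split; lra.
(* Both estimates are applied to one small increment starting at [x], so the slopes for different
   [e] are compatible and their supremum is the limit. *)
have cross e e' : 0 < e -> 0 < e' -> (dq e).2 <= (dq e').2 + e'.
  move=> e0 e'0; have [d0 h] := dqP e e0; have [d'0 h'] := dqP e' e'0.
  pose m := Num.min (dq e).1 (dq e').1; have m0 : 0 < m by rewrite lt_min d0.
  have v0 : 0 < `|v| + 1 by rewrite ltr_wpDl.
  pose t := m / 2 / (`|v| + 1); have t0 : 0 < t by rewrite /t !divr_gt0.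
  have tm : `|x + t *: v - x| < m.
    rewrite addrAC subrr add0r normrZ gtr0_norm //.
    apply: (@le_lt_trans _ _ (t * (`|v| + 1))); first by rewrite ler_pM2l // lerDl.
    by rewrite /t divfK ?gt_eqF // ltr_pdivrMr // ltr_pMr // ltr1n.
  have xx (d : R) : 0 < d -> `|x - x| < d by rewrite subrr normr0.
  have md : m <= (dq e).1 by rewrite ge_min lexx.
  have md' : m <= (dq e').1 by rewrite ge_min lexx orbT.
  have /andP[h1 _] := h x t t0 (xx _ d0) (lt_le_trans tm md).
  have /andP[_ h2] := h' x t t0 (xx _ d'0) (lt_le_trans tm md').
  by rewrite -(ler_pM2r t0); exact: le_trans h1 h2.
pose S := [set (dq e).2 | e in [set e | 0 < e]].
have ubS e : 0 < e -> ubound S ((dq e).2 + e) by move=> e0 _ [e' e'0 <-]; exact: cross.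
have supS : has_sup S by split; [exists (dq 1).2; exists 1 => //=|exists ((dq 1).2 + 1); exact: ubS].
exists (sup S) => e e0; have [d0 h] := dqP e e0; exists (dq e).1 => // z t t0 zx ztx.
have /andP[h1 h2] := h z t t0 zx ztx.
have q1 : (dq e).2 <= sup S by apply: ub_le_sup; [exact: supS.2|exists e].
have q2 : sup S <= (dq e).2 + e by apply: ge_sup; [exact: supS.1|exact: ubS].
have q1t : (dq e).2 * t <= sup S * t by rewrite ler_pM2r.
have q2t : sup S * t <= ((dq e).2 + e) * t by rewrite ler_pM2r.
rewrite ler_norml; apply/andP; split; move: h1 h2 q1t q2t; rewrite mulrDl; lra.
Qed.

(** Both endpoints vary, which is stronger than differentiability at [x] and forces continuity of
    the derivative in [strict_C1]. *)
Definition strictly_differentiable x J := forall e, 0 < e -> exists2 d, 0 < d &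
  forall z w, `|z - x| < d -> `|w - x| < d -> `|f w - f z - (w - z) *m J| <= e * `|w - z|.

Lemma strict_of_slopes x :
  (forall (i j : 'I_n) e, 0 < e -> slopes_oscillate (delta_mx 0 j) (delta_mx 0 i) e x) ->
  exists J, strictly_differentiable x J.
Proof.
move=> osc.
have /choice[J JP] : forall ij : 'I_n * 'I_n, exists J, forall e, 0 < e -> exists2 d, 0 < d & forall z t, 0 < t ->
    `|z - x| < d -> `|z + t *: delta_mx 0 ij.1 - x| < d ->
    `|f (z + t *: delta_mx 0 ij.1) 0 ij.2 - f z 0 ij.2 - J * t| <= e * t.
  move=> [i j]; have [J JP] := slope_limit (osc i j); exists J => e /JP[d d0 dP]; exists d => // z t t0 zx ztx.
  by have := dP z t t0 zx ztx; rewrite !dot_delta.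
exists (\matrix_(i, j) J (i, j)) => e e0.
pose e1 := e / n.+1%:R; have n0 : 0 < n.+1%:R :> R by rewrite ltr0n.
have e10 : 0 < e1 by rewrite divr_gt0.
have [d d0 dP] : exists2 d, 0 < d & forall d', 0 < d' -> d' <= d -> forall ij : 'I_n * 'I_n, ij \in enum predT ->
    forall z t, `|z - x| < d' -> `|z + t *: delta_mx 0 ij.1 - x| < d' ->
    `|f (z + t *: delta_mx 0 ij.1) 0 ij.2 - f z 0 ij.2 - J ij * t| <= e1 * `|t|.
  apply: (@pos_min_seq R _ (enum predT) (fun (ij : 'I_n * 'I_n) d' => forall z t, `|z - x| < d' ->
    `|z + t *: delta_mx 0 ij.1 - x| < d' -> `|f (z + t *: delta_mx 0 ij.1) 0 ij.2 - f z 0 ij.2 - J ij * t| <= e1 * `|t|)).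
  move=> ij _; have [d d0 dP] := JP ij e1 e10; exists d => // d' d'0 d'd z t zx ztx.
  have {}zx := lt_le_trans zx d'd; have {}ztx := lt_le_trans ztx d'd.
  have [->|tN0] := eqVneq t 0.
    by rewrite scale0r addr0 subrr mulr0 subr0 normr0 mulr0.
  have [t0|t0] := ltP 0 t; first by rewrite (gtr0_norm t0); exact: dP.
  (* A backward increment is a forward one from the other endpoint, which is why slopes are
     controlled at moving base points. *)
  have tn : t < 0 by rewrite lt_neqAle tN0.
  have := dP (z + t *: delta_mx 0 ij.1) (- t); rewrite oppr_gt0 => /(_ tn ztx).
  rewrite scaleNr addrK => /(_ zx); rewrite (ltr0_norm tn).
  by rewrite -normrN; congr (`|_| <= _); ring.
exists d => // z w zx wx.
(* From [z] to [w] changing one coordinate at a time; in the sup norm the path stays in the ball. *)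
pose path (k : nat) : 'rV[R]_n := \row_j (if (j < k)%N then w 0 j else z 0 j).
have path_near k : `|path k - x| < d.
  apply: norm_lt_coord => // j; rewrite !mxE; case: ifP => _.
    by have := le_lt_trans (coord_le_norm (w - x) j) wx; rewrite !mxE.
  by have := le_lt_trans (coord_le_norm (z - x) j) zx; rewrite !mxE.
have path0 : path 0%N = z by apply/rowP => j; rewrite mxE.
have pathn : path n = w by apply/rowP => j; rewrite mxE ltn_ord.
have pathS (i : 'I_n) : path i.+1 = path i + (w - z) 0 i *: delta_mx 0 i.
  apply/rowP => j; rewrite !mxE ltnS leq_eqVlt eqxx /=.
  have [->|ji] := eqVneq j i; first by rewrite eqxx ltnn mulr1 addrCA subrr addr0.
  have -> : (j == i :> nat) = false by apply: contra_neqF ji => /eqP/val_inj.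
  by rewrite /= mulr0 addr0.
apply: norm_le_coord => [|j]; first by rewrite mulr_ge0 // ltW.
have -> : (f w - f z - (w - z) *m \matrix_(i, j) J (i, j)) 0 j =
    \sum_(i < n) (f (path i + (w - z) 0 i *: delta_mx 0 i) 0 j - f (path i) 0 j - J (i, j) * (w - z) 0 i).
  rewrite sumrB (eq_bigr (fun i : 'I_n => f (path i.+1) 0 j - f (path i) 0 j)) => [|i _]; last by rewrite pathS.
  rewrite -(big_mkord xpredT (fun i => f (path i.+1) 0 j - f (path i) 0 j)) telescope_sumr // path0 pathn.
  rewrite mxE [(- (_ *m _)) 0 j]mxE; congr (_ + _); first by rewrite !mxE.
  by congr (- _); rewrite mxE; apply: eq_bigr => i _; rewrite [X in _ * X]mxE mulrC.
apply: le_trans (ler_norm_sum _ _ _) _.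
apply: (@le_trans _ _ (\sum_(i < n) e1 * `|w - z|)).
  apply: ler_sum => i _.
  apply: (le_trans (dP d d0 (lexx d) (i, j) (mem_enum _ _) (path i) ((w - z) 0 i) (path_near i) _)).
    by rewrite /= -pathS.
  by rewrite ler_pM2l // coord_le_norm.
rewrite sumr_const card_ord -mulrnAl ler_wpM2r // /e1 -mulr_natr mulrAC ler_pdivrMr // ler_pM2l //.
by rewrite ler_nat.
Qed.

Lemma strict_differentiable x J : strictly_differentiable x J ->
  differentiable f x /\ jacobian f x = J.
Proof.
move=> sJ; apply: remainder_differentiable => e /sJ[d d0 dP]; exists d => // z zx.
by apply: dP => //; rewrite subrr normr0.
Qed.

Lemma slope_matrices_close (g v : 'rV[R]_n) (t e : R) (i j : 'I_n) (J J' : 'M[R]_n) : 0 < t ->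
  v = t *: delta_mx 0 i -> `|g - v *m J| <= e * t -> `|g - v *m J'| <= e * t ->
  `|J' i j - J i j| <= 2 * e.
Proof.
move=> t0 vE b1 b2.
have vK (K : 'M[R]_n) : (v *m K) 0 j = t * K i j.
  by rewrite vE -scalemxAl mxE -rowE mxE.
have := le_trans (coord_le_norm _ j) b1; have := le_trans (coord_le_norm _ j) b2.
rewrite [(g - v *m J) 0 j]mxE [(g - v *m J') 0 j]mxE.
rewrite [(- (v *m J)) 0 j]mxE [(- (v *m J')) 0 j]mxE !vK.
move: (J i j) (J' i j) (g 0 j) => p q r h1 h2.
rewrite -(ler_pM2l t0) -[in leLHS](gtr0_norm t0) -normrM.
have -> : t * (q - p) = (r - t * p) - (r - t * q) by ring.
have -> : t * (2 * e) = e * t + e * t by ring.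
by apply: le_trans (ler_normB _ _) _; exact: lerD.
Qed.

(** One small increment based at [x'] is approximated by the derivative at [x] and by that at [x'],
    so the two matrices are close. *)
Lemma strict_C1 (V : set 'rV[R]_n) : open V -> (forall x, V x -> exists J, strictly_differentiable x J) ->
  Ck 1 V f.
Proof.
move=> oV sV.
have sJ x : V x -> strictly_differentiable x (jacobian f x).
  by move=> /sV[J JP]; have [_ ->] := strict_differentiable JP.
have dV x : V x -> differentiable f x by move=> /sV[J /strict_differentiable[]].
split=> // v x Vx; apply: continuous_normP => e e0.
pose c := \sum_i `|v 0 i| + 1; have c0 : 0 < c by rewrite ltr_wpDl // sumr_ge0.
have e1 : 0 < e / c / 4 by rewrite !divr_gt0.
have [d d0 dP] := sJ x Vx _ e1.
have [r r0 rV] := open_ballP oV Vx.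
exists (Num.min (d / 2) r); first by rewrite lt_min r0 divr_gt0.
move=> x'; rewrite lt_min => /andP[x'd /rV Vx'].
rewrite !deriveEjacobian //; try exact: dV.
have [d' d'0 d'P] := sJ x' Vx' _ e1.
have entry i j : `|jacobian f x' i j - jacobian f x i j| <= e / c / 2.
  pose t := Num.min (d / 2) d' / 2.
  have m0 : 0 < Num.min (d / 2) d' by rewrite lt_min d'0 divr_gt0.
  have t0 : 0 < t by rewrite divr_gt0.
  have tm : t < Num.min (d / 2) d' by rewrite /t; lra.
  have := tm; rewrite lt_min => /andP[td td'].
  have nd : `|t *: delta_mx 0 i : 'rV[R]_n| <= t.
    apply: norm_le_coord => [|k]; first exact: ltW.
    by rewrite !mxE eqxx /=; case: eqP => _; rewrite ?mulr1 ?mulr0 ?normr0 ?(ltW t0) // gtr0_norm.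
  pose w := x' + t *: delta_mx 0 i.
  have wx' : w - x' = t *: delta_mx 0 i by rewrite /w addrAC subrr add0r.
  have b1 : `|f w - f x' - (w - x') *m jacobian f x| <= e / c / 4 * t.
    apply: (le_trans (dP x' w _ _)); last by rewrite wx' ler_pM2l.
      by apply: lt_trans x'd _; lra.
    rewrite -(subrKA x') wx' (le_lt_trans (ler_normD _ _)) // (splitr d) ltrD //.
    exact: le_lt_trans td.
  have b2 : `|f w - f x' - (w - x') *m jacobian f x'| <= e / c / 4 * t.
    apply: (le_trans (d'P x' w _ _)); last by rewrite wx' ler_pM2l.
      by rewrite subrr normr0.
    by rewrite wx'; exact: le_lt_trans td'.
  have -> : e / c / 2 = 2 * (e / c / 4) by field; rewrite gt_eqF.
  exact: slope_matrices_close t0 wx' b1 b2.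
rewrite -mulmxBr.
have e2 : 0 < e / c / 2 by rewrite !divr_gt0.
apply: (@le_lt_trans _ _ ((\sum_i `|v 0 i|) * (e / c / 2))).
  apply: norm_le_coord => [|j]; first by rewrite mulr_ge0 ?sumr_ge0 // ltW.
  rewrite mxE mulr_suml; apply: le_trans (ler_norm_sum _ _ _) _; apply: ler_sum => i _.
  by rewrite normrM ler_wpM2l // [X in `|X|]mxE [X in _ + X]mxE.
apply: (@le_lt_trans _ _ (c * (e / c / 2))); first by rewrite ler_wpM2r ?lerDl // ltW.
have -> : c * (e / c / 2) = e / 2 by field; rewrite gt_eqF.
lra.
Qed.

Lemma singular_locus_thin (U : set 'rV[R]_n) : open_ne U -> U `<=` Omega ->
  exists x, U x /\ (Omega `\` singular_locus Omega f) x.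
Proof.
move=> oU UO.
have [V [[oV [x Vx]] VU VP]] := slopes_regular_seq [seq (delta_mx 0 ij.2, delta_mx 0 ij.1) | ij <- enum {: 'I_n * 'I_n}] oU UO.
exists x; split; first exact: VU.
split; first exact/UO/VU.
move=> [_]; apply; exists V; split=> //; first exact: subset_trans VU UO.
apply: strict_C1 => // z Vz; apply: strict_of_slopes => i j e e0.
apply: (VP z Vz (delta_mx 0 j, delta_mx 0 i)) => //.
by apply/mapP; exists (i, j); rewrite ?mem_enum.
Qed.

End GenericC1.

(** * Regular points *)

Section Convexity.
Variable R : realType.

Lemma convex_hull_convex (V : lmodType R) (S : set V) x y t :
  convex_hull S x -> convex_hull S y -> 0 <= t <= 1 -> convex_hull S ((1 - t) *: x + t *: y).
Proof.
move=> [k [w [p [w0 w1 pS ->]]]] [l [w' [p' [w'0 w'1 p'S ->]]]] /andP[t0 t1].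
exists (k + l)%N, (fun i : 'I_(k + l) => match fintype.split i with inl j => (1 - t) * w j | inr j => t * w' j end),
  (fun i : 'I_(k + l) => match fintype.split i with inl j => p j | inr j => p' j end); split.
- by move=> i; case: (fintype.split i) => j; rewrite mulr_ge0 // subr_ge0.
- rewrite big_split_ord /= (eq_bigr (fun i => (1 - t) * w i)) => [|i _]; last by rewrite (unsplitK (inl _ i)).
  rewrite [X in _ + X](eq_bigr (fun i => t * w' i)) => [|i _]; last by rewrite (unsplitK (inr _ i)).
  by rewrite -!mulr_sumr w1 w'1; ring.
- by move=> i; case: (fintype.split i).
- rewrite big_split_ord /= !scaler_sumr; congr (_ + _); apply: eq_bigr => i _.
    by rewrite (unsplitK (inl _ i)) scalerA.
  by rewrite (unsplitK (inr _ i)) scalerA.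
Qed.

Lemma sub_convex_hull (V : lmodType R) (S : set V) x : S x -> convex_hull S x.
Proof.
move=> Sx; exists 1%N, (fun=> 1), (fun=> x); split=> //.
- by rewrite big_ord1.
- by rewrite big_ord1 scale1r.
Qed.

Lemma convex_hull_sub (V : lmodType R) (S T : set V) : S `<=` T -> convex_hull S `<=` convex_hull T.
Proof.
by move=> ST x [k [w [p [h1 h2 h3 h4]]]]; exists k, w, p; split=> // i; exact: ST.
Qed.

Variable n : nat.

(** Along the segment the determinant is a polynomial in [t] without root, so the intermediate value
    theorem excludes a change of sign. *)
Lemma det_sign_segment (A B : 'M[R]_n) :
  (forall t, 0 <= t <= 1 -> \det ((1 - t) *: A + t *: B) != 0) -> sgz (\det A) = sgz (\det B).
Proof.
move=> inv.
pose P : 'M[{poly R}]_n := \matrix_(i, j) ((1 - 'X) * (A i j)%:P + 'X * (B i j)%:P).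
have PE t : (\det P).[t] = \det ((1 - t) *: A + t *: B).
  rewrite -[LHS]/(horner_eval t (\det P)) -det_map_mx; congr (\det _).
  apply/matrixP => i j; rewrite !mxE.
  by rewrite -[LHS]/(((1 - 'X) * (A i j)%:P + 'X * (B i j)%:P).[t]) !hornerE.
have P0 : (\det P).[0] = \det A by rewrite PE subr0 scale1r scale0r addr0.
have P1 : (\det P).[1] = \det B by rewrite PE subrr scale0r scale1r add0r.
have nr x : 0 <= x <= 1 -> ~~ root (\det P) x by move=> x01; rewrite /root PE; exact: inv.
have dA : \det A != 0 by rewrite -P0; apply: nr; rewrite lexx ler01.
have dB : \det B != 0 by rewrite -P1; apply: nr; rewrite lexx ler01.
have [Ap|An|A0] := ltrgt0P (\det A); last by rewrite A0 eqxx in dA.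
- have [Bp|Bn|B0] := ltrgt0P (\det B); last by rewrite B0 eqxx in dB.
    by rewrite !gtr0_sgz.
  have [|x x01] := @poly_ivt R (- \det P) 0 1 ler01.
    by rewrite !hornerN P0 P1 oppr_le0 oppr_ge0 (ltW Ap) (ltW Bn).
  by rewrite rootN => rx; have := nr x x01; rewrite rx.
- have [Bp|Bn|B0] := ltrgt0P (\det B); last by rewrite B0 eqxx in dB.
    have [|x x01 rx] := @poly_ivt R (\det P) 0 1 ler01.
      by rewrite P0 P1 (ltW An) (ltW Bp).
    by have := nr x x01; rewrite rx.
  by rewrite !ltr0_sgz.
Qed.

Lemma dot_self_continuous : continuous (fun x : 'rV[R]_n => dot x x).
Proof.
apply: (@continuous_big _ _ +%R 0 _ _ _ _ (fun i (x : 'rV[R]_n) => x 0 i * x 0 i)) => [|i _ x].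
  exact: add_continuous.
apply: (@continuousM _ _ (fun x : 'rV[R]_n => x 0 i) (fun x : 'rV[R]_n => x 0 i)); exact: coord_continuous.
Qed.

(* The minimal norm point [u] of the closure of [K] separates [K] from [0]. *)
Lemma convex_separation (K : set 'rV[R]_n) k : K !=set0 ->
  (forall x y t, K x -> K y -> 0 <= t <= 1 -> K ((1 - t) *: x + t *: y)) ->
  0 < k -> (forall x, K x -> k <= enorm x) ->
  exists u d, 0 < d /\ forall x, K x -> d <= dot u x.
Proof.
move=> [k0 Kk0] convK kp Kk.
(* A minimiser over this compact part is one over the whole closure, since [k0] beats every point
   outside. *)
pose C := closure K `&` [set w | `|w| <= enorm k0].
have cC : compact C.
  apply: bounded_closed_compact.
    exists (enorm k0); split; first exact: num_real.
    by move=> M LM x [_ xL]; exact: le_trans (ltW LM).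
  apply: closedI; first exact: closed_closure.
  move=> x clx /=; apply/ler_addgt0Pr => e e0.
  have [y [yL xy]] := clx _ (nbhsx_ballx x e e0).
  rewrite -[x](subrK y) (le_trans (ler_normD _ _)) // addrC lerD //.
  by move: xy; rewrite mx_norm_ball /ball_ /= => /ltW.
have Ck0 : C k0 by split; [exact: subset_closure|exact: norm_le_enorm].
have [|w0 /set_mem[clw0 w0L] w0min] := @compact_EVT_min _ _ (fun x : 'rV[R]_n => dot x x) C (ex_intro _ k0 Ck0) cC.
  exact/continuous_subspaceT/dot_self_continuous.
have {}w0min w : closure K w -> dot w0 w0 <= dot w w.
  move=> clw; have [wL|wL] := leP `|w| (enorm k0); first by apply: w0min; exact/mem_set.
  apply: (@le_trans _ _ (dot k0 k0)); first by apply: w0min; exact/mem_set.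
  rewrite -!sqr_enorm ler_pXn2r ?nnegrE ?enorm_ge0 //.
  by apply: ltW; apply: lt_le_trans wL (norm_le_enorm w).
have clconv w t : K w -> 0 <= t <= 1 -> closure K ((1 - t) *: w0 + t *: w).
  move=> Kw t01 B /nbhs_ballP[e /= e0 eB].
  have [k' [Kk' w0k']] := clw0 _ (nbhsx_ballx w0 e e0).
  exists ((1 - t) *: k' + t *: w); split; first exact: convK.
  apply: eB; move: w0k'; rewrite mx_norm_ball /ball_ /= => w0k'.
  rewrite opprD addrACA subrr addr0 -scalerBr normrZ; apply: le_lt_trans w0k'.
  move: t01 => /andP[t0 t1]; rewrite ler_piMl // ger0_norm ?subr_ge0 // lerBlDr lerDl //.
have w0N0 : w0 != 0.
  apply/eqP => w00; have e0 : 0 < k / n.+1%:R by rewrite divr_gt0 // ltr0n.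
  have [k' [Kk' w0k']] := clw0 _ (nbhsx_ballx w0 _ e0).
  move: w0k'; rewrite mx_norm_ball /ball_ /= w00 sub0r normrN ltr_pdivlMr ?ltr0n // mulrC.
  by move=> /(le_lt_trans (enorm_le_norm k')) /(le_lt_trans (Kk _ Kk')); rewrite ltxx.
exists w0, (dot w0 w0); split; first exact: dot_gt0.
move=> w Kw; rewrite -subr_ge0 -dotBr leNgt; apply/negP => neg.
pose a := dot w0 (w - w0); pose b := dot (w - w0) (w - w0).
have b0 : 0 <= b by exact: dot_ge0.
(* Moving from [w0] by [t] towards [w] changes the squared norm by [2 * t * a + t ^ 2 * b], which is
   negative for this [t]. *)
pose t := Num.min 1 (- a / (b + 1)).
have bp : 0 < b + 1 by rewrite ltr_wpDl.
have t0 : 0 < t by rewrite lt_min ltr01 divr_gt0 // oppr_gt0.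
have t1 : t <= 1 by rewrite ge_min lexx.
have tb : t * (b + 1) <= - a by rewrite -ler_pdivlMr // ge_min lexx orbT.
have := w0min _ (clconv w t Kw (ltac:(by rewrite (ltW t0) t1))).
have -> : (1 - t) *: w0 + t *: w = w0 + t *: (w - w0) by apply/rowP => j; rewrite !mxE; ring.
rewrite dotDr dotZr ![dot (w0 + _) _]dotC !dotDr !dotZr (dotC _ w0) -/a -/b.
have neg' : a < 0 by exact: neg.
nra.
Qed.

End Convexity.

(** * Expansion near a regular point *)

Section RegularPoints.
Variables (R : realType) (D : forall n : nat, set (set 'rV[R]_n)).
Arguments D {n}.
Hypothesis hD : ominimal (@D).
Variables (n : nat) (Omega : set 'rV[R]_n) (f : 'rV[R]_n -> 'rV[R]_n).
Hypothesis Omega_open : open Omega.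
Hypothesis f_continuous : {within closure Omega, continuous f}.
Hypothesis f_definable : definable_map (@D) (closure Omega) f.

Lemma enormZ t (v : 'rV[R]_n) : enorm (t *: v) = `|t| * enorm v.
Proof.
by rewrite !enormE dotZr dotC dotZr mulrA -expr2 sqrtrM ?sqr_ge0 // sqrtr_sqr.
Qed.

Lemma enorm_gt0 (v : 'rV[R]_n) : v != 0 -> 0 < enorm v.
Proof. by move=> v0; rewrite enormE sqrtr_gt0 dot_gt0. Qed.

Lemma enormD (v w : 'rV[R]_n) : enorm (v + w) <= enorm v + enorm w.
Proof.
rewrite -(ler_pXn2r (n := 2)) ?nnegrE ?addr_ge0 ?enorm_ge0 // sqr_enorm.
rewrite dotDr ![dot (v + w) _]dotC !dotDr sqrrD !sqr_enorm (dotC w v).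
have := le_trans (ler_norm _) (dot_le_enorm v w); rewrite -mulr_natr; lra.
Qed.

Definition uniformly_regular x r := 0 < r /\ exists2 c, 0 < c &
  (forall z, eball x r z -> Omega z) /\
  forall M, convex_hull (dimage Omega f (eball x r)) M -> forall v, c * enorm v <= enorm (v *m M).

(** If the infimum vanished for every radius, the limit [nu] would be that of a constant zero
    function. *)
Lemma regular_point_uniform x : regular_point Omega f x -> exists r, uniformly_regular x r.
Proof.
move=> [Ox nux].
pose g (r : R) := ereal_inf [set sigma A | A in convex_hull (dimage Omega f (eball x r))].
have g0 r : (0 <= g r)%E.
  apply: le_ereal_inf_tmp => _ [M _ <-]; apply: le_ereal_inf_tmp => _ [v _ <-].
  by rewrite lee_fin enorm_ge0.
have [[r [r0 gr]]|no] := pselect (exists r, 0 < r /\ (0 < g r)%E); last first.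
  move: nux; rewrite /nu -/g.
  suff -> : lim (g r @[r --> 0^'+]) = 0%E by rewrite ltxx.
  apply/cvg_lim => //; apply: cvg_near_cst.
  near=> r; apply/eqP; rewrite eq_le g0 andbT leNgt; apply/negP => gr.
  by apply: no; exists r; split=> //; near: r; exact: nbhs_right_gt.
have [d d0 dO] := open_ballP Omega_open Ox.
(* The infimum may be infinite, for instance in dimension [0] where no vector has norm [1]; any
   constant then serves. *)
have [c c0 cg] : exists2 c, 0 < c & (c%:E <= g r)%E.
  case: (g r) gr => [s|_|//]; first by rewrite lte_fin => s0; exists s.
  by exists 1; rewrite ?leey.
exists (Num.min r d); split; first by rewrite lt_min r0.
exists c => //; split.
  move=> z; rewrite /eball /= lt_min => /andP[_ zd]; apply: dO.
  exact: le_lt_trans (norm_le_enorm _) zd.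
move=> M hM v; have [->|v0] := eqVneq v 0.
  by rewrite mul0mx enormE dot0r sqrtr0 mulr0.
have hM' : convex_hull (dimage Omega f (eball x r)) M.
  apply: convex_hull_sub hM => _ [z [[zB zO] <-]]; exists z => //; split=> //.
  by move: zB; rewrite /eball /= lt_min => /andP[].
have vp := enorm_gt0 v0.
have /(le_trans cg) : (g r <= sigma M)%E by apply: ereal_inf_lbound; exists M.
have h : (sigma M <= (enorm (((enorm v)^-1 *: v) *m M))%:E)%E.
  apply: ereal_inf_lbound; exists ((enorm v)^-1 *: v) => //=.
  by rewrite enormZ ger0_norm ?invr_ge0 ?enorm_ge0 // mulVf // gt_eqF.
move=> /le_trans /(_ h); rewrite lee_fin -scalemxAl enormZ ger0_norm ?invr_ge0 ?enorm_ge0 //.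
by rewrite mulrC ler_pdivlMr.
Unshelve. all: by end_near. Qed.

Lemma nonsingular_differentiable z : (Omega `\` singular_locus Omega f) z -> differentiable f z.
Proof.
by move=> [Oz nz]; apply: contrapT => nd; apply: nz; split=> // -[U [_ Uz _ [dU _]]]; apply: nd; exact: dU.
Qed.

Lemma eball_open x r : open (eball x r : set 'rV[R]_n).
Proof.
apply: open_normP => z zx; have n0 : 0 < n.+1%:R :> R by rewrite ltr0n.
exists ((r - enorm (z - x)) / n.+1%:R); first by rewrite divr_gt0 // subr_gt0.
move=> w; rewrite ltr_pdivlMr // mulrC => wz; rewrite /eball /= -(subrKA z).
apply: le_lt_trans (enormD _ _) _; rewrite addrC -ltrBrDl.
exact: le_lt_trans (enorm_le_norm _) wz.
Qed.

Lemma eball_nonsingular x r : 0 < r -> (forall z, eball x r z -> Omega z) ->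
  exists z, eball x r z /\ (Omega `\` singular_locus Omega f) z.
Proof.
move=> r0 BO; apply: (singular_locus_thin hD Omega_open f_continuous f_definable) => //.
by split; [exact: eball_open|exists x; rewrite /eball /= subrr enormE dot0r sqrtr0].
Qed.

(* If [dot u \o f] did not increase from [x] to [x + v], then for all [a] near [x]
   it would have small slope somewhere, hence on an interval, between [a] and
   [a + v]; by Baire, it would have small slope on an open set. *)
Lemma uniformly_regular_expansive x r v : uniformly_regular x r -> v != 0 -> enorm v < r ->
  exists u, 0 < dot u (f (x + v) - f x) /\
    forall M, dimage Omega f (eball x r) M -> 0 < dot u (v *m M).
Proof.
move=> [r0 [c c0 [BO hull]]] v0 vr.
pose H := convex_hull (dimage Omega f (eball x r)).
have [z0 [Bz0 Oz0]] := eball_nonsingular r0 BO.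
have Hz0 : H (jacobian f z0) by apply: sub_convex_hull; exists z0.
have [|x1 y1 t [M HM <-] [M' HM' <-] t01||_ [M HM <-]|u [d [d0 dP]]] :=
    @convex_separation R n [set v *m M | M in H] (c * enorm v).
- by exists (v *m jacobian f z0); exists (jacobian f z0).
- exists ((1 - t) *: M + t *: M'); first exact: convex_hull_convex.
  by rewrite mulmxDr -!scalemxAr.
- by rewrite mulr_gt0 // enorm_gt0.
- exact: hull.
have dimP M : dimage Omega f (eball x r) M -> d <= dot u (v *m M).
  by move=> SM; apply: dP; exists M => //; exact: sub_convex_hull.
exists u; split; last by move=> M /dimP; exact: lt_le_trans.
(* A threshold halfway between the assumed increment, at most [0], and the slope at least [d]
   enjoyed by all derivatives. *)
pose k := d / 2; have k0 : 0 < k by rewrite divr_gt0.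
rewrite dotBr ltNge; apply/negP => le0.
have Ox : Omega x by apply: BO; rewrite /eball /= subrr enormE dot0r sqrtr0.
have n0 : 0 < n.+1%:R :> R by rewrite ltr0n.
have [cu cu0 cuP] := dot_bounded u.
have segB a t : enorm (a - x) < r - enorm v -> 0 <= t <= 1 -> eball x r (a + t *: v).
  move=> ax /andP[t0 t1]; rewrite /eball /= addrAC; apply: le_lt_trans (enormD _ _) _.
  rewrite enormZ ger0_norm //; have : t * enorm v <= enorm v by rewrite ler_piMl // enorm_ge0.
  by move: ax; lra.
have [U [oU UB Uk]] : exists U, [/\ open_ne U, forall a, U a -> enorm (a - x) < r - enorm v &
    forall a, U a -> dot u (f (a + v)) - dot u (f a) < k].
  have e0 : 0 < k / 2 / cu by rewrite !divr_gt0.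
  have Oxv : Omega (x + v).
    by apply: BO; rewrite /eball /= addrAC subrr add0r.
  have [d1 d10 d1P] := within_continuousP f_continuous (subset_closure Ox) e0.
  have [d2 d20 d2P] := within_continuousP f_continuous (subset_closure Oxv) e0.
  have rv0 : 0 < (r - enorm v) / n.+1%:R by rewrite divr_gt0 // subr_gt0.
  pose e := Num.min ((r - enorm v) / n.+1%:R) (Num.min d1 d2).
  have ep : 0 < e by rewrite !lt_min rv0 d10 d20.
  have near_a a : norm_ball x e a -> enorm (a - x) < r - enorm v.
    rewrite /norm_ball /= !lt_min => /andP[]; rewrite ltr_pdivlMr // mulrC => h _.
    exact: le_lt_trans (enorm_le_norm _) h.
  exists (norm_ball x e); split=> //.
    by split; [exact: norm_ball_open|exists x; rewrite /norm_ball /= subrr normr0].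
  move=> a aB; have := aB; rewrite /norm_ball /= !lt_min => /andP[_ /andP[a1 a2]].
  have Oa t : 0 <= t <= 1 -> closure Omega (a + t *: v).
    by move=> t01; apply/subset_closure/BO/segB => //; exact: near_a.
  have Oa0 : closure Omega a by have := Oa 0; rewrite scale0r addr0; apply; rewrite lexx ler01.
  have Oa1 : closure Omega (a + v) by have := Oa 1; rewrite scale1r; apply; rewrite lexx ler01.
  have b1 := d1P a Oa0 a1.
  have b2 : `|f (a + v) - f (x + v)| < k / 2 / cu.
    by apply: d2P => //; rewrite opprD addrACA subrr addr0.
  have du w : `|w| < k / 2 / cu -> `|dot u w| < k / 2.
    by rewrite ltr_pdivlMr // mulrC => /(le_lt_trans (cuP _)).
  have := du _ b1; have := du _ b2; rewrite !dotBr !ltr_norml => /andP[_ h2] /andP[h1 _].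
  by lra.
pose E (i : nat) : set 'rV[R]_n := if choice.unpickle i : option (rat * rat) is Some (p, q) then
  [set a | ratr p < ratr q :> R /\ forall t, (ratr p < t /\ t < ratr q) ->
    0 < t /\ (t < 1 /\ upper_slope Omega f u v k (a + t *: v))] else set0.
have pl := @polymap_lsubmx R n 1.
have pr := @polymap_rsubmx R n 1 0.
have DE i : D (E i).
  rewrite /E; case: (choice.unpickle i) => [[p q]|]; last exact: (ominimal_set0 hD).
  apply: (definable_and hD); first exact: (definable_cst hD).
  apply: (definable_allR hD); apply: (definable_imp hD).
    by apply: (definable_and hD); apply: (definable_lt hD) => //; exact: polyfun_cst.
  apply: (definable_and hD); first by apply: (definable_lt hD) => //; exact: polyfun_cst.
  apply: (definable_and hD); first by apply: (definable_lt hD) => //; exact: polyfun_cst.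
  apply: (definable_upper_slope hD f_definable); first exact: polyfun_cst.
  by apply: polymap_add pl _; apply: polymap_scale pr _; exact: polymap_cst.
have UE : U `<=` \bigcup_i E i.
  move=> a Ua.
  have DT : D [set t : 'rV[R]_1 | upper_slope Omega f u v k (a + t 0 0 *: v)].
    apply: (definable_upper_slope hD f_definable); first exact: polyfun_cst.
    apply: polymap_add; first exact: polymap_cst.
    by apply: polymap_scale; [exact: polyfun_coord|exact: polymap_cst].
  have [/rational_interval[p [q [pq pqP]]]|fin] := definable_line hD 0 1 DT.
    exists (choice.pickle (p, q)); first exact: I.
    rewrite /E choice.pickleK; split=> // t [pt tq].
    by have [/andP[h1 h2] /=] := pqP t pt tq; rewrite mxE.
  (* Were small slopes confined to finitely many [t], [lower_mean] would give an increment of at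
     least [k]. The endpoint [0] is added as the finite set concerns only the open interval. *)
  exfalso; have fin0 : finite_set ([set 0] `|` [set t | 0 < t < 1 /\
      [set t : 'rV[R]_1 | upper_slope Omega f u v k (a + t 0 0 *: v)] (const_mx t)]).
    by rewrite finite_setU.
  have := @lower_mean R n Omega f Omega_open f_continuous u v k a 1 _ ler01 _ fin0 _.
  rewrite scale1r mulr1 => h; have {}h : k <= dot u (f (a + v)) - dot u (f a).
    apply: h => [t t01|t /andP[t0 t1] nT up]; first by apply/BO/segB => //; exact: UB.
    apply: nT; have [->|tN0] := eqVneq t 0; [by left|right; split=> /=].
      by rewrite lt_neqAle eq_sym tN0 t0.
    by rewrite mxE.
  by have := Uk a Ua; rewrite ltNge h.
have [i [V [[oV [a0 Va0]] VU VE]]] := definable_baire hD DE oU UE.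
move: VE; rewrite /E; case: (choice.unpickle i) => [[p q]|] VE; last by have := VE a0 Va0.
have [pq _] := VE a0 Va0.
pose t0 : R := (ratr p + ratr q) / 2.
have pt : ratr p < t0 by rewrite /t0; lra.
have tq : t0 < ratr q by rewrite /t0; lra.
(* The translate of [V] by [t0 *: v], an open set all of whose points have upper slope [k]. It
   contains a point where [f] is differentiable, with slope at least [d] there. *)
pose W := [set z | V (z - t0 *: v)].
have WS z : W z -> upper_slope Omega f u v k z /\ eball x r z.
  move=> Wz; have [_ /(_ t0 (conj pt tq))[h1 [h2]]] := VE _ Wz.
  rewrite subrK => h3; split=> //; rewrite -[z](subrK (t0 *: v)); apply: segB.
    by apply: UB; exact: VU.
  by rewrite (ltW h1) (ltW h2).
have oW : open_ne W.
  split; last by exists (a0 + t0 *: v); rewrite /W /= addrK.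
  apply: open_normP => z Wz; have [e e0 eV] := open_ballP oV Wz; exists e => // w wz.
  by apply: eV; rewrite opprB addrA subrK.
have [z [Wz nz]] := singular_locus_thin hD Omega_open f_continuous f_definable oW (fun z Wz => BO z (WS z Wz).2).
have [[e [e0 eP]] Bz] := WS z Wz.
have dz := nonsingular_differentiable nz.
have dzM : d <= dot u (v *m jacobian f z) by apply: dimP; exists z.
have vn0 : 0 < `|v| by rewrite normr_gt0.
(* With this error the increment is at least [(d - d / 4) * t], contradicting the bound
   [d / 2 * t]. *)
have h0 : 0 < d / 4 / cu / `|v| by rewrite !divr_gt0.
have [e' e'0 e'P] := differentiable_remainder dz h0.
pose t := Num.min (e / 2) (e' / 2 / `|v|).
have tp : 0 < t by rewrite lt_min !divr_gt0.
have te : t < e.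
  by apply: (@le_lt_trans _ _ (e / 2)); [rewrite ge_min lexx|lra].
have te' : t * `|v| < e'.
  apply: (@le_lt_trans _ _ (e' / 2)); first by rewrite -ler_pdivlMr // ge_min lexx orbT.
  lra.
have [_ _ slope] := eP t (conj tp te).
have := e'P (z + t *: v); rewrite addrAC subrr add0r normrZ gtr0_norm // => /(_ te').
have -> : d / 4 / cu / `|v| * (t * `|v|) = d / 4 * t / cu by field; rewrite !gt_eqF.
rewrite ler_pdivlMr // => rem.
have : `|dot u (f (z + t *: v) - f z - t *: v *m jacobian f z)| <= d / 4 * t.
  by apply: le_trans (cuP _) _; rewrite mulrC.
rewrite !dotBr -scalemxAl dotZr ler_norml => /andP[h1 _].
have : t * d <= t * dot u (v *m jacobian f z) by rewrite ler_pM2l.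
move: slope h1; rewrite /k; have : 0 < d * t by rewrite mulr_gt0.
lra.
Qed.

End RegularPoints.

(** * The degree as a sum of signs *)

Section DegreeFormula.
Variables (R : realType) (D : forall n : nat, set (set 'rV[R]_n)).
Arguments D {n}.
Hypothesis hD : ominimal (@D).
Variables (n : nat) (Omega : set 'rV[R]_n) (f : 'rV[R]_n -> 'rV[R]_n).
Hypothesis Omega_open : open Omega.
Hypothesis f_continuous : {within closure Omega, continuous f}.
Hypothesis f_definable : definable_map (@D) (closure Omega) f.

Lemma hull_unitmx x r A : uniformly_regular Omega f x r ->
  convex_hull (dimage Omega f (eball x r)) A -> A \in unitmx.
Proof.
move=> [_ [c c0 [_ hull]]] /hull cA; rewrite unitmxE unitfE; apply/negP => /det0P[v v0 vA].
have := cA v; rewrite vA enormE [enorm 0]enormE dot0r sqrtr0 pmulr_rle0 // -enormE.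
by rewrite leNgt enorm_gt0.
Qed.

(** Any derivative [A] taken close enough to [x] will do: the [u] of [uniformly_regular_expansive]
    is positive on all of them at once. Segments between derivatives stay in the hull of invertible
    matrices, so the sign of the determinant is constant near [x]. *)
Lemma regular_linear_like x : regular_point Omega f x ->
  exists A, [/\ A \in unitmx, linear_like f (f x) x A & Sign Omega f x = (sgz (\det A))%:~R].
Proof.
move=> /regular_point_uniform => /(_ Omega_open)[r ur].
have [r0 [c c0 [BO _]]] := ur.
have [z0 [Bz0 nz0]] := eball_nonsingular hD Omega_open f_continuous f_definable r0 BO.
have S0 : dimage Omega f (eball x r) (jacobian f z0) by exists z0.
have n0 : 0 < n.+1%:R :> R by rewrite ltr0n.
exists (jacobian f z0); split.
- by apply: hull_unitmx ur _; exact: sub_convex_hull.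
- exists (r / n.+1%:R) => [|z zx zr]; first by rewrite divr_gt0.
  have [||u [u1 u2]] := uniformly_regular_expansive hD Omega_open f_continuous f_definable ur (v := z - x).
  + by rewrite subr_eq0.
  + apply: le_lt_trans (enorm_le_norm _) _; by rewrite mulrC -ltr_pdivlMr.
  have zE : x + (z - x) = z by rewrite addrC subrK.
  by rewrite zE in u1; exists u; split=> //; exact: u2.
(* Density of the nonsingular points makes the filter proper, so that the limit defining [Sign] is
   determined. *)
- have cl : closure (Omega `\` singular_locus Omega f) x.
    move=> B /nbhs_ballP[e /= e0 eB].
    pose s := Num.min r e; have s0 : 0 < s by rewrite lt_min r0.
    have [z [Bz nz]] : exists z, eball x s z /\ (Omega `\` singular_locus Omega f) z.
      apply: (eball_nonsingular hD Omega_open f_continuous f_definable s0) => z.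
      by rewrite /eball /= lt_min => /andP[zr _]; exact: BO.
    exists z; split=> //; apply: eB; rewrite ballE.
    apply: le_lt_trans (norm_le_enorm _) _.
    by move: Bz; rewrite /eball /= lt_min => /andP[].
  have PF := within_nbhs_proper cl.
  rewrite /Sign; apply/cvg_lim => //; apply: cvg_near_cst.
  rewrite near_withinE.
  have nb : nbhs x (eball x r).
    apply: open_nbhs_nbhs; split; first exact: eball_open.
    by rewrite /eball /= subrr enormE dot0r sqrtr0.
  have sgE z : eball x r z -> (Omega `\` singular_locus Omega f) z ->
      Num.sg (\det (jacobian f z)) = (sgz (\det (jacobian f z0)))%:~R.
    move=> Bz nz; rewrite sgrEz.
    have Sz : dimage Omega f (eball x r) (jacobian f z) by exists z.
    move: (jacobian f z) (jacobian f z0) Sz S0 => A B SA SB.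
    congr (_%:~R).
    apply: det_sign_segment => t t01; rewrite -unitfE -unitmxE.
    by apply: hull_unitmx ur _; apply: convex_hull_convex t01; apply: sub_convex_hull.
  by apply: filterS nb => z; exact: sgE.
Qed.

Lemma degree_regular_zeros (W : set 'rV[R]_n) y : open W -> bounded_set W -> W `<=` Omega ->
  (forall z, boundary W z -> f z <> y) ->
  (forall x, zeros W f y x -> regular_point Omega f x) ->
  finite_set (zeros W f y) /\ (degree f W y)%:~R = \sum_(x \in zeros W f y) Sign Omega f x.
Proof.
move=> oW bW WO bf reg.
have cf : {within closure W, continuous f} by apply: continuous_subspaceW f_continuous; exact: closure_subset.
have /choice[A AP] : forall x, exists A, zeros W f y x ->
    [/\ A \in unitmx, linear_like f y x A & Sign Omega f x = (sgz (\det A))%:~R].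
  move=> x; have [zx|nz] := pselect (zeros W f y x); last by exists 0.
  have [A h] := regular_linear_like (reg x zx); exists A => _; move: h.
  by case: zx => _ ->.
have fin : finite_set (zeros W f y).
  by apply: (zeros_finite (A := A) oW bW cf bf) => x /AP[].
split=> //; rewrite (degreeE (A := A) oW bW cf bf).
- rewrite !fsbig_finite //= rmorph_sum /= big_seq [RHS]big_seq; apply: eq_bigr => x.
  by rewrite in_fset_set // => /set_mem /AP[_ _ ->].
- by move=> x /AP[].
- exact: degree_approximation_exists.
Qed.

End DegreeFormula.

Theorem theorem5p1 (R : realType) (D : forall n : nat, set (set 'rV[R]_n))
    (hD : ominimal D) (n : nat)
    (Omega : set 'rV[R]_n) (f : 'rV[R]_n -> 'rV[R]_n)
    (Omega_open : open Omega) (Omega_bounded : bounded_set Omega)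
    (Omega_definable : D n Omega)
    (f_continuous : {within closure Omega, continuous f})
    (f_definable : definable_map D (closure Omega) f) :
  (forall (x : 'rV[R]_n) (W : set 'rV[R]_n),
      regular_point Omega f x ->
      open W -> W x -> W `<=` Omega ->
      closure W `&` fiber Omega f (f x) = [set x] ->
      (degree f W (f x))%:~R = Sign Omega f x)
  /\
  (forall y : 'rV[R]_n,
      ~ (f @` boundary Omega) y ->
      regular_value Omega f y ->
      finite_set (fiber Omega f y) /\
      (degree f Omega y)%:~R = \sum_(x \in fiber Omega f y) Sign Omega f x).
Proof.
split=> [x W regx oW Wx WO fib|y nby regy].
  have bW : bounded_set W.
    by have [L L0 OL] := bounded_setP Omega_bounded; exists L; split; [exact: num_real|move=> M LM z /WO/OL zL; exact: le_trans (ltW LM)].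
  have fibE z : closure W z -> f z = f x -> z = x.
    by move=> clz fz; have : [set x] z by rewrite -fib; split=> //; split=> //; exact: closure_subset clz.
  have zE : zeros W f (f x) = [set x].
    apply/seteqP; split=> z /=; last by move=> ->.
    by move=> [Wz]; apply: fibE; exact: subset_closure.
  (* The fibre meets the closure of [W] only at [x], which is interior. *)
  have bf z : boundary W z -> f z <> f x.
    by move=> [clz iz] fz; apply: iz; rewrite (fibE z clz fz) ((interior_id _).1 oW).
  have reg z : zeros W f (f x) z -> regular_point Omega f z by rewrite zE => ->.
  have [_ ->] := degree_regular_zeros hD Omega_open f_continuous f_definable oW bW WO bf reg.
  by rewrite zE fsbig_set1.
have zE : zeros Omega f y = fiber Omega f y.
  apply/seteqP; split=> z [h fz]; split=> //; first exact: subset_closure.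
  by apply: (boundary_zeros Omega_open _ h fz) => w bw fw; apply: nby; exists w.
rewrite -zE; apply: (degree_regular_zeros hD) => //.
- by move=> z bz fz; apply: nby; exists z.
- by move=> x; rewrite zE => /regy.
Qed.
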